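(* Every completely contractive representation of a non-degenerate C$^*$-correspondence dynamical system $((X,\mathcal{C}),\mathcal{G},\alpha)$ has a minimal isometric coextension. Moreover, the minimal isometric coextension is unique up to unitary equivalence.
   Context: A C$^*$-correspondence $(X,\mathcal{C})=(X,\mathcal{C},\phi_X)$ is a C$^*$-algebra $\mathcal{C}$, a right Hilbert $\mathcal{C}$-module $X$ and a $*$-homomorphism $\phi_X:\mathcal{C}\to\mathcal{L}(X)$, non-degenerate meaning $\overline{\mathrm{span}}\,\phi_X(\mathcal{C})X=X$. A representation $(\rho,t,\mathcal{H})$ of $(X,\mathcal{C})$ is a non-degenerate $*$-homomorphism $\rho:\mathcal{C}\to B(\mathcal{H})$ and a linear map $t:X\to B(\mathcal{H})$ with $\rho(c)t(x)=t(\phi_X(c)x)$ and $t(x)\rho(c)=t(xc)$; it is isometric (Toeplitz) if $t(x)^*t(y)=\rho(\langle x,y\rangle)$, and completely contractive if $t$ is completely contractive for the operator space structure $X$ inherits from the universal C$^*$-algebra $\mathcal{T}_X$ of isometric representations. A C$^*$-correspondence dynamical system $((X,\mathcal{C}),\mathcal{G},\alpha)$ is a non-degenerate C$^*$-correspondence with a generalized gauge action of a locally compact (Hausdorff) group $\mathcal{G}$: a (point-norm continuous) homomorphism such that each $\alpha_s$ is an isometric automorphism of $X$ and a $*$-automorphism of $\mathcal{C}$ with $\alpha_s(\xi c)=\alpha_s(\xi)\alpha_s(c)$, $\alpha_s(\phi_X(c)\xi)=\phi_X(\alpha_s(c))\alpha_s(\xi)$, $\alpha_s(\langle\xi,\eta\rangle)=\langle\alpha_s(\xi),\alpha_s(\eta)\rangle$.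 A (completely contractive) representation $(\rho,t,u,\mathcal{H})$ of $((X,\mathcal{C}),\mathcal{G},\alpha)$ is a completely contractive representation $(\rho,t,\mathcal{H})$ of $(X,\mathcal{C})$ with a strongly continuous unitary representation $u:\mathcal{G}\to U(\mathcal{H})$ such that $u(s)t(\xi)=t(\alpha_s(\xi))u(s)$ and $u(s)\rho(c)=\rho(\alpha_s(c))u(s)$ for all $s,\xi,c$. It is isometric if $(\rho,t,\mathcal{H})$ is isometric. $(\rho_1,t_1,u_1,\mathcal{H}_1)$ is a dilation of $(\rho,t,u,\mathcal{H})$ if $\mathcal{H}\subseteq\mathcal{H}_1$, $\mathcal{H}$ reduces $\rho_1$ and $u_1$ with $\rho_1(c)|_{\mathcal{H}}=\rho(c)$, $u_1(g)|_{\mathcal{H}}=u(g)$, and $\mathcal{H}$ is semi-invariant for $t_1$ with $P_{\mathcal{H}}t_1(\xi)|_{\mathcal{H}}=t(\xi)$. It is a coextension if $\mathcal{H}$ is coinvariant for $t_1$ (i.e. $t_1(\xi)^*\mathcal{H}\subseteq\mathcal{H}$ for all $\xi$). It is minimal if $\mathcal{H}_1$ is the smallest reducing subspace for $t_1$ containing $\mathcal{H}$. *)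

(* Defs.v *)
From HB Require Import structures.
From mathcomp Require Import all_boot all_order all_algebra.
From mathcomp Require Import all_classical all_reals all_analysis.
From mathcomp Require Import sesquilinear complex.

Set Implicit Arguments.
Unset Strict Implicit.
Unset Printing Implicit Defensive.

Import Order.TTheory GRing.Theory Num.Theory.
Import numFieldNormedType.Exports.

Local Open Scope classical_set_scope.
Local Open Scope ring_scope.

(* All spaces are over the complex numbers R[i], R an arbitrary realType.
   Norms on modules over R[i] take their (nonnegative real) values in R[i]. *)

HB.mixin Record isTopologicalGroup G of Group G & Topological G := {
  mulg_continuous : continuous (fun x : G * G => (x.1 * x.2)%g);
  invg_continuous : continuous (fun x : G => (x^-1)%g) }.

#[short(type="topologicalGroupType")]
HB.structure Definition TopologicalGroup :=
  {G of isTopologicalGroup G & Group G & Topological G}.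

(* The inner product [hdot] is linear in its first variable. *)
HB.mixin Record isHilbert (R : realType) H of CompleteNormedModule R[i] H := {
  hdot : {dot H for (@Num.conj R[i])};
  hdot_norm : forall h : H, `|h| ^+ 2 = hdot h h }.

#[short(type="hilbertType")]
HB.structure Definition Hilbert (R : realType) :=
  {H of isHilbert R H & CompleteNormedModule R[i] H}.

(* Not necessarily unital, so the product is not a ring structure of the
   library. *)
HB.mixin Record isCstarAlgebra (R : realType) A
    of CompleteNormedModule R[i] A := {
  cmul : A -> A -> A;
  cstar : A -> A;
  cmulA : associative cmul;
  cmulDl : left_distributive cmul +%R;
  cmulDr : right_distributive cmul +%R;
  cmulZl : forall (k : R[i]) a b, cmul (k *: a) b = k *: cmul a b;
  cmulZr : forall (k : R[i]) a b, cmul a (k *: b) = k *: cmul a b;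
  cstarK : involutive cstar;
  cstarD : {morph cstar : a b / a + b};
  cstarZ : forall (k : R[i]) a, cstar (k *: a) = k^* *: cstar a;
  cstarM : {morph cstar : a b / cmul a b >-> cmul b a};
  cnormM : forall a b : A, `|cmul a b| <= `|a| * `|b|;
  cnorm_star : forall a : A, `|cmul (cstar a) a| = `|a| ^+ 2 }.

#[short(type="cstarType")]
HB.structure Definition CstarAlgebra (R : realType) :=
  {A of isCstarAlgebra R A & CompleteNormedModule R[i] A}.

Definition cpositive (R : realType) (A : cstarType R) (a : A) :=
  exists b : A, a = cmul (cstar b) b.

(* Right Hilbert modules; [minner] is linear in its second variable. *)
HB.mixin Record isHilbertModule (R : realType) (A : cstarType R) X
    of CompleteNormedModule R[i] X := {
  mact : X -> A -> X;
  mactDl : forall x y a, mact (x + y) a = mact x a + mact y a;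
  mactDr : forall x a b, mact x (a + b) = mact x a + mact x b;
  mactZl : forall (k : R[i]) x a, mact (k *: x) a = k *: mact x a;
  mactZr : forall (k : R[i]) x a, mact x (k *: a) = k *: mact x a;
  mactM : forall x a b, mact x (cmul a b) = mact (mact x a) b;
  minner : X -> X -> A;
  minnerDr : forall x y z, minner x (y + z) = minner x y + minner x z;
  minnerZr : forall (k : R[i]) x y, minner x (k *: y) = k *: minner x y;
  minnerMr : forall x y a, minner x (mact y a) = cmul (minner x y) a;
  minner_star : forall x y, cstar (minner x y) = minner y x;
  minner_pos : forall x, cpositive (minner x x);
  minner_norm : forall x : X, `|x| ^+ 2 = `|minner x x| }.

#[short(type="hilbertModType")]
HB.structure Definition HilbertModule (R : realType) (A : cstarType R) :=
  {X of isHilbertModule R A X & CompleteNormedModule R[i] X}.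

(* A *-homomorphism phi from A to the adjointable operators on X. Membership in
   L(X) is part of [corr_star]: phi (a^* ) is an adjoint of phi a. Linearity and
   boundedness of each phi a follow from this. *)
Record correspondence (R : realType) (A : cstarType R) (X : hilbertModType A) :=
  Correspondence {
  corr_phi :> A -> X -> X;
  corr_star : forall a x y,
    minner (corr_phi a x) y = minner x (corr_phi (cstar a) y);
  corr_linear : forall (k : R[i]) a b x,
    corr_phi (k *: a + b) x = k *: corr_phi a x + corr_phi b x;
  corr_mul : forall a b x, corr_phi (cmul a b) x = corr_phi a (corr_phi b x) }.

(* The closed linear span of the vectors (f i v) is the whole space; no scalars
   are needed in the sums since every f i used below is linear. *)
Definition total_range (R : realType) (V : normedModType R[i]) (I : Type)
    (f : I -> V -> V) :=
  closure [set w | exists (n : nat) (i : 'I_n -> I) (v : 'I_n -> V),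
                     w = \sum_(j < n) f (i j) (v j)] = setT.

Definition nondegenerate_correspondence (R : realType) (A : cstarType R)
    (X : hilbertModType A) (phi : correspondence X) := total_range phi.

Section Operators.
Variable R : realType.

Definition bounded_op (H K : hilbertType R) (T : H -> K) :=
  linear T /\ continuous T.

(* The Hilbert space adjoint; unique, and existing for bounded T by the Riesz
   representation theorem. *)
Definition adj (H K : hilbertType R) (T : H -> K) : K -> H :=
  xget (fun=> 0) [set S | forall h k, hdot (T h) k = hdot h (S k)].

Definition isometry_op (H K : hilbertType R) (V : H -> K) :=
  linear V /\ forall h, `|V h| = `|h|.

Definition unitary_op (H K : hilbertType R) (W : H -> K) :=
  isometry_op W /\ forall k, exists h, W h = k.

(* Norm of an n x n matrix of operators acting on the Hilbert sum of n copies
   of H. *)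
Definition opmx_norm (H : hilbertType R) (n : nat) (T : 'M[H -> H]_n) : \bar R :=
  ereal_sup
    [set (Num.sqrt (complex.Re (\sum_i `|\sum_j T i j (h j)| ^+ 2)))%:E
    | h in [set h : 'I_n -> H | \sum_j `|h j| ^+ 2 <= 1]].

Definition closed_subspace (H : hilbertType R) (M : set H) :=
  [/\ closed M, M 0 & forall (k : R[i]) h h', M h -> M h' -> M (k *: h + h')].

Definition op_invariant (H : hilbertType R) (I : Type) (F : I -> H -> H)
    (M : set H) :=
  forall i h, M h -> M (F i h).

Definition op_coinvariant (H : hilbertType R) (I : Type) (F : I -> H -> H)
    (M : set H) :=
  forall i h, M h -> M (adj (F i) h).

Definition reducing (H : hilbertType R) (I : Type) (F : I -> H -> H)
    (M : set H) :=
  [/\ closed_subspace M, op_invariant F M & op_coinvariant F M].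

Definition orthocompl (H : hilbertType R) (M : set H) : set H :=
  [set h | forall k, M k -> hdot h k = 0].

Definition semi_invariant (H : hilbertType R) (I : Type) (F : I -> H -> H)
    (M : set H) :=
  exists N1 N2 : set H,
    [/\ closed_subspace N1 /\ op_invariant F N1,
        closed_subspace N2 /\ op_invariant F N2,
        N2 `<=` N1 & M = N1 `&` orthocompl N2].

End Operators.

Section Representations.
Variables (R : realType) (A : cstarType R) (X : hilbertModType A).
Variable phi : correspondence X.

Record representation (H : hilbertType R)
    (rho : A -> H -> H) (t : X -> H -> H) : Prop := {
  rho_bounded : forall a, bounded_op (rho a);
  rho_linear : forall (k : R[i]) a b h,
    rho (k *: a + b) h = k *: rho a h + rho b h;
  rho_mul : forall a b h, rho (cmul a b) h = rho a (rho b h);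
  rho_star : forall a, rho (cstar a) = adj (rho a);
  rho_nondegenerate : total_range rho;
  t_bounded : forall x, bounded_op (t x);
  t_linear : forall (k : R[i]) x y h,
    t (k *: x + y) h = k *: t x h + t y h;
  t_left : forall a x h, rho a (t x h) = t (phi a x) h;
  t_right : forall a x h, t x (rho a h) = t (mact x a) h }.

Definition toeplitz (H : hilbertType R)
    (rho : A -> H -> H) (t : X -> H -> H) :=
  forall x y h, adj (t x) (t y h) = rho (minner x y) h.

Definition isometric_representation (H : hilbertType R)
    (rho : A -> H -> H) (t : X -> H -> H) :=
  representation rho t /\ toeplitz rho t.

(* *-polynomials in the generators of the Toeplitz algebra T_X. The universal
   C*-algebra T_X is their separated completion for [toeplitz_mxnorm] with
   n = 1, and [toeplitz_mxnorm] is the norm of M_n(T_X) on matrices of such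
   polynomials. *)
Inductive toeplitz_poly : Type :=
  | ToeplitzC of A
  | ToeplitzX of X
  | ToeplitzAdd of toeplitz_poly & toeplitz_poly
  | ToeplitzScale of R[i] & toeplitz_poly
  | ToeplitzMul of toeplitz_poly & toeplitz_poly
  | ToeplitzStar of toeplitz_poly.

Fixpoint toeplitz_eval (H : hilbertType R) (rho : A -> H -> H)
    (t : X -> H -> H) (p : toeplitz_poly) : H -> H :=
  match p with
  | ToeplitzC a => rho a
  | ToeplitzX x => t x
  | ToeplitzAdd p q =>
      fun h => toeplitz_eval rho t p h + toeplitz_eval rho t q h
  | ToeplitzScale k p => fun h => k *: toeplitz_eval rho t p h
  | ToeplitzMul p q => fun h => toeplitz_eval rho t p (toeplitz_eval rho t q h)
  | ToeplitzStar p => adj (toeplitz_eval rho t p)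
  end.

Definition toeplitz_mxnorm (n : nat) (p : 'M[toeplitz_poly]_n) : \bar R :=
  ereal_sup [set r | exists (K : hilbertType R)
                            (sigma : A -> K -> K) (s : X -> K -> K),
    isometric_representation sigma s /\
    r = opmx_norm (map_mx (toeplitz_eval sigma s) p)].

(* X carries the matrix norms it inherits as a subspace of T_X. *)
Definition completely_contractive (H : hilbertType R) (t : X -> H -> H) :=
  forall (n : nat) (x : 'M[X]_n),
    (opmx_norm (map_mx t x) <= toeplitz_mxnorm (map_mx ToeplitzX x))%E.

End Representations.

Section DynamicalSystems.
Variables (R : realType) (A : cstarType R) (X : hilbertModType A).
Variables (phi : correspondence X) (G : topologicalGroupType).

Record gauge_action := GaugeAction {
  actC : G -> A -> A;
  actX : G -> X -> X;
  actC_mul : forall r s a, actC (r * s)%g a = actC r (actC s a);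
  actX_mul : forall r s x, actX (r * s)%g x = actX r (actX s x);
  actC_continuous : forall a, continuous (fun s => actC s a);
  actX_continuous : forall x, continuous (fun s => actX s x);
  actC_bij : forall s, bijective (actC s);
  actC_linear : forall s, linear (actC s);
  actC_cmul : forall s, {morph actC s : a b / cmul a b};
  actC_star : forall s, {morph actC s : a / cstar a};
  actX_bij : forall s, bijective (actX s);
  actX_linear : forall s, linear (actX s);
  actX_norm : forall s x, `|actX s x| = `|x|;
  act_right : forall s x a, actX s (mact x a) = mact (actX s x) (actC s a);
  act_left : forall s a x, actX s (phi a x) = phi (actC s a) (actX s x);
  act_inner : forall s x y,
    actC s (minner x y) = minner (actX s x) (actX s y) }.

Variable alpha : gauge_action.

Record unitary_representation (H : hilbertType R) (u : G -> H -> H) : Prop := {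
  u_unitary : forall s, unitary_op (u s);
  u_mul : forall r s h, u (r * s)%g h = u r (u s h);
  u_continuous : forall h, continuous (fun s => u s h) }.

Record covariant_rep := CovariantRep {
  rep_space : hilbertType R;
  rep_rho : A -> rep_space -> rep_space;
  rep_t : X -> rep_space -> rep_space;
  rep_u : G -> rep_space -> rep_space;
  rep_representation : representation phi rep_rho rep_t;
  rep_cc : completely_contractive phi rep_t;
  rep_unitary : unitary_representation rep_u;
  rep_cov_t : forall s x h,
    rep_u s (rep_t x h) = rep_t (actX alpha s x) (rep_u s h);
  rep_cov_rho : forall s a h,
    rep_u s (rep_rho a h) = rep_rho (actC alpha s a) (rep_u s h) }.

Definition isometric (pi : covariant_rep) := toeplitz (@rep_rho pi) (@rep_t pi).

(* The inclusion of H in H_1 is an isometric embedding V; the restriction of an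
   operator T of H_1 to H is T \o V, and compressing to H amounts to applying
   V^*. *)
Record dilation (pi pi1 : covariant_rep)
    (V : rep_space pi -> rep_space pi1) : Prop := {
  dil_isometry : isometry_op V;
  dil_reducing_rho : reducing (@rep_rho pi1) (range V);
  dil_reducing_u : reducing (@rep_u pi1) (range V);
  dil_rho : forall a h, rep_rho a (V h) = V (rep_rho a h);
  dil_u : forall s h, rep_u s (V h) = V (rep_u s h);
  dil_semi_invariant : semi_invariant (@rep_t pi1) (range V);
  dil_t : forall x h, adj V (rep_t x (V h)) = rep_t x h }.

Definition coextension (pi pi1 : covariant_rep)
    (V : rep_space pi -> rep_space pi1) :=
  dilation V /\ op_coinvariant (@rep_t pi1) (range V).

Definition minimal (pi pi1 : covariant_rep)
    (V : rep_space pi -> rep_space pi1) :=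
  forall M : set (rep_space pi1),
    reducing (@rep_t pi1) M -> range V `<=` M -> M = setT.

Definition minimal_isometric_coextension (pi pi1 : covariant_rep)
    (V : rep_space pi -> rep_space pi1) :=
  [/\ isometric pi1, coextension V & minimal V].

(* Unitary equivalence of two dilations of the same representation: the unitary
   fixes the common subspace. *)
Definition unitarily_equivalent (pi pi1 pi2 : covariant_rep)
    (V1 : rep_space pi -> rep_space pi1)
    (V2 : rep_space pi -> rep_space pi2) :=
  exists W : rep_space pi1 -> rep_space pi2,
    [/\ unitary_op W,
        forall h, W (V1 h) = V2 h,
        forall a h, W (rep_rho a h) = rep_rho a (W h),
        forall x h, W (rep_t x h) = rep_t x (W h)
      & forall s h, W (rep_u s h) = rep_u s (W h)].

End DynamicalSystems.

(* Main.v *)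
Require Import Defs.
From HB Require Import structures.
From mathcomp Require Import all_boot all_order all_algebra.
From mathcomp Require Import all_classical all_reals all_analysis.
From mathcomp Require Import sesquilinear complex ring lra.

(* A minimal isometric coextension of (rho, t, u) is spanned by the vectors
   t_1(x_1)...t_1(x_n) h with h in H, and coinvariance of H together with the
   Toeplitz relation determines their inner products: peeling off the first
   letters of two words leaves rho_1(<y_1, x_1>), which acts on the next letter
   through phi, and an empty word turns the other one into t(y_1)...t(y_m) k.
   Uniqueness follows, since matching the words of two such coextensions is a
   densely defined isometry with dense range.

   For existence, the same formula defines a sesquilinear form on formal words,
   the coextension lives on the completed quotient, and all operators act on
   words; nondegeneracy of phi makes the new representation of the C*-algebra
   nondegenerate. Positivity of the form reduces, by induction on the length of
   the words, to the row contractivity of t, i.e. to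
     |sum_i t(x_i) h_i|^2 <= sum_ij (rho(<x_j, x_i>) h_i, h_j).
   If the Gram matrix of the row x is the identity, this is complete
   contractivity applied to x; a general row is first multiplied by an
   approximate inverse square root of its Gram matrix. *)

Set Implicit Arguments.
Unset Strict Implicit.
Unset Printing Implicit Defensive.

Import Order.TTheory GRing.Theory Num.Theory.
Import numFieldNormedType.Exports.

Local Open Scope classical_set_scope.
Local Open Scope ring_scope.

(** The induction behind positivity cannot carry the form K itself. It carries the defect K(w,v) -
    (w(t)h, v(t)k), the part of the form orthogonal to H. Peeling off first letters splits the
    defect into the defect of the shorter words, amplified by the Gram matrix of these letters, plus
    the gap between the two sides of the row inequality. The amplified term is positive because Gram
    matrices are positive in every *-representation. This is needed on spaces that are neither
    complete nor separated, so boundedness there is obtained algebraically, from a square root of 1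
    - a^* a.

    In the row inequality the two factors are balanced: with Y = 1 - c (G + e), the extended row has
    squared norm at most 2/c in every isometric representation, and the vector paired with it has
    squared norm at most c/2 times the right-hand side plus e |h|^2. The constants cancel, the sums
    over powers of Y telescope, and only a geometrically small remainder is left. *)

Local Notation Re := complex.Re.
Local Notation Im := complex.Im.

(** * Complex numbers through real and imaginary parts *)

Section ComplexParts.
Variable R : realType.
Implicit Types (x y z : R[i]) (r : R).

Lemma eq_ReIm x y : Re x = Re y -> Im x = Im y -> x = y.
Proof. by case: x y => [a b] [c d] /= -> ->. Qed.

Lemma cRe_add x y : Re (x + y) = Re x + Re y. Proof. by case: x y => [? ?] []. Qed.
Lemma cIm_add x y : Im (x + y) = Im x + Im y. Proof. by case: x y => [? ?] []. Qed.
Lemma cRe_opp x : Re (- x) = - Re x. Proof. by case: x. Qed.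
Lemma cIm_opp x : Im (- x) = - Im x. Proof. by case: x. Qed.
Lemma cRe_mul x y : Re (x * y) = Re x * Re y - Im x * Im y.
Proof. by case: x y => [? ?] []. Qed.
Lemma cIm_mul x y : Im (x * y) = Re x * Im y + Im x * Re y.
Proof. by case: x y => [? ?] []. Qed.
Lemma cRe_conj x : Re (x^*) = Re x. Proof. by case: x. Qed.
Lemma cIm_conj x : Im (x^*) = - Im x. Proof. by case: x. Qed.
Lemma cRe_real r : Re (r%:C)%C = r. Proof. by []. Qed.
Lemma cIm_real r : Im (r%:C)%C = 0. Proof. by []. Qed.
Lemma cRe_zero : Re (0 : R[i]) = 0. Proof. by []. Qed.
Lemma cIm_zero : Im (0 : R[i]) = 0. Proof. by []. Qed.
Lemma cRe_one : Re (1 : R[i]) = 1. Proof. by []. Qed.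
Lemma cIm_one : Im (1 : R[i]) = 0. Proof. by []. Qed.
Definition ReImE := (cRe_add, cIm_add, cRe_opp, cIm_opp, cRe_mul, cIm_mul, cRe_conj,
  cIm_conj, cRe_real, cIm_real, cRe_zero, cIm_zero, cRe_one, cIm_one).

Lemma conjC_real r : ((r%:C)%C : R[i])^* = (r%:C)%C.
Proof. by apply: eq_ReIm; rewrite !ReImE ?oppr0. Qed.

Lemma cRe_sum I (s : seq I) (P : pred I) (F : I -> R[i]) :
  Re (\sum_(i <- s | P i) F i) = \sum_(i <- s | P i) Re (F i).
Proof. exact: (big_morph (@complex.Re R) (@cRe_add) (@cRe_zero)). Qed.

Definition nsq x := Re x ^+ 2 + Im x ^+ 2.

End ComplexParts.

Ltac cring := apply: eq_ReIm; rewrite !ReImE; ring.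

(** * Real-valued norms and the topology they define *)

Section RealNorm.
Variable R : realType.

(** Norms take values in R[i]; their real parts are used throughout, so that real ordered arithmetic
    applies. *)
Definition rnorm (V : normedZmodType R[i]) (x : V) : R := Re `|x|.

Section Zmod.
Variable V : normedZmodType R[i].
Implicit Types x y : V.

Lemma normr_rnorm x : `|x| = (rnorm x)%:C%C.
Proof. by rewrite /rnorm RRe_real //; exact: normr_real. Qed.

Lemma rnorm_ge0 x : 0 <= rnorm x.
Proof. rewrite -lecR -normr_rnorm; exact: normr_ge0. Qed.
Lemma rnorm0 : rnorm (0 : V) = 0. Proof. by rewrite /rnorm normr0. Qed.
Lemma rnorm_eq0 x : rnorm x = 0 -> x = 0.
Proof. by move=> x0; apply/normr0_eq0; rewrite normr_rnorm x0. Qed.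
Lemma rnormN x : rnorm (- x) = rnorm x. Proof. by rewrite /rnorm normrN. Qed.
Lemma rnormBC x y : rnorm (x - y) = rnorm (y - x).
Proof. by rewrite -opprB rnormN. Qed.
Lemma rnormD x y : rnorm (x + y) <= rnorm x + rnorm y.
Proof. by rewrite -lecR rmorphD /= -!normr_rnorm ler_normD. Qed.
Lemma rnorm_tri z x y : rnorm (x - y) <= rnorm (x - z) + rnorm (z - y).
Proof. by apply: le_trans (rnormD _ _); rewrite addrA subrK. Qed.
Lemma rnorm_sum I (s : seq I) (P : pred I) (F : I -> V) :
  rnorm (\sum_(i <- s | P i) F i) <= \sum_(i <- s | P i) rnorm (F i).
Proof.
apply: (big_ind2 (fun (a : V) b => rnorm a <= b)) => //; first by rewrite rnorm0.
by move=> a b c d ab cd; apply: le_trans (rnormD _ _) _; exact: lerD.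
Qed.
End Zmod.

Lemma nsq_rnorm (z : R[i]) : nsq z = rnorm z ^+ 2.
Proof.
apply: (@complexI R); rewrite /nsq add_Re2_Im2 normr_rnorm.
by rewrite -rmorphXn.
Qed.

Lemma Re_le_rnorm (z : R[i]) : Re z <= rnorm z.
Proof.
rewrite -lecR -normr_rnorm (le_trans _ (normc_ge_Re z)) //.
by rewrite lecR ler_norm.
Qed.

Lemma rnorm_real (r : R) : rnorm (r%:C)%C = `|r|.
Proof. by rewrite /rnorm normc_def /= expr0n addr0 sqrtr_sqr. Qed.

Lemma rnormZ (V : normedModType R[i]) (k : R[i]) (x : V) :
  rnorm (k *: x) = rnorm k * rnorm x.
Proof. by apply: (@complexI R); rewrite rmorphM /= -!normr_rnorm normrZ. Qed.

Lemma pos_complex (e : R[i]) : 0 < e -> e = (Re e)%:C%C /\ 0 < Re e.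
Proof.
by rewrite ltcE => /andP[/eqP ie re]; split=> //; apply: eq_ReIm; rewrite ?ie.
Qed.

Section Top.
Variable V : normedModType R[i].
Implicit Types (x y : V) (S : set V).

Lemma ball_rnorm x (e : R) : ball x (e%:C)%C = [set y | rnorm (x - y) < e].
Proof.
rewrite -ball_normE; apply/seteqP; split=> y /=;
  by rewrite normr_rnorm ltcR.
Qed.

Lemma nbhs_rnorm x S : nbhs x S <->
  exists2 e : R, 0 < e & forall y, rnorm (x - y) < e -> S y.
Proof.
split.
  move=> /nbhs_ballP[e /= e0 sub]; have [ee re] := pos_complex e0.
  exists (Re e) => // y xy; apply: sub.
  by rewrite ee ball_rnorm.
move=> [e e0 sub]; apply/nbhs_ballP; exists (e%:C)%C => /=; first by rewrite ltcR.
by rewrite ball_rnorm.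
Qed.

Lemma closureP S x : closure S x <->
  forall e : R, 0 < e -> exists2 y, S y & rnorm (x - y) < e.
Proof.
split=> [cl e e0|H B /nbhs_rnorm[e e0 sub]].
  have [|y [Sy xy]] := cl [set y | rnorm (x - y) < e]; last by exists y.
  by apply/nbhs_rnorm; exists e.
by have [y Sy xy] := H e e0; exists y; split => //; exact: sub.
Qed.

Lemma cvg_rnorm T (F : set_system T) (FF : Filter F) (f : T -> V) x :
  f @ F --> x <-> forall e : R, 0 < e -> \forall t \near F, rnorm (x - f t) < e.
Proof.
split=> [fx e e0|H].
  by apply: (fx [set y | rnorm (x - y) < e]); apply/nbhs_rnorm; exists e.
move=> B /nbhs_rnorm[e e0 sub]; apply: filterS (H e e0) => t; exact: sub.
Qed.

Lemma closed_rnorm S : closed S <-> forall x,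
  (forall e : R, 0 < e -> exists2 y, S y & rnorm (x - y) < e) -> S x.
Proof.
split=> [cl x /closureP|H x /closureP]; [exact: cl|exact: H].
Qed.

Lemma rnorm_small x y : (forall e : R, 0 < e -> rnorm (x - y) < e) -> x = y.
Proof.
move=> H; apply/subr0_eq/rnorm_eq0/eqP; rewrite eq_le rnorm_ge0 andbT leNgt.
by apply/negP => /H; rewrite ltxx.
Qed.
End Top.

Definition rate (n : nat) : R := n.+1%:R^-1.

Lemma rate_gt0 n : 0 < rate n. Proof. by rewrite invr_gt0. Qed.

Lemma rate_small (e : R) : 0 < e -> exists n, rate n < e.
Proof.
move=> e0; exists (Num.truncn e^-1).
rewrite /rate -ltf_pV2 ?posrE ?invr_gt0 // invrK.
by have /andP[] := truncn_itv (ltW (eqbRL (invr_gt0 e) e0)).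
Qed.

Lemma rate_small_le (e : R) : 0 < e ->
  exists N, forall n, (N <= n)%N -> rate n < e.
Proof.
move=> /rate_small[N Ne]; exists N => n Nn; apply: le_lt_trans Ne.
by rewrite lef_pV2 ?posrE // ler_nat.
Qed.

Lemma le_rate (a b c : R) : 0 <= c -> (forall n, a <= b + c * rate n) -> a <= b.
Proof.
move=> c0 H; rewrite leNgt; apply/negP => ba.
have e0 : 0 < (a - b) / (c + 1) by rewrite divr_gt0 ?subr_gt0 // ltr_wpDl.
have [n ne] := rate_small e0; have := H n.
have c1 : 0 < c + 1 by rewrite ltr_wpDl.
move: ne; rewrite ltr_pdivlMr // => ne.
have := rate_gt0 n; lra.
Qed.

(** The explicit modulus passes to the limit: letting m grow in the hypothesis leaves [rate n].
    Approximants chosen with error [rate n] thus converge without passing to subsequences. *)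
Lemma complete_rate (V : completeNormedModType R[i]) (x : nat -> V) :
  (forall m n, rnorm (x m - x n) <= rate m + rate n) ->
  exists l, forall n, rnorm (x n - l) <= rate n.
Proof.
move=> H.
have cx : cauchy (x @ \oo).
  apply: cauchy_exP => e e0; have [ee re] := pos_complex e0.
  have e20 : 0 < Re e / 2 by rewrite divr_gt0.
  have [N NP] := rate_small_le e20.
  exists (x N); exists N => // n /= Nn; rewrite ee ball_rnorm /=.
  by apply: le_lt_trans (H _ _) _; rewrite [ltRHS](splitr (Re e)) ltrD // NP.
have /cvg_ex[l xl] : cvg (x @ \oo) by apply: cauchy_cvg.
exists l => n; apply/ler_addgt0Pr => e e0.
have e20 : 0 < e / 2 by rewrite divr_gt0.
have [N NP] := rate_small_le e20.
have xl' := proj1 (cvg_rnorm _ _ _) xl.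
near \oo => m.
apply: le_trans (rnorm_tri (x m) _ _) _; rewrite (splitr e) addrA lerD //.
  apply: le_trans (H _ _) _; rewrite lerD2l; apply/ltW/NP; near: m; by exists N.
by rewrite rnormBC ltW //; near: m; exact: xl'.
Unshelve. all: by end_near. Qed.

End RealNorm.

Ltac rnorm_lra := repeat match goal with
  |- context [@rnorm ?R ?V ?x] => move: (@rnorm R V x) => ? end; lra.

(** * Sequential limits and completeness of the complex numbers *)

Section Limits.
Variable R : realType.

Definition slim (V : normedZmodType R[i]) (x : nat -> V) (l : V) :=
  forall e : R, 0 < e -> exists N, forall n, (N <= n)%N -> rnorm (x n - l) < e.

Lemma slim_unique (V : normedModType R[i]) (x : nat -> V) l l' :
  slim x l -> slim x l' -> l = l'.
Proof.
move=> xl xl'; apply: rnorm_small => e e0.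
have e20 : 0 < e / 2 by rewrite divr_gt0.
have [N1 H1] := xl _ e20; have [N2 H2] := xl' _ e20.
apply: le_lt_trans (rnorm_tri (x (maxn N1 N2)) _ _) _.
rewrite (splitr e) ltrD //; last by apply: H2; rewrite leq_maxr.
by rewrite rnormBC; apply: H1; rewrite leq_maxl.
Qed.

Lemma rnormM (x y : R[i]) : rnorm (x * y) = rnorm x * rnorm y.
Proof. by apply: (@complexI R); rewrite rmorphM /= -!normr_rnorm normrM. Qed.

Lemma rnorm_conj (x : R[i]) : rnorm (x^*) = rnorm x.
Proof. by rewrite /rnorm norm_conjC. Qed.

Lemma rnorm_ReIm (z : R[i]) : rnorm z <= `|Re z| + `|Im z|.
Proof.
rewrite {1}(complexE z) (le_trans (rnormD _ _)) //.
rewrite rnormM !rnorm_real.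
have -> : rnorm ('i%C : R[i]) = 1.
  by rewrite /rnorm normc_def /= expr0n expr1n add0r sqrtr1.
by rewrite mul1r.
Qed.

Lemma Re_le (z : R[i]) : `|Re z| <= rnorm z.
Proof. by rewrite -lecR -normr_rnorm normc_ge_Re. Qed.

Lemma Im_le (z : R[i]) : `|Im z| <= rnorm z.
Proof.
have -> : Im z = Re (- (z * 'i%C)) by rewrite cRe_opp ReiNIm opprK.
apply: le_trans (Re_le _) _; rewrite rnormN rnormM.
have -> : rnorm ('i%C : R[i]) = 1.
  by rewrite /rnorm normc_def /= expr0n expr1n add0r sqrtr1.
by rewrite mulr1.
Qed.

Lemma real_complete (x : nat -> R) :
  (forall e, 0 < e -> exists N, forall m n, (N <= m)%N -> (N <= n)%N ->
     `|x m - x n| < e) ->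
  exists l, forall e, 0 < e -> exists N, forall n, (N <= n)%N -> `|x n - l| < e.
Proof.
move=> H.
have cx : cauchy (x @ \oo).
  apply: cauchy_exP => e e0; have [N NP] := H e e0.
  by exists (x N); exists N => // n /= Nn; rewrite -ball_normE /=; apply: NP.
have /cvg_ex[l xl] : cvg (x @ \oo) by apply: cauchy_cvg.
exists l => e e0.
have /cvgrPdist_lt /(_ e e0) [N _ NP] := xl.
by exists N => n Nn; rewrite distrC; exact: NP.
Qed.

Lemma complex_complete (x : nat -> R[i]) :
  (forall e : R, 0 < e -> exists N, forall m n, (N <= m)%N -> (N <= n)%N ->
     rnorm (x m - x n) < e) -> exists l, slim x l.
Proof.
move=> H.
have [a Ha] : exists l, forall e, 0 < e -> exists N, forall n, (N <= n)%N ->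
    `|Re (x n) - l| < e.
  apply: real_complete => e /H[N NP]; exists N => m n Nm Nn.
  by apply: le_lt_trans (NP m n Nm Nn); rewrite -cRe_opp -cRe_add Re_le.
have [b Hb] : exists l, forall e, 0 < e -> exists N, forall n, (N <= n)%N ->
    `|Im (x n) - l| < e.
  apply: real_complete => e /H[N NP]; exists N => m n Nm Nn.
  by apply: le_lt_trans (NP m n Nm Nn); rewrite -cIm_opp -cIm_add Im_le.
exists (Complex a b) => e e0; have e20 : 0 < e / 2 by rewrite divr_gt0.
have [N1 H1] := Ha _ e20; have [N2 H2] := Hb _ e20.
exists (maxn N1 N2) => n; rewrite geq_max => /andP[n1 n2].
apply: le_lt_trans (rnorm_ReIm _) _; rewrite !ReImE /= (splitr e).
by rewrite ltrD // ?H1 ?H2.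
Qed.

Lemma slim_cst (V : normedZmodType R[i]) (l : V) : slim (fun=> l) l.
Proof. by move=> e e0; exists 0%N => n _; rewrite subrr rnorm0. Qed.

Lemma slim_add (V : normedZmodType R[i]) (x y : nat -> V) l l' :
  slim x l -> slim y l' -> slim (fun n => x n + y n) (l + l').
Proof.
move=> xl yl e e0; have e20 : 0 < e / 2 by rewrite divr_gt0.
have [N1 H1] := xl _ e20; have [N2 H2] := yl _ e20.
exists (maxn N1 N2) => n; rewrite geq_max => /andP[n1 n2].
rewrite opprD addrACA (splitr e); apply: le_lt_trans (rnormD _ _) _.
by rewrite ltrD ?H1 ?H2.
Qed.

Lemma slim_lip (V W : normedZmodType R[i]) (f : V -> W) (c : R) (x : nat -> V) l :
  (forall y z, rnorm (f y - f z) <= c * rnorm (y - z)) ->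
  slim x l -> slim (fun n => f (x n)) (f l).
Proof.
move=> H xl e e0.
have c0 : 0 < `|c| + 1 by rewrite ltr_wpDl.
have [|N NP] := xl (e / (`|c| + 1)); first by rewrite divr_gt0.
exists N => n /NP; rewrite ltr_pdivlMr // => lt.
apply: le_lt_trans (H _ _) _; apply: le_lt_trans lt.
rewrite mulrC ler_wpM2l ?rnorm_ge0 //.
by have := ler_norm c; lra.
Qed.

Lemma slim_mull (k : R[i]) (x : nat -> R[i]) l :
  slim x l -> slim (fun n => k * x n) (k * l).
Proof.
apply: (slim_lip (f := fun z => k * z) (c := rnorm k)) => y z.
by rewrite -mulrBr rnormM.
Qed.

Lemma slim_conj (x : nat -> R[i]) l : slim x l -> slim (fun n => (x n)^*) l^*.
Proof.
apply: (slim_lip (f := fun z => z^*) (c := 1)) => y z.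
by rewrite -rmorphB rnorm_conj mul1r.
Qed.

Lemma slim_le (x : nat -> R[i]) l (a : R) :
  slim x l -> (exists N, forall n, (N <= n)%N -> Re (x n) <= a) -> Re l <= a.
Proof.
move=> xl [M H]; apply/ler_addgt0Pr => e e0; have [N NP] := xl e e0.
have := NP (maxn M N) (leq_maxr _ _).
rewrite rnormBC => /(le_lt_trans (Re_le_rnorm _)).
rewrite !ReImE => lt; have := H (maxn M N) (leq_maxl _ _); lra.
Qed.

Lemma slim_ge (x : nat -> R[i]) l (a : R) :
  slim x l -> (forall n, a <= Re (x n)) -> a <= Re l.
Proof.
move=> xl H; rewrite -lerN2 -cRe_opp.
have xl' := slim_mull (-1) xl; rewrite mulN1r in xl'.
by apply: (slim_le xl'); exists 0%N => n _; rewrite mulN1r cRe_opp lerN2.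
Qed.

Lemma rate_slim (V : normedZmodType R[i]) (x : nat -> V) l :
  (forall n, rnorm (x n - l) <= rate R n) -> slim x l.
Proof.
move=> H e /rate_small_le[N NP]; exists N => n /NP; exact: le_lt_trans.
Qed.

End Limits.

(** No vector space structure is asked for: [ph_comb c x y] has to behave like c x + y only inside
    the form, which may be degenerate. The main instance consists of lists of words, where addition
    is concatenation. *)
Record prehilbert (R : realType) := PreHilbert {
  ph_car :> Type;
  ph_dot : ph_car -> ph_car -> R[i];
  ph_comb : R[i] -> ph_car -> ph_car -> ph_car;
  ph_pt : ph_car;
  ph_dotP : forall c x y v,
    ph_dot (ph_comb c x y) v = c * ph_dot x v + ph_dot y v;
  ph_dotC : forall x y, ph_dot x y = (ph_dot y x)^*;
  ph_dot_ge0 : forall x, 0 <= Re (ph_dot x x) }.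

(** * The seminorm of a pre-Hilbert space *)

Section PreHilbertTheory.
Variables (R : realType) (E : prehilbert R).
Implicit Types (x y v : E) (c : R[i]).
Local Notation "<< x , y >>" := (ph_dot x y).
Local Notation comb := (@ph_comb R E).

Lemma ph_dotPr c x y v : <<v, comb c x y>> = c^* * <<v, x>> + <<v, y>>.
Proof. by rewrite ph_dotC ph_dotP rmorphD rmorphM /= -!ph_dotC. Qed.

Definition hn x : R := Num.sqrt (Re <<x, x>>).

Lemma hn_ge0 x : 0 <= hn x. Proof. exact: sqrtr_ge0. Qed.
Lemma hn_sqr x : hn x ^+ 2 = Re <<x, x>>. Proof. by rewrite sqr_sqrtr ?ph_dot_ge0. Qed.

Lemma Im_dot x : Im <<x, x>> = 0.
Proof.
by have := congr1 (@complex.Im R) (ph_dotC x x); rewrite cIm_conj; lra.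
Qed.

Lemma dot_hn x : <<x, x>> = ((hn x ^+ 2)%:C)%C.
Proof. by rewrite hn_sqr; apply: eq_ReIm => //; rewrite Im_dot. Qed.

Lemma Re_dot_comb c x y : Re <<comb c x y, comb c x y>> =
  nsq c * Re <<x, x>> + 2 * Re (c * <<x, y>>) + Re <<y, y>>.
Proof.
rewrite ph_dotP !ph_dotPr (ph_dotC y x) !ReImE.
rewrite /nsq !Im_dot; ring.
Qed.

Lemma CauchySchwarz x y : rnorm <<x, y>> <= hn x * hn y.
Proof.
rewrite -(@ler_pXn2r _ 2) ?nnegrE ?rnorm_ge0 ?mulr_ge0 ?hn_ge0 //.
rewrite exprMn !hn_sqr -nsq_rnorm.
have s0 : 0 <= nsq <<x, y>> by rewrite addr_ge0 ?sqr_ge0.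
(* The form is nonnegative at -t conj(<x,y>) x + y. *)
have H (t : R) :
    0 <= t ^+ 2 * nsq <<x, y>> * Re <<x, x>> - 2 * t * nsq <<x, y>> + Re <<y, y>>.
  apply: le_trans (ph_dot_ge0 (comb (- (t%:C)%C * <<x, y>>^*) x y)) _.
  rewrite Re_dot_comb /nsq !ReImE le_eqVlt; apply/orP; left; apply/eqP; ring.
have := ph_dot_ge0 x; rewrite le_eqVlt => /orP[/eqP x0|x0].
  rewrite -x0 mul0r; rewrite leNgt; apply/negP => s1.
  (* In the degenerate case <x,x> = 0 the bound in [H] is affine in t, and this t makes it
     negative. *)
  have := H ((Re <<y, y>> + 1) / nsq <<x, y>>).
  rewrite -x0 mulr0 add0r -mulrA divfK ?gt_eqF //.
  have := ph_dot_ge0 y; lra.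
have := H (Re <<x, x>>)^-1.
have -> : (Re <<x, x>>)^-1 ^+ 2 * nsq <<x, y>> * Re <<x, x>> =
  (Re <<x, x>>)^-1 * nsq <<x, y>> by field; rewrite gt_eqF.
rewrite -mulrA => Hi.
have : (Re <<x, x>>)^-1 * nsq <<x, y>> <= Re <<y, y>> by lra.
by rewrite ler_pdivrMl.
Qed.

Lemma hn_comb c x y : hn (comb c x y) <= rnorm c * hn x + hn y.
Proof.
rewrite -(@ler_pXn2r _ 2) ?nnegrE ?addr_ge0 ?mulr_ge0 ?hn_ge0 ?rnorm_ge0 //.
rewrite hn_sqr Re_dot_comb sqrrD exprMn !hn_sqr nsq_rnorm.
have : Re (c * <<x, y>>) <= rnorm c * hn x * hn y.
  rewrite (le_trans (Re_le_rnorm _)) // rnormM -mulrA ler_wpM2l ?rnorm_ge0 //.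
  exact: CauchySchwarz.
rewrite mulr2n; move: (Re (c * _)) (rnorm c * _) => a b; lra.
Qed.

Lemma hn_small x (a : R) : 0 <= a -> hn x ^+ 2 <= a * hn x -> hn x <= a.
Proof.
move=> a0; have := hn_ge0 x; rewrite le_eqVlt => /orP[/eqP<- //|x0].
by rewrite expr2 ler_pM2r.
Qed.

Definition ph_sub x y := comb (-1) y x.

Lemma ph_dotB x y v : <<ph_sub x y, v>> = <<x, v>> - <<y, v>>.
Proof. by rewrite ph_dotP mulN1r addrC. Qed.

Lemma ph_dotBr x y v : <<v, ph_sub x y>> = <<v, x>> - <<v, y>>.
Proof. by rewrite ph_dotC ph_dotB rmorphB /= -!ph_dotC. Qed.

Lemma hn_le_of_dot x (a : R) : 0 <= a ->
  (forall v, rnorm <<x, v>> <= a * hn v) -> hn x <= a.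
Proof.
move=> a0 H; apply: hn_small => //; rewrite hn_sqr.
exact: le_trans (Re_le_rnorm _) (H _).
Qed.

End PreHilbertTheory.

(** * Completion of a pre-Hilbert space *)

Section Completion.
Variables (R : realType) (E : prehilbert R).
Local Notation C := R[i].
Local Notation "<< x , y >>" := (ph_dot x y).
Implicit Types (g : E -> C) (x y v : E) (e : R).

Definition approx e g x :=
  forall v, rnorm (g v - <<x, v>>) <= e * hn v.

(* The completion of E is realised as the space of those functions on E which
   are uniform limits, on the unit ball, of the functions [ph_dot x]. *)
Definition approximable : pred (E -> C) :=
  fun g => `[< forall e, 0 < e -> exists x, approx e g x >].

Lemma approx_le e e' g x : e <= e' -> approx e g x -> approx e' g x.
Proof.
by move=> ee' H v; apply: le_trans (H v) _; rewrite ler_wpM2r ?hn_ge0.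
Qed.

Lemma approx_comb e e' (c : C) g g' x x' : approx e g x -> approx e' g' x' ->
  approx (rnorm c * e + e') (c *: g + g') (ph_comb c x x').
Proof.
move=> H H' v; rewrite ph_dotP fctE opprD addrACA -mulrBr.
rewrite (le_trans (rnormD _ _)) // mulrDl lerD // rnormM -mulrA.
by rewrite ler_wpM2l ?rnorm_ge0.
Qed.

Lemma approx_sub e e' g x x' : 0 <= e -> 0 <= e' -> approx e g x -> approx e' g x' ->
  hn (ph_sub x x') <= e + e'.
Proof.
move=> e0 e0' H H'; apply: hn_le_of_dot => [|v]; first exact: addr_ge0.
rewrite ph_dotB mulrDl -[_ - _](subrKA (g v)); apply: le_trans (rnormD _ _) _.
by rewrite lerD // rnormBC.
Qed.

Lemma approximable_submod : GRing.submod_closed (approximable : {pred E -> C}).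
Proof.
split=> [|c g g' /asboolP H /asboolP H'].
  apply/asboolP => e e0; exists (ph_sub (ph_pt E) (ph_pt E)) => v.
  by rewrite ph_dotB subrr subr0 rnorm0 mulr_ge0 ?hn_ge0 ?ltW.
apply/asboolP => e e0.
have c0 : 0 < rnorm c + 1 by rewrite ltr_wpDl ?rnorm_ge0.
have d0 : 0 < e / (rnorm c + 1) by rewrite divr_gt0.
have [x Hx] := H _ d0; have [y Hy] := H' _ d0.
exists (ph_comb c x y); apply: approx_le (approx_comb c Hx Hy).
by rewrite -[X in _ + X]mul1r -mulrDl mulrCA mulfV ?mulr1 // gt_eqF.
Qed.

HB.instance Definition _ :=
  GRing.isSubmodClosed.Build C (E -> C) approximable approximable_submod.

Record completion := Completion {
  compl_fun :> E -> C; compl_approx : compl_fun \in approximable }.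

HB.instance Definition _ := [isSub for compl_fun].
HB.instance Definition _ := [Choice of completion by <:].
HB.instance Definition _ := [SubChoice_isSubLmodule of completion by <:].

(** Sequences in E converging to g uniformly on the unit ball; the inner product of the completion
    can be computed along any of them. *)
Definition aseq g (x : nat -> E) :=
  forall e, 0 < e -> exists N, forall n, (N <= n)%N -> approx e g (x n).

Lemma aseq_exists (g : completion) : exists x : nat -> E, aseq g x.
Proof.
have H n : exists x, approx (rate R n) g x.
  by have /asboolP := compl_approx g; apply; exact: rate_gt0.
exists (fun n => sval (cid (H n))) => e /rate_small_le[N NP]; exists N => n Nn.
by apply: approx_le (svalP (cid (H n))); rewrite ltW ?NP.
Qed.

Lemma aseq_comb (c : C) g g' (x x' : nat -> E) : aseq g x -> aseq g' x' ->
  aseq (c *: g + g') (fun n => ph_comb c (x n) (x' n)).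
Proof.
move=> H H' e e0.
have c0 : 0 < rnorm c + 1 by rewrite ltr_wpDl ?rnorm_ge0.
have d0 : 0 < e / (rnorm c + 1) by rewrite divr_gt0.
have [N HN] := H _ d0; have [M HM] := H' _ d0.
exists (maxn N M) => n; rewrite geq_max => /andP[Nn Mn].
apply: approx_le (approx_comb c (HN n Nn) (HM n Mn)).
by rewrite -[X in _ + X]mul1r -mulrDl mulrCA mulfV ?mulr1 // gt_eqF.
Qed.

Lemma aseq_bounded g (x : nat -> E) : aseq g x ->
  exists2 M : R, 0 < M & exists N, forall n, (N <= n)%N -> hn (x n) <= M.
Proof.
move=> H; have [N HN] := H 1 ltr01.
exists (2 + hn (x N)); first by rewrite ltr_wpDr ?hn_ge0.
exists N => n Nn; apply: hn_le_of_dot => [|v].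
  by rewrite addr_ge0 ?hn_ge0.
have -> : <<x n, v>> = <<ph_sub (x n) (x N), v>> + <<x N, v>>.
  by rewrite ph_dotB subrK.
rewrite (le_trans (rnormD _ _)) // mulrDl lerD ?CauchySchwarz //.
rewrite (le_trans (CauchySchwarz _ _)) // ler_wpM2r ?hn_ge0 //.
by apply: (approx_sub _ _ (HN n Nn) (HN N (leqnn _))).
Qed.

Lemma dot_aseq_close g g' (x x' y y' : nat -> E) :
  aseq g x -> aseq g x' -> aseq g' y -> aseq g' y' ->
  forall e, 0 < e -> exists N, forall m n, (N <= m)%N -> (N <= n)%N ->
    rnorm (<<x m, y m>> - <<x' n, y' n>>) < e.
Proof.
move=> gx gx' gy gy' e e0.
have [M M0 BM] := @aseq_bounded g' y gy.
have [N1 H1] := BM.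
have [L L0 BL] := @aseq_bounded g x' gx'.
have [N2 H2] := BL.
(* Each of the two differences below has seminorm at most 2d, so the total error is at most 2d (M +
   L) = e/2. *)
have d0 : 0 < e / (4 * (M + L)) by rewrite divr_gt0 // mulr_gt0 // addr_gt0.
set d := e / (4 * (M + L)) in d0.
have [n1 K1] := gx _ d0; have [n2 K2] := gx' _ d0.
have [n3 K3] := gy _ d0; have [n4 K4] := gy' _ d0.
exists (maxn (maxn N1 N2) (maxn (maxn n1 n2) (maxn n3 n4))) => m n.
rewrite !geq_max => /andP[/andP[a1 a2] /andP[/andP[a3 a4] /andP[a5 a6]]].
move=> /andP[/andP[b1 b2] /andP[/andP[b3 b4] /andP[b5 b6]]].
have -> : <<x m, y m>> - <<x' n, y' n>> =
    <<ph_sub (x m) (x' n), y m>> + <<x' n, ph_sub (y m) (y' n)>>.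
  by rewrite ph_dotB ph_dotBr addrA subrK.
have h1 : hn (ph_sub (x m) (x' n)) <= d + d.
  by apply: (approx_sub _ _ (K1 m _) (K2 n _)) => //; exact: ltW.
have h2 : hn (ph_sub (y m) (y' n)) <= d + d.
  by apply: (approx_sub _ _ (K3 m _) (K4 n _)) => //; exact: ltW.
apply: le_lt_trans (rnormD _ _) _.
have k1 := CauchySchwarz (ph_sub (x m) (x' n)) (y m).
have k2 := CauchySchwarz (x' n) (ph_sub (y m) (y' n)).
have l1 : hn (ph_sub (x m) (x' n)) * hn (y m) <= (d + d) * M.
  by rewrite ler_pM ?hn_ge0 // H1.
have l2 : hn (x' n) * hn (ph_sub (y m) (y' n)) <= L * (d + d).
  by rewrite ler_pM ?hn_ge0 // H2.
have ed : d * (M + L) = e / 4 by rewrite /d; field; rewrite gt_eqF // addr_gt0.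
apply: le_lt_trans (lerD (le_trans k1 l1) (le_trans k2 l2)) _.
have -> : (d + d) * M + L * (d + d) = 2 * (d * (M + L)) by ring.
by rewrite ed; lra.
Qed.

(** Sequences representing the same element are close in seminorm, so the limit does not depend on
    their choice, and identities of the form pass from E to the completion. *)
Lemma compl_dot_subproof (g g' : completion) : exists l : C,
  forall x y : nat -> E, aseq g x -> aseq g' y -> slim (fun n => <<x n, y n>>) l.
Proof.
have [x gx] := aseq_exists g; have [y gy] := aseq_exists g'.
have [l xl] := complex_complete (dot_aseq_close gx gx gy gy).
exists l => x' y' gx' gy' e e0; have e20 : 0 < e / 2 by rewrite divr_gt0.
have [N1 H1] := xl _ e20; have [N2 H2] := dot_aseq_close gx gx' gy gy' e20.
exists (maxn N1 N2) => n; rewrite geq_max => /andP[n1 n2].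
apply: le_lt_trans (rnorm_tri <<x n, y n>> _ _) _.
by rewrite (splitr e) ltrD ?H1 // rnormBC H2.
Qed.

Definition compl_dot (g g' : completion) : C := sval (cid (compl_dot_subproof g g')).

Lemma compl_dotE (g g' : completion) (x y : nat -> E) : aseq g x -> aseq g' y ->
  slim (fun n => <<x n, y n>>) (compl_dot g g').
Proof. exact: (svalP (cid (compl_dot_subproof g g'))). Qed.

Lemma compl_dotP (c : C) (g g' h : completion) :
  compl_dot (c *: g + g') h = c * compl_dot g h + compl_dot g' h.
Proof.
have [x gx] := aseq_exists g; have [x' gx'] := aseq_exists g'.
have [y hy] := aseq_exists h.
apply: (@slim_unique _ C^o); last first.
  exact: (slim_add (slim_mull c (compl_dotE gx hy)) (compl_dotE gx' hy)).
have := compl_dotE (aseq_comb c gx gx' : aseq (c *: g + g' : completion) _) hy.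
by under eq_fun do rewrite ph_dotP.
Qed.

Lemma compl_dotC (g g' : completion) : compl_dot g g' = (compl_dot g' g)^*.
Proof.
have [x gx] := aseq_exists g; have [x' gx'] := aseq_exists g'.
apply: (@slim_unique _ C^o); last exact: (slim_conj (compl_dotE gx' gx)).
have := compl_dotE gx gx'.
by under eq_fun do rewrite ph_dotC.
Qed.

Lemma compl_dot_ge0 (g : completion) : 0 <= Re (compl_dot g g).
Proof.
have [x gx] := aseq_exists g.
by apply: (slim_ge (compl_dotE gx gx)) => n; exact: ph_dot_ge0.
Qed.

(** Elements are functions, so vanishing is checked pointwise: g v is the limit of <x_n, v>, which
    Cauchy-Schwarz bounds by a seminorm tending to 0. Null vectors of E therefore disappear without
    forming a quotient. *)
Lemma compl_dot_def (g : completion) : Re (compl_dot g g) = 0 -> g = 0.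
Proof.
move=> g0; apply: val_inj; apply/funext => v /=.
have [x gx] := aseq_exists g; apply: (@rnorm_small _ C^o) => e e0.
rewrite subr0.
have w0 : 0 < hn v + 1 by rewrite ltr_wpDl ?hn_ge0.
set d := e / (2 * (hn v + 1)).
have d0 : 0 < d by rewrite /d divr_gt0 // mulr_gt0.
have [N1 H1] := gx _ d0.
have [N2 H2] := compl_dotE gx gx (exprn_gt0 2 d0).
set n := maxn N1 N2.
have k1 := H1 n (leq_maxl _ _) v.
have k2 : hn (x n) <= d.
  rewrite -(@ler_pXn2r _ 2) ?nnegrE ?hn_ge0 ?ltW // hn_sqr.
  have := le_lt_trans (Re_le_rnorm _) (H2 n (leq_maxr _ _)).
  by rewrite !ReImE g0 subr0.
rewrite -(subrK <<x n, v>> (g v)) (le_lt_trans (rnormD _ _)) //.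
apply: le_lt_trans (lerD k1 (le_trans (CauchySchwarz _ _) _)) _.
  by apply: ler_wpM2r k2; exact: hn_ge0.
have -> : d * hn v + d * hn v = 2 * d * (hn v + 1) - 2 * d by ring.
have -> : 2 * d * (hn v + 1) = e by rewrite /d; field; rewrite gt_eqF.
lra.
Qed.

(** The completion is itself a pre-Hilbert space, so its norm and triangle inequality come from the
    general seminorm. *)
Definition compl_pre : prehilbert R :=
  @PreHilbert R completion compl_dot (fun c (g g' : completion) => c *: g + g') 0
    compl_dotP compl_dotC compl_dot_ge0.

Definition compl_norm (g : completion) : C := ((hn (g : compl_pre))%:C)%C.

Lemma compl_normD (g g' : completion) :
  compl_norm (g + g') <= compl_norm g + compl_norm g'.
Proof.
rewrite /compl_norm -rmorphD lecR.
have := hn_comb 1 (g : compl_pre) g'.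
have -> : rnorm (1 : C) = 1 by rewrite /rnorm normr1.
by rewrite mul1r /= scale1r.
Qed.

Lemma compl_normZ (c : C) (g : completion) :
  compl_norm (c *: g) = `|c| * compl_norm g.
Proof.
rewrite /compl_norm normr_rnorm -rmorphM /=; congr (_%:C)%C.
apply/eqP; rewrite -(@eqrXn2 _ 2) ?mulr_ge0 ?hn_ge0 ?rnorm_ge0 //.
rewrite exprMn !hn_sqr /=; apply/eqP.
have := @Re_dot_comb R compl_pre c g 0; rewrite /= addr0 -nsq_rnorm => ->.
have d0 h : compl_dot 0 h = 0.
  have := compl_dotP (-1) 0 0 h; rewrite scaler0 addr0 mulN1r => ->.
  by rewrite addrC subrr.
have d0r h : compl_dot h 0 = 0 by rewrite compl_dotC d0 conjC0.
by rewrite !d0r mulr0 !ReImE mulr0 !addr0.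
Qed.

Lemma compl_norm0_eq0 (g : completion) : compl_norm g = 0 -> g = 0.
Proof.
move=> /(@complexI R) g0; apply: compl_dot_def.
by have := @hn_sqr R compl_pre g; rewrite g0 expr0n /= => <-.
Qed.

HB.instance Definition _ := Lmodule_isNormed.Build C completion
  compl_normD compl_normZ compl_norm0_eq0.

Lemma rnorm_compl (g : completion) : rnorm g = hn (g : compl_pre).
Proof. by []. Qed.

Lemma compl_embed_subproof x : ph_dot x \in approximable.
Proof.
apply/asboolP => e e0; exists x => v.
by rewrite subrr rnorm0 mulr_ge0 ?hn_ge0 ?ltW.
Qed.

Definition compl_embed x : completion := Completion (compl_embed_subproof x).
Local Notation J := compl_embed.

Lemma aseq_embed x : aseq (J x) (fun=> x).
Proof.
move=> e e0; exists 0%N => n _ v.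
by rewrite subrr rnorm0 mulr_ge0 ?hn_ge0 ?ltW.
Qed.

Lemma compl_embed_dot x y : compl_dot (J x) (J y) = <<x, y>>.
Proof.
apply: (@slim_unique _ C^o); last exact: slim_cst.
exact: compl_dotE (@aseq_embed x) (@aseq_embed y).
Qed.

Lemma compl_embed_comb c x y : J (ph_comb c x y) = c *: J x + J y.
Proof. by apply: val_inj; apply/funext => v /=; rewrite ph_dotP. Qed.

(** Here the bound of g - J x as a functional becomes a bound of its Hilbert norm. If y_n represents
    g, the vectors y_n - x have seminorm at most e + d eventually, and their norms converge to that
    of g - J x. *)
Lemma rnorm_approx (g : completion) x e : 0 <= e -> approx e g x ->
  rnorm (g - J x) <= e.
Proof.
move=> e0 gx; apply/ler_addgt0Pr => d d0.
rewrite rnorm_compl -(@ler_pXn2r _ 2) ?nnegrE ?hn_ge0 ?addr_ge0 ?(ltW d0) //.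
rewrite hn_sqr; have [y gy] := aseq_exists g.
have gJ : aseq (g - J x) (fun n => ph_comb (-1) x (y n)).
  by have := aseq_comb (-1) (@aseq_embed x) gy; rewrite addrC scaleN1r.
apply: slim_le (compl_dotE gJ gJ) _; have [N HN] := gy _ d0.
exists N => n Nn; rewrite -hn_sqr ler_pXn2r ?nnegrE ?hn_ge0 ?addr_ge0 ?(ltW d0) //.
rewrite addrC; apply: (approx_sub _ e0 (HN n Nn) gx); exact: ltW.
Qed.

(** Diagonal argument: centres g_n of small balls in F are replaced by vectors y_n of E. The
    functions <y_n, .> converge uniformly on the unit ball, and their limit is the limit of F. *)
Lemma completion_complete (F : set_system completion) :
  ProperFilter F -> cauchy F -> cvg F.
Proof.
move=> FF /cauchyP cF.
have pC n : 0 < (((rate R n)%:C)%C : C) by rewrite ltcR rate_gt0.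
have Hg n : exists g : completion, F (ball g ((rate R n)%:C)%C) by exact: cF (pC n).
pose g n := sval (cid (Hg n)).
have Fg n : F (ball (g n) ((rate R n)%:C)%C) := svalP (cid (Hg n)).
have gg m n : rnorm (g m - g n) <= rate R m + rate R n.
  have [h []] := filter_ex (filterI (Fg m) (Fg n)); rewrite !ball_rnorm /= => h1 h2.
  apply: le_trans (rnorm_tri h _ _) _.
  by rewrite lerD // ?(rnormBC h) ltW.
have Hy n : exists y : E, approx (rate R n) (g n) y.
  by have /asboolP := compl_approx (g n); apply; exact: rate_gt0.
pose y n := sval (cid (Hy n)).
have gy n : approx (rate R n) (g n) (y n) := svalP (cid (Hy n)).
have gJy n : rnorm (g n - J (y n)) <= rate R n.
  by apply: rnorm_approx => //; exact: ltW (rate_gt0 _ _).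
(* The path y_m, g_m, g_n, y_n has length at most r_m + (r_m + r_n) + r_n. *)
have yy m n v : rnorm (<<y m, v>> - <<y n, v>>) <= 2 * (rate R m + rate R n) * hn v.
  have -> : <<y m, v>> - <<y n, v>> = compl_dot (J (y m) - J (y n)) (J v).
    have := compl_dotP (-1) (J (y n)) (J (y m)) (J v).
    by rewrite scaleN1r mulN1r !compl_embed_dot ![- _ + _]addrC => ->.
  have /= := @CauchySchwarz R compl_pre (J (y m) - J (y n)) (J v).
  rewrite -rnorm_compl => /le_trans; apply.
  have -> : hn (J v : compl_pre) = hn v by rewrite /hn /= compl_embed_dot.
  rewrite ler_wpM2r ?hn_ge0 //.
  have h1 := rnorm_tri (g m) (J (y m)) (J (y n)).
  have h2 := rnorm_tri (g n) (g m) (J (y n)).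
  have := gg m n; have := gJy m; have := gJy n; rewrite (rnormBC (g m) (J _)).
  by move: h1 h2; rnorm_lra.
have Hl v : exists l : C, slim (fun n => <<y n, v>>) l.
  apply: complex_complete => e e0.
  have v0 : 0 < hn v + 1 by rewrite ltr_wpDl ?hn_ge0.
  have d0 : 0 < e / (4 * (hn v + 1)) by rewrite divr_gt0 // mulr_gt0.
  have [N HN] := rate_small_le d0; exists N => m n Nm Nn.
  apply: le_lt_trans (yy m n v) _.
  have := HN m Nm; have := HN n Nn; rewrite !ltr_pdivlMr ?mulr_gt0 // => k1 k2.
  have := rate_gt0 R m; have := rate_gt0 R n; have := hn_ge0 v.
  by move: (rate R m) (rate R n) (hn v) k1 k2 => a b c k1 k2; nra.
pose l v := sval (cid (Hl v)).
have yl v : slim (fun n => <<y n, v>>) (l v) := svalP (cid (Hl v)).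
have ly n : approx (2 * rate R n) l (y n).
  move=> v; apply/ler_addgt0Pr => e e0.
  have v0 : 0 < hn v + 1 by rewrite ltr_wpDl ?hn_ge0.
  have d0 : 0 < e / (4 * (hn v + 1)) by rewrite divr_gt0 // mulr_gt0.
  have [N HN] := rate_small_le d0.
  have e20 : 0 < e / 2 by rewrite divr_gt0.
  have [M HM] := yl v _ e20; pose k := maxn N M.
  have k1 := HM k (leq_maxr _ _); rewrite rnormBC in k1.
  have k2 := yy k n v; have := HN k (leq_maxl _ _).
  rewrite ltr_pdivlMr ?mulr_gt0 // => k3.
  apply: le_trans (rnorm_tri <<y k, v>> _ _) _.
  apply: le_trans (lerD (ltW k1) k2) _.
  have := rate_gt0 R k; have := hn_ge0 v.
  by move: (rate R k) (rate R n) (hn v) k3 => a b c k3; nra.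
have lP : l \in approximable.
  apply/asboolP => e e0; have e20 : 0 < e / 2 by rewrite divr_gt0.
  have [n ne] := rate_small e20; exists (y n).
  by apply: approx_le (ly n); lra.
pose L := Completion lP.
have LJ n : rnorm (L - J (y n)) <= 2 * rate R n.
  apply: (@rnorm_approx L) (ly n); rewrite mulr_ge0 // ltW //; exact: rate_gt0.
apply/cvg_ex; exists L => B /nbhs_rnorm[e e0 sub].
(* Four errors [rate n]: two from L to J (y n), one to g n, one to h. *)
have e40 : 0 < e / 4 by rewrite divr_gt0.
have [n ne] := rate_small e40.
apply: filterS (Fg n) => h; rewrite ball_rnorm /= => h1; apply: sub.
have h2 := rnorm_tri (J (y n)) L h; have h3 := rnorm_tri (g n) (J (y n)) h.
have := LJ n; have := gJy n; rewrite (rnormBC (g n) (J _)).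
by move: h1 h2 h3; rnorm_lra.
Qed.

HB.instance Definition _ := Uniform_isComplete.Build completion completion_complete.

Lemma compl_dot_bilinear : bilinear_for (GRing.mul : GRing.Scale.law C C)
  (Num.conj \; *%R : GRing.Scale.law C C) (compl_dot : completion -> completion -> C).
Proof.
split=> [h c g g'|h c g g']; first exact: compl_dotP.
by rewrite compl_dotC compl_dotP rmorphD rmorphM /= -!compl_dotC.
Qed.

HB.instance Definition _ := bilinear_isBilinear.Build C completion completion C
  (GRing.mul : GRing.Scale.law C C)
  (Num.conj \; *%R : GRing.Scale.law C C) compl_dot compl_dot_bilinear.

Lemma compl_dot_herm (x y : completion) :
  compl_dot x y = (-1) ^+ false * (compl_dot y x)^*.
Proof. by rewrite expr0 mul1r compl_dotC. Qed.

HB.instance Definition _ := @isHermitianSesquilinear.Build C completion false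
  (@Num.conj C) compl_dot compl_dot_herm.

Lemma compl_dot_gt0 (x : completion) : x != 0 -> 0 < compl_dot x x.
Proof.
move=> x0; rewrite ltcE (@Im_dot R compl_pre x) eqxx /= lt_def compl_dot_ge0 andbT.
by apply: contraNneq x0 => /compl_dot_def ->.
Qed.

HB.instance Definition _ := isDotProduct.Build C completion compl_dot compl_dot_gt0.

Lemma compl_dot_norm (h : completion) : `|h| ^+ 2 = compl_dot h h.
Proof.
rewrite normr_rnorm -rmorphXn /=; symmetry; exact: (@dot_hn R compl_pre h).
Qed.

HB.instance Definition _ := isHilbert.Build R completion compl_dot_norm.
End Completion.

(** * Operators on Hilbert spaces *)

Section HilbertTheory.
Variable R : realType.
Implicit Types H K : hilbertType R.

Section Dot.
Variable H : hilbertType R.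
Implicit Types (x y v : H) (c : R[i]).

Lemma hdotP c x y v : hdot (c *: x + y) v = c * hdot x v + hdot y v.
Proof. by rewrite linearPl. Qed.

Lemma hdotC x y : hdot x y = (hdot y x)^*.
Proof. by rewrite hermC expr0 mul1r. Qed.

Lemma hdot_normE x : hdot x x = ((rnorm x ^+ 2)%:C)%C.
Proof. by rewrite -hdot_norm normr_rnorm rmorphXn. Qed.

Lemma Re_hdot_ge0 x : 0 <= Re (hdot x x).
Proof. by rewrite hdot_normE /= sqr_ge0. Qed.

Definition hilb_pre : prehilbert R :=
  @PreHilbert R H (fun x y => hdot x y) (fun c x y => c *: x + y) 0
    hdotP hdotC Re_hdot_ge0.

Lemma hn_rnorm x : hn (x : hilb_pre) = rnorm x.
Proof. by rewrite /hn /= hdot_normE /= sqrtr_sqr ger0_norm ?rnorm_ge0. Qed.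

Lemma hdotDl x y v : hdot (x + y) v = hdot x v + hdot y v.
Proof. exact: linearDl. Qed.
Lemma hdotZl c x v : hdot (c *: x) v = c * hdot x v.
Proof. exact: linearZl_LR. Qed.
Lemma hdotBl x y v : hdot (x - y) v = hdot x v - hdot y v.
Proof. exact: linearBl. Qed.
Lemma hdot0l v : hdot 0 v = 0 :> R[i].
Proof. exact: linear0l. Qed.
Lemma hdotDr x y v : hdot v (x + y) = hdot v x + hdot v y.
Proof. exact: linearDr. Qed.
Lemma hdotZr c x v : hdot v (c *: x) = c^* * hdot v x.
Proof. exact: linearZr_LR. Qed.
Lemma hdotBr x y v : hdot v (x - y) = hdot v x - hdot v y.
Proof. exact: linearBr. Qed.
Lemma hdot0r v : hdot v 0 = 0 :> R[i].
Proof. exact: linear0r. Qed.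
Lemma hdot_suml I (s : seq I) (P : pred I) (F : I -> H) v :
  hdot (\sum_(i <- s | P i) F i) v = \sum_(i <- s | P i) hdot (F i) v.
Proof. exact: (linear_sumlz _ v s P F). Qed.
Lemma hdot_sumr I (s : seq I) (P : pred I) (F : I -> H) v :
  hdot v (\sum_(i <- s | P i) F i) = \sum_(i <- s | P i) hdot v (F i).
Proof. exact: (linear_sumr _ v s P F). Qed.

Lemma hdot_CS x y : rnorm (hdot x y) <= rnorm x * rnorm y.
Proof. by have := CauchySchwarz (x : hilb_pre) y; rewrite !hn_rnorm. Qed.

Lemma rnorm_sqr x : rnorm x ^+ 2 = Re (hdot x x).
Proof. by rewrite hdot_normE. Qed.

Lemma hdot_inj x y : (forall v, hdot x v = hdot y v) -> x = y.
Proof.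
move=> xy; apply/subr0_eq/rnorm_eq0/eqP; rewrite -sqrf_eq0 rnorm_sqr.
by rewrite hdotBl xy subrr.
Qed.

Lemma hdot_inj_r x y : (forall v, hdot v x = hdot v y) -> x = y.
Proof. by move=> xy; apply: hdot_inj => v; rewrite hdotC xy -hdotC. Qed.

Lemma rnorm_sqrP c x y : rnorm (c *: x + y) ^+ 2 =
  nsq c * rnorm x ^+ 2 + 2 * Re (c * hdot x y) + rnorm y ^+ 2.
Proof.
rewrite !rnorm_sqr; exact: (@Re_dot_comb R hilb_pre c x y).
Qed.

End Dot.

Section LinearOps.
Variables (H K : hilbertType R) (T : H -> K).
Hypothesis lT : linear T.

Lemma lin0 : T 0 = 0.
Proof. by have := lT (-1) 0 0; rewrite scaler0 addr0 scaleN1r addNr. Qed.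
Lemma linZ c x : T (c *: x) = c *: T x.
Proof. by have := lT c x 0; rewrite lin0 !addr0. Qed.
Lemma linD x y : T (x + y) = T x + T y.
Proof. by have := lT 1 x y; rewrite !scale1r. Qed.
Lemma linN x : T (- x) = - T x.
Proof. by rewrite -scaleN1r linZ scaleN1r. Qed.
Lemma linB x y : T (x - y) = T x - T y.
Proof. by rewrite linD linN. Qed.
Lemma lin_sum I (s : seq I) (P : pred I) (F : I -> H) :
  T (\sum_(i <- s | P i) F i) = \sum_(i <- s | P i) T (F i).
Proof. exact: (big_morph T linD lin0). Qed.
End LinearOps.

Lemma bounded_opP H K (T : H -> K) : bounded_op T <->
  linear T /\ exists2 C : R, 0 <= C & forall x, rnorm (T x) <= C * rnorm x.
Proof.
split=> [[lT cT]|[lT [C C0 bT]]]; split=> //.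
  have T0 : T 0 = 0.
    by have := lT (-1) 0 0; rewrite scaler0 addr0 scaleN1r addNr.
  have /(proj1 (cvg_rnorm _ _ _))/(_ 1 ltr01) := cT 0.
  rewrite T0 => /nbhs_rnorm[d d0 sub].
  (* A vector rescaled to norm d/2 lies in the ball on which T has norm below 1. *)
  exists (2 / d) => [|x]; first by rewrite divr_ge0 // ltW.
  have [->|x0] := eqVneq x 0; first by rewrite T0 !rnorm0 mulr0.
  have nx0 : 0 < rnorm x.
    by rewrite lt_def rnorm_ge0 andbT; apply: contraNneq x0 => /rnorm_eq0 ->.
  pose k : R[i] := ((d / (2 * rnorm x))%:C)%C.
  have k0 : 0 < d / (2 * rnorm x) by rewrite divr_gt0 // mulr_gt0.
  have kn : rnorm k = d / (2 * rnorm x) by rewrite rnorm_real gtr0_norm.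
  have : rnorm (T (k *: x)) < 1.
    rewrite -rnormN -sub0r; apply: sub; rewrite sub0r rnormN rnormZ kn.
    have -> : d / (2 * rnorm x) * rnorm x = d / 2 by field; rewrite gt_eqF.
    lra.
  have -> : T (k *: x) = k *: T x.
    by have := lT k x 0; rewrite T0 !addr0.
  rewrite rnormZ kn -ltr_pdivlMl // mulr1 => /ltW /le_trans; apply.
  by rewrite le_eqVlt; apply/orP; left; apply/eqP; field; rewrite !gt_eqF.
move=> x; apply/cvg_rnorm => e e0; apply/nbhs_rnorm.
exists (e / (C + 1)) => [|y xy]; first by rewrite divr_gt0 // ltr_wpDl.
have -> : T x - T y = T (x - y).
  by have := lT (-1) y x; rewrite !scaleN1r ![- _ + _]addrC => ->.
apply: le_lt_trans (bT _) _; rewrite ltr_pdivlMr ?ltr_wpDl // in xy.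
by apply: le_lt_trans xy; rewrite mulrDr mulr1 mulrC lerDl rnorm_ge0.
Qed.

Lemma bounded_op_lip H K (T : H -> K) : bounded_op T ->
  exists2 C : R, 0 <= C & forall x y, rnorm (T x - T y) <= C * rnorm (x - y).
Proof.
move=> /bounded_opP[lT [C C0 bT]]; exists C => // x y.
by rewrite -(linB lT).
Qed.

Lemma bounded_op_comp H K (L : hilbertType R) (S : K -> L) (T : H -> K) :
  bounded_op S -> bounded_op T -> bounded_op (S \o T).
Proof.
move=> [lS cS] [lT cT]; split=> [c x y|x] /=; first by rewrite lT lS.
by apply: continuous_comp; [exact: cT|exact: cS].
Qed.

Lemma bounded_op_comb H K (c : R[i]) (S T : H -> K) :
  bounded_op S -> bounded_op T -> bounded_op (fun h => c *: S h + T h).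
Proof.
move=> /bounded_opP[lS [C C0 bS]] /bounded_opP[lT [D D0 bT]].
apply/bounded_opP; split=> [k x y|].
  by rewrite lS lT scalerDr scalerDr !scalerA mulrC addrACA.
exists (rnorm c * C + D); first by rewrite addr_ge0 ?mulr_ge0 ?rnorm_ge0.
move=> x; rewrite (le_trans (rnormD _ _)) // mulrDl lerD // rnormZ -mulrA.
by rewrite ler_wpM2l ?rnorm_ge0.
Qed.

Lemma closed_projection H (M : set H) (h : H) : closed_subspace M ->
  exists2 p, M p & forall k, M k -> hdot (h - p) k = 0.
Proof.
move=> [cM M0 lM].
pose D := [set (rnorm (h - m)) ^+ 2 | m in M].
have hD : has_inf D.
  split; first by exists (rnorm (h - 0) ^+ 2), 0.
  by exists 0 => _ [m _ <-]; exact: sqr_ge0.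
pose d := inf D.
have dle m : M m -> d <= rnorm (h - m) ^+ 2.
  by move=> Mm; apply: ge_inf; [exact: hD.2|exists m].
(* With the slack r^2/2 the parallelogram identity gives |m_i - m_j|^2 <= r_i^2 + r_j^2, hence a
   distance of at most r_i + r_j. *)
have Hm n : exists m, M m /\ rnorm (h - m) ^+ 2 < d + rate R n ^+ 2 / 2.
  have e0 : 0 < rate R n ^+ 2 / 2 by rewrite divr_gt0 // exprn_gt0 // rate_gt0.
  by have [_ [m Mm <-] lt] := inf_adherent e0 hD; exists m.
pose m n := sval (cid (Hm n)).
have mP n : M (m n) /\ rnorm (h - m n) ^+ 2 < d + rate R n ^+ 2 / 2 :=
  svalP (cid (Hm n)).
have cm i j : rnorm (m i - m j) <= rate R i + rate R j.
  have [Mi di] := mP i; have [Mj dj] := mP j.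
  have ri := rate_gt0 R i; have rj := rate_gt0 R j.
  rewrite -(@ler_pXn2r _ 2) ?nnegrE ?rnorm_ge0 ?addr_ge0 ?(ltW ri) ?(ltW rj) //.
  pose half : R[i] := ((2^-1)%:C)%C.
  have Mh : M (half *: m i + half *: m j).
    have := lM half (m j) 0 Mj M0; rewrite addr0 => Mhj.
    exact: lM.
  have := dle _ Mh.
  have e1 : rnorm (m i - m j) ^+ 2 + 4 * rnorm (h - (half *: m i + half *: m j)) ^+ 2
    = 2 * rnorm (h - m i) ^+ 2 + 2 * rnorm (h - m j) ^+ 2.
    have -> : m i - m j = (-1) *: (h - m i) + (h - m j).
      by rewrite scaleN1r opprB addrA subrK.
    have -> : h - (half *: m i + half *: m j) = half *: ((h - m i) + (h - m j)).
      rewrite addrACA scalerDr -opprD scalerN scalerDr; congr (_ - _).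
      rewrite -scalerDl -[h in LHS]scale1r; congr (_ *: _); rewrite -rmorphD /=.
      by congr (_%:C)%C; field.
    by rewrite scalerDr.
    rewrite rnormZ exprMn rnorm_sqrP.
    have -> : (h - m i) + (h - m j) = 1 *: (h - m i) + (h - m j) by rewrite scale1r.
    rewrite rnorm_sqrP rnorm_real ger0_norm ?invr_ge0 // mulN1r mul1r /nsq !ReImE.
    by field.
  move=> di' ; move: di dj e1 di'.
  by rnorm_lra || nra.
have [p pP] := complete_rate cm.
have dp : rnorm (h - p) ^+ 2 <= d.
  have d0 : 0 <= d by apply: lb_le_inf; [exact: hD.1|move=> _ [k _ <-]; exact: sqr_ge0].
  rewrite -(sqr_sqrtr d0) ler_pXn2r ?nnegrE ?rnorm_ge0 ?sqrtr_ge0 //.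
  apply: (@le_rate _ _ _ 2) => // n; have [Mn dn] := mP n.
  apply: le_trans (rnorm_tri (m n) _ _) _; rewrite mulr_natl mulr2n addrA lerD //.
  have rn := rate_gt0 R n.
  rewrite -(@ler_pXn2r _ 2) ?nnegrE ?rnorm_ge0 ?addr_ge0 ?sqrtr_ge0 ?(ltW rn) //.
  rewrite sqrrD sqr_sqrtr //; apply: le_trans (ltW dn) _.
  have : 0 <= Num.sqrt d * rate R n by rewrite mulr_ge0 ?sqrtr_ge0 ?ltW.
  have : 0 <= rate R n ^+ 2 by apply: sqr_ge0.
  by rewrite [_ * _ *+ 2]mulr2n; move: (Num.sqrt d * rate R n) (rate R n ^+ 2) => a b; lra.
have Mp : M p.
  apply: (proj1 (closed_rnorm _) cM) => e e0.
  have [n ne] := rate_small e0; exists (m n); first by have [] := mP n.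
  by rewrite rnormBC; apply: le_lt_trans (pP n) ne.
exists p => // k Mk.
suff : nsq (hdot k (h - p)) <= 0.
  rewrite nsq_rnorm -[X in _ <= X](expr0n _ 2) ler_pXn2r ?nnegrE ?rnorm_ge0 //.
  move=> n0; rewrite hdotC [hdot k _]rnorm_eq0 ?conjC0 //.
  by apply/eqP; rewrite eq_le n0 rnorm_ge0.
have Ht (t : R) : 0 <= t ^+ 2 * nsq (hdot k (h - p)) * rnorm k ^+ 2 -
    2 * t * nsq (hdot k (h - p)).
  pose c := - (t%:C)%C * (hdot k (h - p))^*.
  have := dle _ (lM (- c) k p Mk Mp).
  have -> : h - (- c *: k + p) = c *: k + (h - p).
    by rewrite opprD addrCA scaleNr opprK.
  move=> le1; have := le_trans dp le1; rewrite rnorm_sqrP.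
  have -> : nsq c = t ^+ 2 * nsq (hdot k (h - p)) by rewrite /c /nsq !ReImE; ring.
  have -> : Re (c * hdot k (h - p)) = - t * nsq (hdot k (h - p)).
    by rewrite /c /nsq !ReImE; ring.
  by move: (nsq _) => u; rnorm_lra.
have k0 : 0 <= rnorm k ^+ 2 by apply: sqr_ge0.
have kp : 0 < rnorm k ^+ 2 + 1 by rewrite ltr_wpDl.
(* After clearing denominators, this t leaves -(|k|^2 + 2) |(k, h - p)|^2 >= 0; the + 1 covers k =
   0. *)
have := Ht (rnorm k ^+ 2 + 1)^-1; rewrite -(ler_pM2l (exprn_gt0 2 kp)) mulr0.
have -> : (rnorm k ^+ 2 + 1) ^+ 2 * ((rnorm k ^+ 2 + 1)^-1 ^+ 2 * nsq (hdot k (h - p)) *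
  rnorm k ^+ 2 - 2 / (rnorm k ^+ 2 + 1) * nsq (hdot k (h - p))) =
  - (rnorm k ^+ 2 + 2) * nsq (hdot k (h - p)) by field; rewrite gt_eqF.
move: (rnorm k ^+ 2) (nsq _) k0 => a b a0; nra.
Qed.

Lemma riesz H (f : H -> R[i]) (C : R) :
  (forall c x y, f (c *: x + y) = c * f x + f y) ->
  (forall x, rnorm (f x) <= C * rnorm x) -> exists y, forall h, f h = hdot h y.
Proof.
move=> lf bf.
have f0 : f 0 = 0 by have := lf (-1) 0 0; rewrite scaler0 addr0 mulN1r addNr.
have fB x y : f (x - y) = f x - f y.
  by have := lf (-1) y x; rewrite scaleN1r mulN1r ![- _ + _]addrC.
have [[h0 fh0]|nex] := pselect (exists h, f h != 0); last first.
  exists 0 => h; rewrite hdot0r; apply/eqP/negPn/negP => fh; apply: nex.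
  by exists h.
have cM : closed_subspace [set h | f h = 0].
  split=> //= [|c x y fx fy]; last by rewrite lf fx fy mulr0 addr0.
  apply/closed_rnorm => x H0; apply: (@rnorm_small _ R[i]^o) => e e0.
  have C0 : 0 < `|C| + 1 by rewrite ltr_wpDl.
  have d0 : 0 < e / (`|C| + 1) by rewrite divr_gt0.
  have [y /= fy xy] := H0 _ d0; rewrite -fy -fB.
  apply: le_lt_trans (bf _) _; rewrite ltr_pdivlMr // in xy.
  apply: le_lt_trans xy; rewrite mulrC ler_wpM2l ?rnorm_ge0 //.
  by have := ler_norm C; lra.
have [p /= fp pM] := closed_projection h0 cM.
set z := h0 - p in pM.
have fz : f z != 0 by rewrite /z fB fp subr0.
have zz : hdot z z != 0.
  apply: contraNneq fz => zz; suff -> : z = 0 by rewrite f0.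
  by apply/rnorm_eq0/eqP; rewrite -sqrf_eq0 rnorm_sqr zz.
(* The vector h - (f h / f z) z lies in the kernel of f, hence is orthogonal to z. The conjugate
   compensates conjugate linearity in the second variable. *)
exists ((f z / hdot z z)^* *: z) => h; rewrite hdotZr conjCK.
have /pM : [set h | f h = 0] (h - (f h / f z) *: z).
  rewrite /= fB; have := lf (f h / f z) z 0; rewrite addr0 f0 addr0 => ->.
  by rewrite divfK // subrr.
rewrite hdotC => /eqP; rewrite conjC_eq0 hdotBl hdotZl => /eqP e1.
have -> : hdot h z = f h / f z * hdot z z by apply/subr0_eq.
by rewrite mulrACA mulVf // mulr1 mulrC divfK.
Qed.

(** [adj] is a choice among the solutions of the adjoint relation, and there is at most one
    solution. Adjoints are computed below by exhibiting one. *)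
Lemma adj_unique H K (T : H -> K) (S : K -> H) :
  (forall h k, hdot (T h) k = hdot h (S k)) -> adj T = S.
Proof.
move=> TS; rewrite /adj; case: xgetP => [S' _ /= TS'|/(_ S) /=//].
by apply/funext => k; apply: hdot_inj_r => v; rewrite -TS' TS.
Qed.

Lemma adjP H K (T : H -> K) : bounded_op T ->
  forall h k, hdot (T h) k = hdot h (adj T k).
Proof.
move=> /bounded_opP[lT [C C0 bT]].
have ex k : exists y, forall h, hdot (T h) k = hdot h y.
  apply: (@riesz H (fun h => hdot (T h) k) (C * rnorm k)) => [c x y|x].
    by rewrite lT hdotP.
  by rewrite (le_trans (hdot_CS _ _)) // mulrAC ler_wpM2r ?rnorm_ge0.
pose S k := sval (cid (ex k)).
have SP h k : hdot (T h) k = hdot h (S k) := svalP (cid (ex k)) h.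
by move=> h k; rewrite (adj_unique SP).
Qed.

Lemma adjPr H K (T : H -> K) : bounded_op T ->
  forall h k, hdot k (T h) = hdot (adj T k) h.
Proof. by move=> bT h k; rewrite hdotC (adjP bT) -hdotC. Qed.

Lemma closed_image_isometry H K (V : H -> K) : isometry_op V ->
  closed_subspace (range V).
Proof.
move=> [lV nV].
have nV' x : rnorm (V x) = rnorm x by rewrite /rnorm nV.
split=> [||c _ _ [x _ <-] [y _ <-]].
- apply/closed_rnorm => k Hk.
  have ex n : exists h, rnorm (k - V h) < rate R n.
    by have [_ [h _ <-] lt] := Hk _ (rate_gt0 R n); exists h.
  pose x n := sval (cid (ex n)).
  have xP n : rnorm (k - V (x n)) < rate R n := svalP (cid (ex n)).
  have [m n|l lP] := @complete_rate R H x.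
    rewrite -nV' (linB lV); apply: le_trans (rnorm_tri k _ _) _.
    by rewrite lerD // ?(rnormBC _ k) ltW.
  exists l => //; apply: rnorm_small => e e0.
  have e20 : 0 < e / 2 by rewrite divr_gt0.
  have [n ne] := rate_small e20.
  apply: le_lt_trans (rnorm_tri (V (x n)) _ _) _.
  rewrite -(linB lV) nV' (rnormBC l) (rnormBC _ k).
  have := lP n; have := xP n; move: ne; rnorm_lra.
- by exists 0 => //; rewrite (lin0 lV).
- by exists (c *: x + y) => //; rewrite lV.
Qed.

Section Dense.
Variables (E : Type) (H : hilbertType R) (J : E -> H).

(** The source is a bare type because J will be [compl_embed] or [word_sum], defined on lists of
    words. *)
Definition dense_map := forall h (e : R), 0 < e -> exists x, rnorm (h - J x) < e.

Lemma dense_closed (S : set H) : dense_map -> closed S ->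
  (forall x, S (J x)) -> forall h, S h.
Proof.
move=> dJ /closed_rnorm cS SJ h; apply: cS => e /(dJ h)[x hx].
by exists (J x).
Qed.

Lemma dense_eq K (T S : H -> K) : dense_map -> bounded_op T -> bounded_op S ->
  (forall x, T (J x) = S (J x)) -> T = S.
Proof.
move=> dJ /bounded_opP[lT [C C0 bT]] /bounded_opP[lS [D D0 bS]] TS.
apply/funext; apply: (dense_closed (S := [set h | T h = S h])) => //.
apply/closed_rnorm => h Hh; apply: rnorm_small => e e0.
have c0 : 0 < C + D + 1 by rewrite ltr_wpDl // addr_ge0.
have d0 : 0 < e / (C + D + 1) by rewrite divr_gt0.
have [y /= Ty] := Hh _ d0; rewrite ltr_pdivlMr // => lt.
have -> : T h - S h = T (h - y) - S (h - y).
  by rewrite (linB lT) (linB lS) Ty opprB addrA subrK.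
apply: le_lt_trans (rnormD _ _) _; rewrite rnormN.
have := bT (h - y); have := bS (h - y); have := rnorm_ge0 (h - y).
by move: lt; rnorm_lra.
Qed.

Lemma dense_eq_lip (V : normedModType R[i]) (f g : H -> V) (c d : R) : dense_map ->
  (forall x y, rnorm (f x - f y) <= c * rnorm (x - y)) ->
  (forall x y, rnorm (g x - g y) <= d * rnorm (x - y)) ->
  (forall x, f (J x) = g (J x)) -> forall h, f h = g h.
Proof.
move=> dJ lf lg fg h.
have ex n : exists x, rnorm (h - J x) < rate R n by apply: dJ; exact: rate_gt0.
pose x n := sval (cid (ex n)).
have xh : slim (fun n => J (x n)) h.
  by apply: rate_slim => n; rewrite rnormBC ltW //; exact: (svalP (cid (ex n))).
apply: slim_unique (slim_lip lf xh) _.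
under eq_fun do rewrite fg.
exact: slim_lip lg xh.
Qed.

Lemma dense_hdot0 (h : H) : dense_map -> (forall x, hdot (J x) h = 0) -> h = 0.
Proof.
move=> dJ Jh; apply: rnorm_small => e e0; rewrite subr0.
have [x hx] := dJ h _ e0; apply: le_lt_trans hx.
have := hdot_CS (h - J x) h; rewrite hdotBl Jh subr0 => h1.
have : Re (hdot h h) <= rnorm (h - J x) * rnorm h.
  by apply: le_trans (Re_le_rnorm _) h1.
rewrite -rnorm_sqr expr2; have := rnorm_ge0 h; rewrite le_eqVlt.
by move=> /orP[/eqP<- _|h0]; [exact: rnorm_ge0|rewrite ler_pM2r].
Qed.

(** Density is used in one variable at a time, both sides being Lipschitz in it. *)
Lemma dense_adjoint (T S : H -> H) : dense_map -> bounded_op T -> bounded_op S ->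
  (forall x y, hdot (T (J x)) (J y) = hdot (J x) (S (J y))) ->
  forall h k, hdot (T h) k = hdot h (S k).
Proof.
move=> dJ /bounded_op_lip[C C0 bT] /bounded_op_lip[D D0 bS] TS h k.
have {}TS y : hdot (T h) (J y) = hdot h (S (J y)).
  apply: (@dense_eq_lip R[i]^o (fun h => hdot (T h) (J y))
     (fun h => hdot h (S (J y))) (C * rnorm (J y)) (rnorm (S (J y)))) => //= u v.
    rewrite -hdotBl (le_trans (hdot_CS _ _)) // mulrAC ler_wpM2r ?rnorm_ge0 //.
  by rewrite -hdotBl (le_trans (hdot_CS _ _)) // mulrC.
apply: (@dense_eq_lip R[i]^o (fun k => hdot (T h) k)
     (fun k => hdot h (S k)) (rnorm (T h)) (rnorm h * D)) => //= u v.
  by rewrite -hdotBr hdot_CS.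
by rewrite -hdotBr (le_trans (hdot_CS _ _)) // -mulrA ler_wpM2l ?rnorm_ge0.
Qed.

Variable comb : R[i] -> E -> E -> E.
Hypothesis J_comb : forall c x y, J (comb c x y) = c *: J x + J y.

(** The value T h is pinned down by |T h - g x| <= C |h - J x| for all x. Linearity, boundedness and
    the values on the dense set all follow from this inequality. The bound on g also makes g
    constant on the fibres of J. *)
Lemma dense_extension (K : hilbertType R) (g : E -> K) (C : R) :
  dense_map -> 0 <= C ->
  (forall c x y, g (comb c x y) = c *: g x + g y) ->
  (forall x, rnorm (g x) <= C * rnorm (J x)) ->
  exists T : H -> K, [/\ linear T, forall h, rnorm (T h) <= C * rnorm h &
    forall x, T (J x) = g x].
Proof.
move=> dJ C0 lg bg.
have c0 : 0 < C + 1 by rewrite ltr_wpDl.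
have bg2 x y : rnorm (g x - g y) <= C * rnorm (J x - J y).
  have := bg (comb (-1) y x); rewrite lg J_comb !scaleN1r.
  by rewrite ![- _ + _]addrC.
have exT h : exists l, forall x, rnorm (l - g x) <= C * rnorm (h - J x).
  have ex n : exists x, rnorm (h - J x) < rate R n / (C + 1).
    by apply: dJ; rewrite divr_gt0 // rate_gt0.
  pose x n := sval (cid (ex n)).
  have xP n : rnorm (h - J (x n)) < rate R n / (C + 1) := svalP (cid (ex n)).
  have xP' n : C * rnorm (h - J (x n)) <= rate R n.
    have := xP n; rewrite ltr_pdivlMr //.
    by have := rnorm_ge0 (h - J (x n)); rnorm_lra.
  have [m n|l lP] := @complete_rate R K (fun n => g (x n)).
    apply: le_trans (bg2 _ _) _.
    have := xP' m; have := xP' n; have := rnorm_tri h (J (x m)) (J (x n)).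
    rewrite (rnormBC (J (x m)) h).
    by move: (rate R m) (rate R n) (rnorm _) (rnorm _) (rnorm _) => a b u v w; nra.
  exists l => y; apply: (@le_rate _ _ _ 2) => // n.
  apply: le_trans (rnorm_tri (g (x n)) _ _) _.
  have := lP n; rewrite rnormBC; have := bg2 (x n) y; have := xP' n.
  have := rnorm_tri h (J (x n)) (J y); rewrite (rnormBC (J (x n)) h).
  move: (rate R n) (rnorm _) (rnorm _) (rnorm _) (rnorm _) (rnorm _).
  by move=> a b u v w z; nra.
pose T h := sval (cid (exT h)).
have TP h x : rnorm (T h - g x) <= C * rnorm (h - J x) := svalP (cid (exT h)) x.
exists T; split=> [c h h'|h|x].
- apply: rnorm_small => e e0; have k0 := rnorm_ge0 c.
  have d0 : 0 < e / (4 * ((C + 1) * (rnorm c + 1))).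
    by rewrite divr_gt0 // !mulr_gt0 // ltr_wpDl.
  have [x xh] := dJ h _ d0; have [y yh] := dJ h' _ d0.
  apply: le_lt_trans (rnorm_tri (g (comb c x y)) _ _) _.
  have k1 := TP (c *: h + h') (comb c x y).
  have k2 : rnorm (g (comb c x y) - (c *: T h + T h')) <=
      rnorm c * (C * rnorm (h - J x)) + C * rnorm (h' - J y).
    rewrite lg opprD addrACA -scalerBr; apply: le_trans (rnormD _ _) _.
    by rewrite rnormZ lerD ?ler_wpM2l // rnormBC TP.
  have k3 : rnorm (c *: h + h' - J (comb c x y)) <=
      rnorm c * rnorm (h - J x) + rnorm (h' - J y).
    rewrite J_comb opprD addrACA -scalerBr; apply: le_trans (rnormD _ _) _.
    by rewrite rnormZ.
  move: k1 k2 k3 xh yh; rewrite !ltr_pdivlMr ?mulr_gt0 ?ltr_wpDl //.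
  have := rnorm_ge0 (h - J x); have := rnorm_ge0 (h' - J y); move: k0.
  move: (rnorm (h - J x)) (rnorm (h' - J y)) (rnorm (_ - (c *: T h + T h')))
    (rnorm (c *: h + h' - _)) (rnorm (_ - g _)) (rnorm c).
  move=> a b u v w k k0 b0 a0 k1 k2 k3 xh yh.
  have h1 : C * v <= C * (k * a + b) by rewrite ler_wpM2l.
  have h2 : 0 <= C * a by rewrite mulr_ge0.
  have h3 : 0 <= C * b by rewrite mulr_ge0.
  have h4 : 0 <= C * b * k by rewrite mulr_ge0.
  have h5 : 0 <= a * k by rewrite mulr_ge0.
  have h6 : 0 <= b * k by rewrite mulr_ge0.
  nra.
- apply/ler_addgt0Pr => e e0.
  have d0 : 0 < e / (2 * (C + 1)) by rewrite divr_gt0 // mulr_gt0.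
  have [x xh] := dJ h _ d0; have h1 := TP h x; have h2 := bg x.
  have h3 : rnorm (T h) <= rnorm (T h - g x) + rnorm (g x).
    by rewrite -[T h in leLHS](subrK (g x)) rnormD.
  have h4 : rnorm (J x) <= rnorm (h - J x) + rnorm h.
    by rewrite rnormBC -[J x in leLHS](subrK h) rnormD.
  move: xh h1 h2 h3 h4; rewrite ltr_pdivlMr ?mulr_gt0 //.
  have := rnorm_ge0 (h - J x); move: (rnorm (h - J x)) (rnorm (T h)) (rnorm (_ - g _))
    (rnorm (g x)) (rnorm (J x)) (rnorm h) => a b u v w z a0 xh h1 h2 h3 h4.
  have : C * w <= C * (a + z) by rewrite ler_wpM2l.
  nra.
- by apply/subr0_eq/rnorm_eq0/eqP; rewrite eq_le rnorm_ge0 andbT;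
    have := TP (J x) x; rewrite subrr rnorm0 mulr0.
Qed.

End Dense.
End HilbertTheory.

(** * Representations of C*-algebras and positivity of Gram matrices *)

Section CstarAlgebra.
Variables (R : realType) (A : cstarType R).
Implicit Types (a b c : A) (k : R[i]).

Lemma rnorm_cmul a b : rnorm (cmul a b) <= rnorm a * rnorm b.
Proof. by rewrite -lecR rmorphM /= -!normr_rnorm; exact: cnormM. Qed.

Lemma rnorm_cstar_cmul a : rnorm (cmul (cstar a) a) = rnorm a ^+ 2.
Proof.
by apply: (@complexI R); rewrite rmorphXn /= -!normr_rnorm; exact: cnorm_star.
Qed.

(** The C*-identity gives |b|^2 <= |cstar b| |b|; this is applied to a and to its adjoint. *)
Lemma rnorm_cstar a : rnorm (cstar a) = rnorm a.
Proof.
have H b : rnorm b <= rnorm (cstar b).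
  have := rnorm_ge0 b; rewrite le_eqVlt => /orP[/eqP <-|b0]; first exact: rnorm_ge0.
  by rewrite -(ler_pM2r b0) -expr2 -rnorm_cstar_cmul rnorm_cmul.
by apply/eqP; rewrite eq_le -{2}(cstarK a) !H.
Qed.

Lemma cmulNl a b : cmul (- a) b = - cmul a b.
Proof. by rewrite -scaleN1r cmulZl scaleN1r. Qed.
Lemma cmulNr a b : cmul a (- b) = - cmul a b.
Proof. by rewrite -scaleN1r cmulZr scaleN1r. Qed.
Lemma cmulBl a b c : cmul (a - b) c = cmul a c - cmul b c.
Proof. by rewrite cmulDl cmulNl. Qed.
Lemma cmulBr a b c : cmul c (a - b) = cmul c a - cmul c b.
Proof. by rewrite cmulDr cmulNr. Qed.
Lemma cstarN a : cstar (- a) = - cstar a.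
Proof. by rewrite -scaleN1r cstarZ rmorphN rmorph1 scaleN1r. Qed.
Lemma cstarB a b : cstar (a - b) = cstar a - cstar b.
Proof. by rewrite cstarD cstarN. Qed.
Lemma cstar0 : cstar (0 : A) = 0.
Proof. by have := cstarZ 0 (0 : A); rewrite !scale0r conjC0 scale0r. Qed.

Lemma expr_small (q e : R) : 0 <= q -> q < 1 -> 0 < e -> exists n, q ^+ n < e.
Proof.
move=> q0 q1 e0; have : `|q| < 1 by rewrite ger0_norm.
move=> /cvg_expr /cvgrPdist_lt /(_ e e0)[N _ NP].
by exists N; have := NP N (leqnn _); rewrite sub0r normrN ger0_norm // exprn_ge0.
Qed.

(* With b as below, 1 - a^* a = (1 - b)^2 in the unitization of A. *)
Lemma one_minus_square a : rnorm a < 1 ->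
  exists b, cstar b = b /\ b + b - cmul b b = cmul (cstar a) a.
Proof.
move=> a1; set c := cmul (cstar a) a.
have cc : cstar c = c by rewrite /c cstarM cstarK.
set r := rnorm c; have r0 : 0 <= r by exact: rnorm_ge0.
have r1 : r < 1 by rewrite /r rnorm_cstar_cmul expr_lt1 // rnorm_ge0.
(* The wanted b is a fixed point of F b = (c + b^2)/2. The scalar q solves q = (r + q^2)/2, so F
   maps the ball of radius q to itself; there it contracts by the factor q < 1. *)
pose q := 1 - Num.sqrt (1 - r).
have s1 : 0 < Num.sqrt (1 - r) by rewrite sqrtr_gt0 subr_gt0.
have q1 : q < 1 by rewrite /q; lra.
have q0 : 0 <= q.
  by rewrite /q subr_ge0 -{2}sqrtr1 ler_wsqrtr // gerBl.
have qE : r + q ^+ 2 = 2 * q.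
  have := sqr_sqrtr (ltW (eqbRL (subr_gt0 _ _) r1)); rewrite /q; move: (Num.sqrt _) => s; nra.
pose half : R[i] := ((2^-1)%:C)%C.
have nh : rnorm half = 2^-1 by rewrite rnorm_real ger0_norm // invr_ge0.
pose F b := half *: (c + cmul b b).
pose b := fix b n := if n is n'.+1 then F (b n') else 0.
have bq n : rnorm (b n) <= q.
  elim: n => [|n IH] /=; first by rewrite rnorm0.
  rewrite /F rnormZ nh ler_pdivrMl // -qE (le_trans (rnormD _ _)) // lerD2l.
  by rewrite (le_trans (rnorm_cmul _ _)) // expr2 ler_pM ?rnorm_ge0.
have FB x y : F x - F y = half *: (cmul x (x - y) + cmul (x - y) y).
  by rewrite /F -scalerBr cmulBr cmulBl addrA subrK opprD addrACA subrr add0r.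
have FL x y (m : R) : rnorm x <= m -> rnorm y <= m ->
    rnorm (F x - F y) <= m * rnorm (x - y).
  move=> xm ym; rewrite FB rnormZ nh ler_pdivrMl // (le_trans (rnormD _ _)) //.
  rewrite mulr_natl mulr2n lerD // (le_trans (rnorm_cmul _ _)) //.
    by rewrite ler_wpM2r ?rnorm_ge0.
  by rewrite mulrC ler_wpM2r ?rnorm_ge0.
have bb n (m : nat) : rnorm (b (n + m)%N - b n) <= q ^+ n.
  elim: n => [|n IH]; first by rewrite add0n subr0 expr0 (le_trans (bq m)) // ltW.
  rewrite addSn /= exprS (le_trans (FL _ _ q (bq _) (bq _))) //.
  by rewrite ler_wpM2l.
have exn j : exists n, q ^+ n < rate R j by apply: expr_small => //; exact: rate_gt0.
pose n j := sval (cid (exn j)).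
have nP j : q ^+ n j < rate R j := svalP (cid (exn j)).
have [i j|l lP] := @complete_rate R A (fun j => b (n j)).
  have ri := rate_gt0 R i; have rj := rate_gt0 R j.
  wlog le_ij : i j ri rj / (n i <= n j)%N.
    move=> W; case/orP: (leq_total (n i) (n j)) => H; first exact: W.
    by rewrite rnormBC [leRHS]addrC; exact: W.
  rewrite rnormBC -(subnKC le_ij) (le_trans (bb _ _)) //.
  by rewrite (le_trans (ltW (nP i))) // lerDl ltW.
have star_b m : cstar (b m) = b m.
  elim: m => [|m IH] /=; first exact: cstar0.
  by rewrite /F cstarZ cstarD cstarM IH cc /half; congr (_ *: _); cring.
have star_l : cstar l = l.
  apply: rnorm_small => e e0; have e20 : 0 < e / 2 by rewrite divr_gt0.
  have [j je] := rate_small e20.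
  apply: le_lt_trans (rnorm_tri (b (n j)) _ _) _.
  rewrite -[X in cstar l - X]star_b -cstarB rnorm_cstar (rnormBC l).
  by have := lP j; move: je; rnorm_lra.
have Fl : F l = l.
  apply: rnorm_small => e e0.
  have ln : rnorm l <= q + 1.
    apply: (@le_rate _ _ _ 1) => // j; rewrite mul1r.
    rewrite -(subrK (b (n j)) l) (le_trans (rnormD _ _)) // rnormBC.
    have := lP j; have := bq (n j); rnorm_lra.
  have e40 : 0 < e / 4 by rewrite divr_gt0.
  have [j je] := rate_small e40.
  apply: le_lt_trans (rnorm_tri (b (n j).+1) _ _) _.
  have h1 : rnorm (F l - b (n j).+1) <= (q + 1) * rate R j.
    rewrite (le_trans (FL _ (b (n j)) (q + 1) ln _)) //.
      by rewrite (le_trans (bq _)) // lerDl.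
    by rewrite rnormBC ler_wpM2l ?lP //; lra.
  have h2 := bb (n j) 1%N; rewrite addn1 in h2.
  have h3 := rnorm_tri (b (n j)) (b (n j).+1) l.
  have h4 := lP j; have h5 := nP j; have h6 := rate_gt0 R j.
  have h7 : (q + 1) * rate R j <= 2 * rate R j by rewrite ler_wpM2r ?ltW //; lra.
  move: je h1 h2 h3 h4 h5 h6 h7; move: (rate R j) (q ^+ _) ((q + 1) * _) => u v w.
  by rnorm_lra.
exists l; split=> //.
have hh : half + half = 1 by rewrite /half -rmorphD /=; congr (_%:C)%C; field.
have -> : l + l = c + cmul l l by rewrite -{1 2}Fl /F -scalerDl hh scale1r.
by rewrite addrK.
Qed.

End CstarAlgebra.

(** * Star representations on pre-Hilbert spaces and their completions *)

Section StarRepresentations.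
Variables (R : realType) (A : cstarType R).

(** The identities are tested against vectors, since the form cannot separate points of E and E has
    no addition. *)
Record pre_star_rep (E : prehilbert R) (act : A -> E -> E) : Prop := {
  psr_star : forall a x y, ph_dot (act a x) y = ph_dot x (act (cstar a) y);
  psr_linear : forall (k : R[i]) a b x y,
    ph_dot (act (k *: a + b) x) y = k * ph_dot (act a x) y + ph_dot (act b x) y;
  psr_mul : forall a b x y,
    ph_dot (act (cmul a b) x) y = ph_dot (act a (act b x)) y }.

Section Contractive.
Variables (E : prehilbert R) (act : A -> E -> E).
Hypothesis rep : pre_star_rep act.
Implicit Types (a : A) (x y : E).

Lemma psr0 x y : ph_dot (act 0 x) y = 0.
Proof.
by have := psr_linear rep (-1) 0 0 x y; rewrite scaler0 addr0 mulN1r addNr.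
Qed.

Lemma psrZ (k : R[i]) a x y : ph_dot (act (k *: a) x) y = k * ph_dot (act a x) y.
Proof. by have := psr_linear rep k a 0 x y; rewrite psr0 !addr0. Qed.

Lemma psrB a b x y :
  ph_dot (act (a - b) x) y = ph_dot (act a x) y - ph_dot (act b x) y.
Proof.
by have := psr_linear rep (-1) b a x y; rewrite scaleN1r mulN1r addrC => ->; rewrite addrC.
Qed.

Lemma psrD a b x y :
  ph_dot (act (a + b) x) y = ph_dot (act a x) y + ph_dot (act b x) y.
Proof. by have := psr_linear rep 1 a b x y; rewrite scale1r mul1r. Qed.

(** With 1 - a^* a = (1 - b)^2, the difference |x|^2 - |a x|^2 equals |x - b x|^2. Boundedness thus
    follows from the algebraic relations alone, without completeness of E. *)
Lemma hn_act_lt1 a x : rnorm a < 1 -> hn (act a x) <= hn x.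
Proof.
move=> /one_minus_square[b [bb bE]].
rewrite -(@ler_pXn2r _ 2) ?nnegrE ?hn_ge0 // !hn_sqr.
rewrite (psr_star rep) [ph_dot x _]ph_dotC -(psr_mul rep) -bE psrB psrD (psr_mul rep).
rewrite cRe_conj -subr_ge0; have := ph_dot_ge0 (ph_sub x (act b x)).
rewrite ph_dotB !ph_dotBr [ph_dot (act b (act b x)) x](psr_star rep) bb.
rewrite (ph_dotC x (act b x)) !ReImE.
by move: (Re _) (Re _) (Re _) => u v w; lra.
Qed.

Lemma hn_act a x : hn (act a x) <= rnorm a * hn x.
Proof.
suff H (m : R) : rnorm a < m -> hn (act a x) <= m * hn x.
  have x1 : 0 < hn x + 1 by rewrite ltr_wpDl ?hn_ge0.
  apply: (@le_rate _ _ _ (hn x)); first exact: hn_ge0.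
  move=> n; have := H (rnorm a + rate R n); rewrite mulrDl [rate _ _ * _]mulrC; apply.
  by rewrite ltrDl rate_gt0.
move=> am; have m0 : 0 < m by apply: le_lt_trans am; exact: rnorm_ge0.
have : hn (act (((m^-1)%:C)%C *: a) x) <= hn x.
  apply: hn_act_lt1; rewrite rnormZ rnorm_real ger0_norm ?invr_ge0 ?ltW //.
  by rewrite mulrC ltr_pdivrMr // mul1r.
suff -> : hn (act (((m^-1)%:C)%C *: a) x) = m^-1 * hn (act a x).
  by rewrite ler_pdivrMl.
apply/eqP; rewrite -(@eqrXn2 _ 2) ?mulr_ge0 ?invr_ge0 ?hn_ge0 ?(ltW m0) //.
rewrite exprMn !hn_sqr psrZ ph_dotC psrZ rmorphM /= -ph_dotC.
apply/eqP; rewrite !ReImE; ring.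
Qed.

End Contractive.

Record star_rep (H : hilbertType R) (rho : A -> H -> H) : Prop := {
  sr_bounded : forall a, bounded_op (rho a);
  sr_linear : forall (k : R[i]) a b h, rho (k *: a + b) h = k *: rho a h + rho b h;
  sr_mul : forall a b h, rho (cmul a b) h = rho a (rho b h);
  sr_star : forall a h k, hdot (rho a h) k = hdot h (rho (cstar a) k) }.

Lemma star_rep_pre (H : hilbertType R) (rho : A -> H -> H) :
  star_rep rho -> @pre_star_rep (hilb_pre H) rho.
Proof.
move=> [_ lr mr sr]; split=> //= [k a b x y|a b x y]; last by rewrite mr.
by rewrite lr hdotP.
Qed.

Lemma sr_contractive (H : hilbertType R) (rho : A -> H -> H) : star_rep rho ->
  forall a h, rnorm (rho a h) <= rnorm a * rnorm h.
Proof.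
by move=> /star_rep_pre r a h; have := hn_act r a h; rewrite !hn_rnorm.
Qed.

Section Lifting.
Variables (E E' : prehilbert R).

Lemma compl_embed_dense : dense_map (@compl_embed R E).
Proof.
move=> g e e0; have e20 : 0 < e / 2 by rewrite divr_gt0.
have /asboolP /(_ _ e20)[x gx] := compl_approx g.
exists x; apply: (@le_lt_trans _ _ (e / 2)); last by lra.
by apply: rnorm_approx => //; exact: ltW.
Qed.

Lemma compl_embed_eq (F : prehilbert R) (x y : F) : (forall v, ph_dot x v = ph_dot y v) ->
  compl_embed x = compl_embed y.
Proof. by move=> xy; apply: val_inj; apply/funext. Qed.

Lemma compl_lift (T : E -> E') (C : R) : 0 <= C ->
  (forall c x y v, ph_dot (T (ph_comb c x y)) v =
     c * ph_dot (T x) v + ph_dot (T y) v) ->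
  (forall x, hn (T x) <= C * hn x) ->
  exists S : completion E -> completion E', [/\ linear S,
    forall h, rnorm (S h) <= C * rnorm h &
    forall x, S (compl_embed x) = compl_embed (T x)].
Proof.
move=> C0 lT bT.
have nJ (F : prehilbert R) (x : F) : rnorm (compl_embed x) = hn x.
  by rewrite rnorm_compl /hn /= compl_embed_dot.
apply: (@dense_extension R E _ _ _ (@compl_embed_comb R E)) => //.
- exact: compl_embed_dense.
- move=> c x y; rewrite -compl_embed_comb; apply: compl_embed_eq => v.
  by rewrite lT ph_dotP.
- by move=> x; rewrite !nJ.
Qed.

End Lifting.

Lemma compl_hdot (E : prehilbert R) (x y : E) :
  hdot (compl_embed x) (compl_embed y) = ph_dot x y.
Proof. exact: compl_embed_dot. Qed.

(** Each operator is bounded by [hn_act], so it extends to the completion, and the relations extend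
    by density. *)
Lemma compl_star_rep (E : prehilbert R) (act : A -> E -> E) :
  pre_star_rep act -> exists rho : A -> completion E -> completion E,
    star_rep rho /\ forall a x, rho a (compl_embed x) = compl_embed (act a x).
Proof.
move=> rep.
have ex a : exists S : completion E -> completion E, [/\ linear S,
    forall h, rnorm (S h) <= rnorm a * rnorm h &
    forall x, S (compl_embed x) = compl_embed (act a x)].
  apply: compl_lift => [|c x y v|x]; first exact: rnorm_ge0.
    by rewrite !(psr_star rep) ph_dotP.
  exact: hn_act.
pose rho a := sval (cid (ex a)).
have rP a : [/\ linear (rho a), forall h, rnorm (rho a h) <= rnorm a * rnorm h &
    forall x, rho a (compl_embed x) = compl_embed (act a x)] := svalP (cid (ex a)).
have rJ a x : rho a (compl_embed x) = compl_embed (act a x) by case: (rP a).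
have rb a : bounded_op (rho a).
  apply/bounded_opP; case: (rP a) => l b _; split=> //.
  by exists (rnorm a) => //; exact: rnorm_ge0.
have dE := @compl_embed_dense E.
exists rho; split=> //; split=> //.
- move=> k a b h.
  have /(congr1 (fun f => f h)) // : rho (k *: a + b) = (fun h => k *: rho a h + rho b h).
  apply: (dense_eq dE) => [//||x]; first exact: bounded_op_comb.
  rewrite !rJ -compl_embed_comb; apply: compl_embed_eq => v.
  by rewrite (psr_linear rep) ph_dotP.
- move=> a b h.
  have /(congr1 (fun f => f h)) // : rho (cmul a b) = rho a \o rho b.
  apply: (dense_eq dE) => [//||x]; first exact: bounded_op_comp.
  by rewrite /= !rJ; apply: compl_embed_eq => v; rewrite (psr_mul rep).
- move=> a; apply: (dense_adjoint dE) => // x y.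
  by rewrite !rJ !compl_hdot (psr_star rep).
Qed.

End StarRepresentations.

(** * Positivity of Gram matrices *)

Section GramPositivity.
Variables (R : realType) (A : cstarType R) (X : hilbertModType A).

Lemma minnerDl (x y z : X) : minner (x + y) z = minner x z + minner y z.
Proof. by rewrite -minner_star minnerDr cstarD !minner_star. Qed.
Lemma minnerMl (x y : X) a : minner (mact x a) y = cmul (cstar a) (minner x y).
Proof. by rewrite -minner_star minnerMr cstarM minner_star. Qed.
Lemma minner0r (x : X) : minner x 0 = 0.
Proof. by have := minnerZr 0 x 0; rewrite !scale0r. Qed.
Lemma minner0l (x : X) : minner 0 x = 0.
Proof. by rewrite -minner_star minner0r cstar0. Qed.
Lemma minner_sumr (x : X) I (s : seq I) (F : I -> X) :
  minner x (\sum_(i <- s) F i) = \sum_(i <- s) minner x (F i).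
Proof. exact: (big_morph (minner x) (minnerDr x) (minner0r x)). Qed.
Lemma minner_suml (x : X) I (s : seq I) (F : I -> X) :
  minner (\sum_(i <- s) F i) x = \sum_(i <- s) minner (F i) x.
Proof.
exact: (big_morph (fun y => minner y x) (fun y z => minnerDl y z x) (minner0l x)).
Qed.

Lemma slim_hdot (H : hilbertType R) (x y : nat -> H) (l l' : H) :
  slim x l -> slim y l' -> slim (fun n => hdot (x n) (y n)) (hdot l l').
Proof.
move=> xl yl e e0.
have c0 : 0 < rnorm l + rnorm l' + 1 by rewrite ltr_wpDl ?addr_ge0 ?rnorm_ge0.
have [d [d0 d1 de]] : exists d : R, [/\ 0 < d, d <= 1 & d * (rnorm l + rnorm l' + 1) <= e].
  exists (Num.min 1 (e / (rnorm l + rnorm l' + 1))); split.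
  - by rewrite lt_min ltr01 divr_gt0.
  - by rewrite ge_min lexx.
  - by rewrite -ler_pdivlMr // ge_min lexx orbT.
have [N1 H1] := xl _ d0; have [N2 H2] := yl _ d0.
exists (maxn N1 N2) => n; rewrite geq_max => /andP[/H1 h1 /H2 h2].
have -> : hdot (x n) (y n) - hdot l l' =
    hdot (x n - l) (y n - l') + (hdot (x n - l) l' + hdot l (y n - l')).
  by rewrite !(hdotBl, hdotBr); ring.
apply: le_lt_trans (rnormD _ _) _.
have k1 := hdot_CS (x n - l) (y n - l').
have k2 : rnorm (hdot (x n - l) l' + hdot l (y n - l')) <=
    rnorm (x n - l) * rnorm l' + rnorm l * rnorm (y n - l').
  by rewrite (le_trans (rnormD _ _)) // lerD // hdot_CS.
have := rnorm_ge0 (x n - l); have := rnorm_ge0 (y n - l').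
have := rnorm_ge0 l; have := rnorm_ge0 l'.
move: (rnorm l) (rnorm l') (rnorm (x n - l)) (rnorm (y n - l')) k1 k2 de h1 h2.
move: (rnorm (hdot (x n - l) (y n - l'))) (rnorm (_ + hdot l _)).
move=> p q a b u v k1 k2 de h1 h2 b0 a0 v0 u0.
have : u * v <= u * 1 by rewrite ler_wpM2l // (le_trans (ltW h2)).
have : u * b <= d * b by rewrite ler_wpM2r // ltW.
have : a * v <= a * d by rewrite ler_wpM2l // ltW.
lra.
Qed.

Lemma slim_sum (V : normedZmodType R[i]) I (s : seq I) (x : I -> nat -> V) (l : I -> V) :
  (forall i, slim (x i) (l i)) ->
  slim (fun n => \sum_(i <- s) x i n) (\sum_(i <- s) l i).
Proof.
move=> xl; elim: s => [|i s IH].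
  by rewrite big_nil; under eq_fun do rewrite big_nil; exact: slim_cst.
by rewrite big_cons; under eq_fun do rewrite big_cons; exact: slim_add.
Qed.

Lemma closed_subspace_closure (H : hilbertType R) (S : set H) : S 0 ->
  (forall (k : R[i]) h h', S h -> S h' -> S (k *: h + h')) ->
  closed_subspace (closure S).
Proof.
move=> S0 lS; split=> [||k h h' /closureP ch /closureP ch'].
- exact: closed_closure.
- exact: subset_closure.
apply/closureP => e e0.
have c0 : 0 < rnorm k + 1 by rewrite ltr_wpDl ?rnorm_ge0.
have d0 : 0 < e / (rnorm k + 1) by rewrite divr_gt0.
have [x Sx hx] := ch _ d0; have [y Sy hy] := ch' _ d0.
exists (k *: x + y); first exact: lS.
rewrite opprD addrACA -scalerBr; apply: le_lt_trans (rnormD _ _) _; rewrite rnormZ.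
move: hx hy; rewrite !ltr_pdivlMr //; have := rnorm_ge0 k.
move: (rnorm k) (rnorm (h - x)) (rnorm (h' - y)) => a b c; nra.
Qed.

Section HilbertGram.
Variables (H : hilbertType R) (rho : A -> H -> H).
Hypothesis rep : star_rep rho.

Let rlin a : linear (rho a). Proof. by case: (sr_bounded rep a). Qed.

Lemma sr0 h : rho 0 h = 0.
Proof. by have := sr_linear rep (-1) 0 0 h; rewrite scaler0 addr0 scaleN1r addNr. Qed.

Lemma sr_sum I (s : seq I) (F : I -> A) h :
  rho (\sum_(i <- s) F i) h = \sum_(i <- s) rho (F i) h.
Proof.
apply: (big_morph (rho^~ h)) => [a b|]; last exact: sr0.
by have := sr_linear rep 1 a b h; rewrite !scale1r.
Qed.

(** The squared norm of the sum of the x_p ⊗ h_p in the interior tensor product of X and H over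
    rho. *)
Definition gram (s : seq (X * H)) : R[i] :=
  \sum_(p <- s) \sum_(q <- s) hdot (rho (minner q.1 p.1) p.2) q.2.

(** All vectors come from one h, so the letters collect into x = sum x_p a_p, and the sum is
    (rho(<x,x>) h, h) with <x,x> of the form b^* b. *)
Lemma gram_cyclic (s : seq (X * A)) h :
  0 <= Re (gram [seq (p.1, rho p.2 h) | p <- s]).
Proof.
pose x := \sum_(p <- s) mact p.1 p.2.
have -> : gram [seq (p.1, rho p.2 h) | p <- s] = hdot (rho (minner x x) h) h.
  rewrite /gram big_map /x minner_sumr sr_sum hdot_suml; apply: eq_bigr => p _.
  rewrite big_map minner_suml sr_sum hdot_suml; apply: eq_bigr => q _ /=.
  by rewrite -{1}(cstarK q.2) -(sr_star rep) -!(sr_mul rep) minnerMl minnerMr cmulA.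
have [b ->] := minner_pos x.
by rewrite (sr_mul rep) (sr_star rep) cstarK Re_hdot_ge0.
Qed.

(** Induction on the number of vectors. Let M be the closure of rho(A) h0. Both M and its complement
    are invariant, so the sum splits. The part in M is a limit of cyclic sums; in the other part the
    entry of h0 drops out. *)
Lemma gram_ge0 (s : seq (X * H)) : 0 <= Re (gram s).
Proof.
have [n] := ubnP (size s); elim: n s => // n IH [|[x0 h0] s] /=.
  by rewrite /gram big_nil.
rewrite ltnS => sn; set s0 := _ :: _.
pose S := [set rho a h0 | a in [set: A]].
have cM : closed_subspace (closure S).
  apply: closed_subspace_closure; first by exists 0 => //; exact: sr0.
  move=> k _ _ [a _ <-] [b _ <-]; exists (k *: a + b) => //; exact: sr_linear.
set M := closure S in cM; have [clM M0 lM] := cM.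
have exP k := closed_projection k cM.
pose P k := s2val (cid2 (exP k)).
have PM k : M (P k) := s2valP (cid2 (exP k)).
have PO k m : M m -> hdot (k - P k) m = 0 := s2valP' (cid2 (exP k)) m.
have Minv a k : M k -> M (rho a k).
  move=> /closureP Mk; apply/closureP => e e0.
  have [C C0 bC] := bounded_op_lip (sr_bounded rep a).
  have c0 : 0 < C + 1 by rewrite ltr_wpDl.
  have [|_ [b _ <-] kb] := Mk (e / (C + 1)); first by rewrite divr_gt0.
  exists (rho a (rho b h0)); first by exists (cmul a b) => //; exact: sr_mul.
  rewrite ltr_pdivlMr // in kb; apply: le_lt_trans (bC _ _) _; apply: le_lt_trans kb.
  by have := rnorm_ge0 (k - rho b h0); rnorm_lra.
(* This vector lies in M and is orthogonal to M. The vector h0 itself may lie outside M, since rho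
   can be degenerate. *)
have r0 a : rho a (h0 - P h0) = 0.
  have Mr : M (rho a (h0 - P h0)).
    rewrite (linB (rlin a)) addrC -scaleN1r; apply: (lM); first exact: Minv.
    by apply: subset_closure; exists a.
  apply/rnorm_eq0/eqP; rewrite -sqrf_eq0 rnorm_sqr.
  by rewrite (sr_star rep) PO ?eqxx //; exact: Minv.
have gram_split s1 : gram s1 = gram [seq (p.1, P p.2) | p <- s1] +
    gram [seq (p.1, p.2 - P p.2) | p <- s1].
  rewrite /gram !big_map -big_split /=; apply: eq_bigr => p _.
  rewrite !big_map -big_split /=; apply: eq_bigr => q _ /=.
  set a := minner _ _.
  have key (u v w z : H) : hdot (rho a u) z = 0 -> hdot (rho a w) v = 0 ->
      hdot (rho a (u + w)) (v + z) = hdot (rho a w) z + hdot (rho a u) v.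
    move=> uz wv; rewrite (linD (rlin a)) hdotDl !hdotDr uz wv.
    by rewrite addr0 add0r addrC.
  rewrite -{1}(subrK (P p.2) p.2) -{1}(subrK (P q.2) q.2); apply: key.
    by rewrite (sr_star rep) PO //; exact: Minv.
  by rewrite hdotC PO ?conjC0 //; exact: Minv.
rewrite gram_split cRe_add addr_ge0 //.
  (* The choice is made total with the value 0 outside M; it is applied only to projections onto
     M. *)
  have exA (m : nat) k : exists a, M k -> rnorm (k - rho a h0) < rate R m.
    have [Mk|nMk] := pselect (M k); last by exists 0.
    have [_ [a _ <-] lt] := proj1 (closureP _ _) Mk _ (rate_gt0 R m).
    by exists a.
  pose a m k := sval (cid (exA m k)).
  have aP m k : M k -> rnorm (k - rho (a m k) h0) < rate R m := svalP (cid (exA m k)).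
  have al k : M k -> slim (fun m => rho (a m k) h0) k.
    by move=> Mk; apply: rate_slim => m; rewrite rnormBC ltW // aP.
  pose s1 m := [seq (p.1, rho (a m (P p.2)) h0) | p <- s0].
  have s1l : slim (fun m => gram (s1 m)) (gram [seq (p.1, P p.2) | p <- s0]).
    rewrite /gram big_map; under eq_fun do rewrite big_map.
    apply: slim_sum => p; rewrite big_map; under eq_fun do rewrite big_map.
    apply: slim_sum => q /=; apply: slim_hdot; last exact: al.
    have [C C0 bC] := bounded_op_lip (sr_bounded rep (minner q.1 p.1)).
    exact: slim_lip bC (al _ (PM _)).
  apply: (slim_ge s1l) => m.
  have -> : s1 m = [seq (p.1, rho p.2 h0) | p <- [seq (p.1, a m (P p.2)) | p <- s0]].
    by rewrite -map_comp.
  exact: gram_cyclic.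
have -> : gram [seq (p.1, p.2 - P p.2) | p <- s0] =
    gram [seq (p.1, p.2 - P p.2) | p <- s].
  rewrite /gram /s0 /= big_cons /= big1 ?add0r; last by move=> q _; rewrite r0 hdot0l.
  apply: eq_bigr => p _; rewrite big_cons /= (sr_star rep) r0 hdot0r add0r.
  by [].
by apply: IH; rewrite size_map.
Qed.

End HilbertGram.

(** This is the form needed in the induction on words, where E carries a degenerate form; the
    Hilbert space case applies to its completion. *)
Lemma pre_gram_ge0 (E : prehilbert R) (act : A -> E -> E) (s : seq (X * E)) :
  pre_star_rep act ->
  0 <= Re (\sum_(p <- s) \sum_(q <- s) ph_dot (act (minner q.1 p.1) p.2) q.2).
Proof.
move=> /compl_star_rep[rho [rep rJ]].
have := gram_ge0 rep [seq (p.1, compl_embed p.2) | p <- s].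
rewrite /gram big_map; set a := \sum_(p <- s) _; set b := \sum_(p <- s) _.
suff -> : a = b by [].
apply: eq_bigr => p _; rewrite big_map; apply: eq_bigr => q _.
by rewrite /= rJ compl_hdot.
Qed.

End GramPositivity.

(** * Completely contractive representations are row contractive *)

Section SymmetricOperator.
Variables (R : realType) (V : lmodType R[i]) (d : V -> V -> R[i]).
Hypothesis dP : forall c x y v, d (c *: x + y) v = c * d x v + d y v.
Hypothesis dC : forall x y, d x y = (d y x)^*.
Hypothesis d_ge0 : forall x, 0 <= Re (d x x).
Variable Y : V -> V.
Hypothesis lY : forall c x y, Y (c *: x + y) = c *: Y x + Y y.
Hypothesis sY : forall x y, d (Y x) y = d x (Y y).

Local Notation q x := (Re (d x x)).
Local Notation b x := (Re (d (Y x) x)).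

Lemma sym_dD x y v : d (x + y) v = d x v + d y v.
Proof. by have := dP 1 x y v; rewrite scale1r mul1r. Qed.
Lemma sym_dN x v : d (- x) v = - d x v.
Proof.
have d0 : d 0 v = 0.
  by have := dP (-1) 0 0 v; rewrite scaler0 addr0 mulN1r addNr.
by have := dP (-1) x 0 v; rewrite scaleN1r d0 !addr0 mulN1r.
Qed.
Lemma sym_dDr x y v : d v (x + y) = d v x + d v y.
Proof. by rewrite dC sym_dD rmorphD /= -!dC. Qed.
Lemma sym_dNr x v : d v (- x) = - d v x.
Proof. by rewrite dC sym_dN rmorphN /= -!dC. Qed.

Lemma symD x y : Y (x + y) = Y x + Y y.
Proof. by have := lY 1 x y; rewrite !scale1r. Qed.
Lemma symN x : Y (- x) = - Y x.
Proof.
have Y0 : Y 0 = 0 by have := lY (-1) 0 0; rewrite scaler0 addr0 scaleN1r addNr.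
by have := lY (-1) x 0; rewrite !scaleN1r Y0 !addr0.
Qed.

Lemma Re_dC x y : Re (d x y) = Re (d y x).
Proof. by rewrite dC cRe_conj. Qed.

Lemma sqnorm_add x : q (x + Y x) = q x + 2 * b x + q (Y x).
Proof. by rewrite !sym_dD !sym_dDr !ReImE (Re_dC x (Y x)); ring. Qed.

Lemma sqnorm_sub x : q (x - Y x) = q x - 2 * b x + q (Y x).
Proof. by rewrite !sym_dD !sym_dDr !sym_dN !sym_dNr !ReImE (Re_dC x (Y x)); ring. Qed.

(** This is (1 - Y)(1 + Y)^2 = (1 + Y) - Y (1 + Y) Y as quadratic forms. Taken at the vectors Y^m x,
    the right-hand sides telescope. *)
Lemma sym_add x :
  q (x + Y x) - b (x + Y x) = (q x + b x) - (q (Y x) + b (Y x)).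
Proof.
rewrite sqnorm_add symD !sym_dD !sym_dDr !ReImE (sY (Y x) x); ring.
Qed.

(** As (1 - Y)(1 + Y) = 1 - Y^2, the squared norm is a second difference of |Y^m x|^2 in m, so it
    telescopes as well. *)
Lemma sqnorm_sub2 x :
  q ((x + Y x) - Y (x + Y x)) = (q x - q (Y x)) - (q (Y x) - q (Y (Y x))).
Proof.
have -> : (x + Y x) - Y (x + Y x) = x - Y (Y x) by rewrite symD opprD addrA addrK.
rewrite !sym_dD !sym_dDr !sym_dN !sym_dNr !ReImE (Re_dC x (Y (Y x))) (sY (Y x) x).
ring.
Qed.

Variable r : R.
Hypothesis b_ge0 : forall x, 0 <= b x.
Hypothesis b_le : forall x, b x <= r * q x.

(** Cauchy-Schwarz for the form (Y u, v) at x and Y x: |Y x|^4 <= (Y x, x) (Y Y x, Y x) <= r |x|^2 r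
    |Y x|^2. *)
Lemma sym_norm_le x : q (Y x) <= r ^+ 2 * q x.
Proof.
have sC u v : d (Y u) v = (d (Y v) u)^* by rewrite sY dC.
have sP c u v w : d (Y (c *: u + v)) w = c * d (Y u) w + d (Y v) w by rewrite lY dP.
pose F := @PreHilbert R V (fun u v => d (Y u) v) (fun c u v => c *: u + v) 0
  sP sC b_ge0.
have := @CauchySchwarz R F x (Y x); rewrite /= => /(le_trans (Re_le_rnorm _)).
rewrite -(@ler_pXn2r _ 2) ?nnegrE ?d_ge0 ?mulr_ge0 ?hn_ge0 //.
rewrite exprMn !hn_sqr /=; have := b_le x; have := b_le (Y x).
have := b_ge0 x; have := b_ge0 (Y x); have := d_ge0 (Y x); have := d_ge0 x.
move: (q x) (q (Y x)) (b x) (b (Y x)) => u v w z u0 v0 z0 w0 zr wr H.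
have [->|v1] := eqVneq v 0; first by rewrite mulr_ge0 // sqr_ge0.
have vp : 0 < v by rewrite lt_def v1.
rewrite -(ler_pM2l vp) -expr2 (le_trans H) //.
have -> : v * (r ^+ 2 * u) = (r * u) * (r * v) by ring.
by rewrite ler_pM.
Qed.

Lemma sym_iter_le n x : q (iter n Y x) <= (r ^+ 2) ^+ n * q x.
Proof.
elim: n => [|n IH]; first by rewrite expr0 mul1r.
rewrite iterS exprS -mulrA (le_trans (sym_norm_le _)) // ler_wpM2l ?sqr_ge0 //.
Qed.

End SymmetricOperator.

Section RepresentationFacts.
Variables (R : realType) (A : cstarType R) (X : hilbertModType A).
Variable phi : correspondence X.
Variables (H : hilbertType R) (rho : A -> H -> H) (t : X -> H -> H).
Hypothesis rep : representation phi rho t.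

Lemma representation_star_rep : star_rep rho.
Proof.
split; [exact: rho_bounded rep|exact: rho_linear rep|exact: rho_mul rep|].
by move=> a h k; rewrite (adjP (rho_bounded rep a)) -(rho_star rep).
Qed.

Lemma t_add x y h : t (x + y) h = t x h + t y h.
Proof. by have := t_linear rep 1 x y h; rewrite !scale1r. Qed.
Lemma t_zero h : t 0 h = 0.
Proof.
by have := t_linear rep (-1) 0 0 h; rewrite scaler0 addr0 scaleN1r addNr.
Qed.
Lemma t_scale k x h : t (k *: x) h = k *: t x h.
Proof. by have := t_linear rep k x 0 h; rewrite t_zero !addr0. Qed.
Lemma t_sum I (s : seq I) (F : I -> X) h :
  t (\sum_(i <- s) F i) h = \sum_(i <- s) t (F i) h.
Proof. by apply: (big_morph (t^~ h)) => [x y|]; [exact: t_add|exact: t_zero]. Qed.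
Lemma t_lin x : linear (t x). Proof. by case: (t_bounded rep x). Qed.

Lemma rnorm_minner (x : X) : rnorm (minner x x) = rnorm x ^+ 2.
Proof.
by apply: (@complexI R); rewrite rmorphXn /= -!normr_rnorm minner_norm.
Qed.

Hypothesis iso : toeplitz rho t.

Lemma toeplitz_hdot x y h k : hdot (t x h) (t y k) = hdot (rho (minner y x) h) k.
Proof.
by rewrite (adjP (t_bounded rep x)) iso (sr_star representation_star_rep) minner_star.
Qed.

Lemma toeplitz_le x h : rnorm (t x h) <= rnorm x * rnorm h.
Proof.
rewrite -(@ler_pXn2r _ 2) ?nnegrE ?mulr_ge0 ?rnorm_ge0 // rnorm_sqr toeplitz_hdot.
rewrite (le_trans (Re_le_rnorm _)) // (le_trans (hdot_CS _ _)) //.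
rewrite exprMn [rnorm h ^+ 2]expr2 mulrA ler_wpM2r ?rnorm_ge0 //.
by rewrite -rnorm_minner; exact: sr_contractive representation_star_rep _ _.
Qed.

End RepresentationFacts.

Lemma adj_le (R : realType) (H K : hilbertType R) (T : H -> K) (C : R) :
  bounded_op T -> 0 <= C -> (forall h, rnorm (T h) <= C * rnorm h) ->
  forall k, rnorm (adj T k) <= C * rnorm k.
Proof.
move=> bT C0 TC k.
have : rnorm (adj T k) ^+ 2 <= C * rnorm (adj T k) * rnorm k.
  rewrite rnorm_sqr -(adjP bT) (le_trans (Re_le_rnorm _)) //.
  by rewrite (le_trans (hdot_CS _ _)) // ler_wpM2r ?rnorm_ge0.
have := rnorm_ge0 (adj T k); rewrite le_eqVlt => /orP[/eqP <- _|a0].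
  by rewrite mulr_ge0 ?rnorm_ge0.
by rewrite expr2 mulrAC ler_pM2r.
Qed.

Section RowBound.
Variables (R : realType) (A : cstarType R) (X : hilbertModType A).
Variable phi : correspondence X.

(* Complete contractivity is applied to the square matrix all of whose rows are
   eta; the number of rows cancels on both sides. *)
Lemma cc_row (H : hilbertType R) (rho : A -> H -> H) (t : X -> H -> H)
    (I : finType) (eta : I -> X) (C : R) :
  representation phi rho t -> completely_contractive phi t -> 0 < C ->
  (forall (K : hilbertType R) (sigma : A -> K -> K) (s : X -> K -> K),
     isometric_representation phi sigma s ->
     forall k, \sum_i rnorm (adj (s (eta i)) k) ^+ 2 <= C * rnorm k ^+ 2) ->
  forall v : I -> H,
    rnorm (\sum_i t (eta i) (v i)) ^+ 2 <= C * \sum_i rnorm (v i) ^+ 2.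
Proof.
move=> rep cc C0 Hiso v; pose n := #|I|.
have sqC (K : hilbertType R) (J : finType) (h : J -> K) :
    \sum_j `|h j| ^+ 2 = ((\sum_j rnorm (h j) ^+ 2)%:C)%C.
  by rewrite rmorph_sum; apply: eq_bigr => j _; rewrite normr_rnorm rmorphXn.
pose en (j : 'I_n) : I := enum_val (j : 'I_#|I|).
have en_bij : bijective en by exact: enum_val_bij.
pose x : 'M[X]_n := \matrix_(i, j) eta (en j).
have ub : (toeplitz_mxnorm phi (map_mx (@ToeplitzX R A X) x) <=
    (Num.sqrt (n%:R * C))%:E)%E.
  apply: ge_ereal_sup => _ [K [sigma [s [iso ->]]]].
  apply: ge_ereal_sup => _ [h /= hle <-]; rewrite lee_fin ler_wsqrtr //.
  rewrite sqC /=.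
  move: hle; rewrite sqC -[1]/((1%:C)%C) lecR => hle.
  pose w := \sum_j s (eta (en j)) (h j).
  rewrite (eq_bigr (fun=> rnorm w ^+ 2)); last first.
    by move=> i _; congr (rnorm _ ^+ 2); apply: eq_bigr => j _; rewrite !mxE.
  rewrite sumr_const card_ord -[leLHS]mulr_natl ler_wpM2l //.
  have [rs _] := iso.
  have wE : rnorm w ^+ 2 = \sum_j Re (hdot (h j) (adj (s (eta (en j))) w)).
    rewrite rnorm_sqr {1}/w hdot_suml cRe_sum; apply: eq_bigr => j _.
    by rewrite (adjP (t_bounded rs _)).
  (* The weights in ab <= C a^2 / 2 + b^2 / (2C) are such that the sum of the second terms is at
     most |w|^2 / 2, which is absorbed on the left. *)
  have wle : rnorm w ^+ 2 <= \sum_j (C / 2 * rnorm (h j) ^+ 2 +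
      (2 * C)^-1 * rnorm (adj (s (eta (en j))) w) ^+ 2).
    rewrite [leLHS]wE; apply: ler_sum => j _.
    rewrite (le_trans (Re_le_rnorm _)) // (le_trans (hdot_CS _ _)) //.
    move: (rnorm _) (rnorm _) => b a.
    rewrite -subr_ge0.
    have -> : C / 2 * a ^+ 2 + (2 * C)^-1 * b ^+ 2 - a * b =
      (2 * C)^-1 * (C * a - b) ^+ 2 by field; rewrite gt_eqF.
    by rewrite mulr_ge0 ?sqr_ge0 // invr_ge0 mulr_ge0 // ltW.
  have : \sum_j rnorm (adj (s (eta (en j))) w) ^+ 2 <= C * rnorm w ^+ 2.
    apply: le_trans (Hiso _ _ _ iso w).
    by rewrite [leRHS](reindex en) //; exact: onW_bij en_bij.
  move: wle; rewrite big_split /= -!mulr_sumr.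
  move: (rnorm w ^+ 2) (\sum_j _) (\sum_j _) hle => u b a a1 uab bu.
  have k1 : (2 * C)^-1 * b <= (2 * C)^-1 * (C * u).
    by rewrite ler_wpM2l // invr_ge0 mulr_ge0 // ltW.
  have k2 : (2 * C)^-1 * (C * u) = u / 2 by field; rewrite gt_eqF.
  have k3 : C / 2 * a <= C / 2 by rewrite ler_piMr // divr_ge0 // ltW.
  lra.
have S0 : 0 <= \sum_i rnorm (v i) ^+ 2 by rewrite sumr_ge0 // => i _; exact: sqr_ge0.
have [Sz|Snz] := eqVneq (\sum_i rnorm (v i) ^+ 2) 0.
  have v0 i : v i = 0.
    apply/rnorm_eq0/eqP; rewrite -sqrf_eq0 eq_le sqr_ge0 andbT -Sz.
    by rewrite (bigD1 i) //= lerDl sumr_ge0 // => j _; exact: sqr_ge0.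
  rewrite big1 ?rnorm0 ?expr0n ?mulr_ge0 ?(ltW C0) // => i _.
  by rewrite v0 (lin0 (t_lin rep _)).
have Sp : 0 < \sum_i rnorm (v i) ^+ 2 by rewrite lt_def Snz.
have [n0|n_gt0] := posnP n.
  rewrite big1 ?rnorm0 ?expr0n ?mulr_ge0 ?(ltW C0) // => i _.
  by have := fintype0 i n0.
set S := \sum_i _ in S0 Snz Sp *.
(* [opmx_norm] ranges over the unit ball, so v is scaled to a unit vector. *)
pose l := (Num.sqrt S)^-1.
have l0 : 0 < l by rewrite invr_gt0 sqrtr_gt0.
have l2 : l ^+ 2 * S = 1 by rewrite exprVn sqr_sqrtr // mulVf.
have nl : rnorm ((l%:C)%C : R[i]) = l by rewrite rnorm_real gtr0_norm.
have := le_trans (cc n x) ub => /(le_trans (ereal_sup_ubound _)).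
move=> /(_ _ (ex_intro2 _ _ (fun j : 'I_n => (l%:C)%C *: v (en j)) _ erefl)).
have hl : \sum_(j < n) rnorm ((l%:C)%C *: v (en j)) ^+ 2 = 1.
  rewrite -l2 /S mulr_sumr [RHS](reindex en); last exact: onW_bij en_bij.
  by apply: eq_bigr => j _; rewrite rnormZ nl exprMn.
rewrite /= sqC hl => /(_ (lexx _)).
rewrite lee_fin sqC /= ler_sqrt ?mulr_ge0 ?(ltW C0) //.
rewrite (eq_bigr (fun=> l ^+ 2 * rnorm (\sum_i t (eta i) (v i)) ^+ 2)); last first.
  move=> i _; rewrite -exprMn -{2}nl -rnormZ scaler_sumr; congr (rnorm _ ^+ 2).
  rewrite [RHS](reindex en); last exact: onW_bij en_bij.
  by apply: eq_bigr => j _; rewrite !mxE (linZ (t_lin rep _)).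
rewrite sumr_const card_ord -[leLHS]mulr_natl ler_pM2l ?ltr0n // => le1.
have -> : rnorm (\sum_i t (eta i) (v i)) ^+ 2 =
    l ^+ 2 * rnorm (\sum_i t (eta i) (v i)) ^+ 2 * S.
  by rewrite mulrAC l2 mul1r.
by rewrite ler_wpM2r.
Qed.

End RowBound.

Lemma adj_linear (R : realType) (H K : hilbertType R) (T : H -> K) :
  bounded_op T -> linear (adj T).
Proof.
move=> bT c x y; apply: hdot_inj_r => h.
by rewrite hdotDr hdotZr -!(adjP bT) hdotDr hdotZr.
Qed.

Lemma iter_linear (R : realType) (V : lmodType R[i]) (Y : V -> V) n :
  (forall c x y, Y (c *: x + y) = c *: Y x + Y y) ->
  forall c x y, iter n Y (c *: x + y) = c *: iter n Y x + iter n Y y.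
Proof. by move=> lY c x y; elim: n => //= n ->; rewrite lY. Qed.

(* A row xi with Gram matrix G is multiplied by the powers of
   Y = 1 - c (G + e), where c is small enough for Y to be a strict positive
   contraction. Since (1 - Y)^-1 = (1 + sum_m ((1 + Y) Y^m)^2) / 2, the rows
   xi and xi (1 + Y) Y^m together are approximately a square root of
   (1 - Y)^-1 applied to xi, and this avoids functional calculus in M_n(A). *)
Section RowContraction.
Variables (R : realType) (A : cstarType R) (X : hilbertModType A).
Variables (phi : correspondence X) (n : nat) (xi : 'I_n -> X) (e : R).
Hypothesis e0 : 0 < e.

Local Notation G := (fun i j => minner (xi i) (xi j)).
(** [M1] bounds the sum of s(xi_i) adj(s(xi_i)) in every isometric representation, and [M2] bounds
    the matrix rho(G) on H^n. As c (M1 + M2 + e) = 1, the operator corresponding to Y is positive in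
    both places, and at most a < 1. *)
Let M1 : R := \sum_i rnorm (xi i) ^+ 2.
Let M2 : R := \sum_i \sum_j rnorm (G i j).
Let c : R := (M1 + M2 + e)^-1.
Let a : R := 1 - c * e.
Local Notation cC := ((c%:C)%C).
Local Notation aC := ((a%:C)%C).

Fact row_M1 : 0 <= M1.
Proof. by rewrite sumr_ge0 // => i _; exact: sqr_ge0. Qed.
Fact row_M2 : 0 <= M2.
Proof.
by apply: sumr_ge0 => i _; apply: sumr_ge0 => j _; exact: rnorm_ge0.
Qed.
Fact row_c : 0 < c.
Proof. by rewrite invr_gt0 ltr_wpDl // addr_ge0 ?row_M1 ?row_M2. Qed.
Fact row_cM : c * M1 + c * M2 + c * e = 1.
Proof.
rewrite -!mulrDr mulVf // gt_eqF // ltr_wpDl // addr_ge0 ?row_M1 ?row_M2 //.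
Qed.
Fact row_cM1 : 0 <= c * M1. Proof. by rewrite mulr_ge0 ?row_M1 // ltW ?row_c. Qed.
Fact row_cM2 : 0 <= c * M2. Proof. by rewrite mulr_ge0 ?row_M2 // ltW ?row_c. Qed.
Fact row_ce : 0 < c * e. Proof. by rewrite mulr_gt0 ?row_c. Qed.

(** Right multiplication of the row x by the matrix Y = a - c G. *)
Definition row_step (x : 'I_n -> X) (j : 'I_n) : X :=
  aC *: x j - cC *: \sum_i mact (x i) (G i j).
Definition row_iter m := iter m row_step xi.
Arguments row_iter : simpl never.

Definition row_family N (i : 'I_n + 'I_N * 'I_n) : X :=
  match i with
  | inl i => xi i
  | inr (m, i) => row_iter m i + row_iter m.+1 i
  end.

(** In an isometric representation, multiplying the row by Y on the right amounts to multiplying by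
    one operator z on the left. The estimate therefore takes place on K itself and is uniform in
    N. *)
Lemma row_iso_bound (K : hilbertType R) (sigma : A -> K -> K) (s : X -> K -> K) N k :
  isometric_representation phi sigma s ->
  \sum_i rnorm (adj (s (row_family (N := N) i)) k) ^+ 2 <= 2 / c * rnorm k ^+ 2.
Proof.
move=> [rep iso]; have c0 := row_c.
pose z k := aC *: k - cC *: \sum_i s (xi i) (adj (s (xi i)) k).
have zE w : z w = aC *: w - cC *: \sum_i s (xi i) (adj (s (xi i)) w) by [].
have bs x := t_bounded rep x.
have sl x := t_lin rep x.
have lz d x y : z (d *: x + y) = d *: z x + z y.
  rewrite /z; under eq_bigr do rewrite (adj_linear (bs _)) sl.
  rewrite big_split /= -scaler_sumr !scalerDr !scalerN !scalerA opprD.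
  by rewrite [d * aC]mulrC [d * cC]mulrC addrACA.
have sz x y : hdot (z x) y = hdot x (z y).
  rewrite /z hdotBl hdotBr !hdotZl !hdotZr hdot_suml hdot_sumr !conjC_real.
  congr (_ - _ * _); apply: eq_bigr => i _.
  by rewrite (adjP (bs _)) (adjPr (bs _)).
have szn m x y : hdot (iter m z x) y = hdot x (iter m z y).
  by elim: m x y => // m IH x y; rewrite iterS sz IH -iterSr.
(* The Toeplitz relation turns s(xi_i) sigma(G_ij) into s(xi_i) adj(s(xi_i)) s(xi_j). *)
have sxi m j h : s (row_iter m j) h = iter m z (s (xi j) h).
  elim: m j h => // m IH j h; rewrite /row_iter iterS -/(row_iter m) /row_step.
  have sN x : s (- x) h = - s x h by rewrite -scaleN1r (t_scale rep) scaleN1r.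
  rewrite (t_add rep) sN !(t_scale rep) (t_sum rep) IH.
  under eq_bigr do rewrite -(t_right rep) IH -iso.
  rewrite iterSr zE.
  have itD u v : iter m z (u + v) = iter m z u + iter m z v.
    by have := iter_linear m lz 1 u v; rewrite !scale1r.
  have it0 : iter m z 0 = 0.
    by have := iter_linear m lz (-1) 0 0; rewrite scaler0 addr0 scaleN1r addNr.
  have itZ d u : iter m z (d *: u) = d *: iter m z u.
    by have := iter_linear m lz d u 0; rewrite it0 !addr0.
  have itB u v : iter m z (u - v) = iter m z u - iter m z v.
    by have := iter_linear m lz (-1) v u; rewrite !scaleN1r ![- _ + _]addrC.
  rewrite itB !itZ; congr (_ - _ *: _).
  by symmetry; apply: (big_morph (iter m z) itD it0).
pose q k := \sum_i rnorm (adj (s (xi i)) k) ^+ 2.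
have adjE m i w : adj (s (row_iter m i + row_iter m.+1 i)) w =
    adj (s (xi i)) (iter m z w + z (iter m z w)).
  move: w; suff -> : adj (s (row_iter m i + row_iter m.+1 i)) =
    (fun w => adj (s (xi i)) (iter m z w + z (iter m z w))) by [].
  apply: adj_unique => h w; rewrite (t_add rep) !sxi hdotDl !szn -(adjP (bs _)).
  by rewrite -hdotDr.
have bE w : Re (hdot (z w) w) = a * rnorm w ^+ 2 - c * q w.
  rewrite /z hdotBl !hdotZl hdot_suml /q; under eq_bigr do rewrite (adjP (bs _)).
  rewrite !ReImE hdot_normE !ReImE !mul0r !subr0; congr (_ - _ * _).
  by rewrite cRe_sum; apply: eq_bigr => i _; rewrite hdot_normE.
have q0 w : 0 <= q w by rewrite sumr_ge0 // => i _; exact: sqr_ge0.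
have qM w : q w <= M1 * rnorm w ^+ 2.
  rewrite /q /M1 mulr_suml ler_sum // => i _; rewrite -exprMn.
  rewrite ler_pXn2r ?nnegrE ?mulr_ge0 ?rnorm_ge0 //.
  by apply: adj_le (bs _) (rnorm_ge0 _) _ _ => h; exact: toeplitz_le rep iso _ _.
pose g w := Re (hdot w w) + Re (hdot (z w) w).
have gE w : g w = rnorm w ^+ 2 + Re (hdot (z w) w) by rewrite /g hdot_normE.
have g0 w : 0 <= g w.
  rewrite gE bE; have := qM w; have := sqr_ge0 (rnorm w); have := row_cM.
  have := row_cM1; have := row_cM2; have := row_ce; rewrite /a.
  move: (rnorm w ^+ 2) (q w) => u v ce m2 m1 E u0 vu.
  have : c * v <= c * M1 * u by rewrite -mulrA ler_pM2l.
  have := mulr_ge0 m2 u0.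
  have : (c * M1 + c * M2 + c * e) * u = u by rewrite E mul1r.
  by move: (c * v) (c * M1) (c * M2) (c * e) => x p r o *; nra.
(* As 1 - z is c times e plus the sum of the s(xi_i) adj(s(xi_i)), one has c q(v) <= ((1 - z) v, v);
   [sym_add] handles v = (1 + z) z^m w. *)
have telescope M w : c * (\sum_(m < M) q (iter m z w + z (iter m z w))) <=
    g w - g (iter M z w).
  elim: M => [|M IH]; first by rewrite big_ord0 mulr0 subrr.
  rewrite big_ord_recr /= mulrDr.
  have := @sym_add R K (fun x y => hdot x y) (@hdotP R K) (@hdotC R K) z lz sz (iter M z w).
  have := bE (iter M z w + z (iter M z w)); rewrite -rnorm_sqr -/(g _) -/(g _).
  have := mulr_ge0 (ltW row_ce) (sqr_ge0 (rnorm (iter M z w + z (iter M z w)))).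
  move: IH; rewrite /a.
  move: (c * \sum_(m < M) _) (q _) (rnorm _ ^+ 2) (g w) (g _) (g _) (Re _).
  by move=> *; nra.
have -> : \sum_i rnorm (adj (s (row_family (N := N) i)) k) ^+ 2 =
    q k + \sum_(m < N) q (iter m z k + z (iter m z k)).
  rewrite big_sumType /=; congr (_ + _).
  rewrite (eq_bigr (fun p : 'I_N * 'I_n =>
    rnorm (adj (s (xi p.2)) (iter p.1 z k + z (iter p.1 z k))) ^+ 2)); last first.
    by move=> [m i] _; rewrite adjE.
  by rewrite -(pair_bigA _ (fun (m : 'I_N) i =>
    rnorm (adj (s (xi i)) (iter m z k + z (iter m z k))) ^+ 2)).
(* The 2 in 2/c is the sum of c q(k) <= |k|^2 - (z k, k) and g(k) = |k|^2 + (z k, k). *)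
rewrite mulrAC ler_pdivlMr // mulrC mulrDr.
have := telescope N k; have := g0 (iter N z k); move: (g (iter N z k)) => gN.
rewrite (gE k) (bE k).
have := mulr_ge0 (ltW row_ce) (sqr_ge0 (rnorm k)); rewrite /a.
move: (c * \sum_(m < N) _) (rnorm k ^+ 2) (q k) => u v w.
lra.
Qed.

Variables (H : hilbertType R) (rho : A -> H -> H) (t : X -> H -> H).
Hypotheses (rep : representation phi rho t) (cc : completely_contractive phi t).

Let d (f g : 'I_n -> H) : R[i] := \sum_i hdot (f i) (g i).
Let P (f : 'I_n -> H) : 'I_n -> H := fun i => \sum_j rho (G i j) (f j).
Let Y (f : 'I_n -> H) : 'I_n -> H := aC *: f - cC *: P f.
Let T (f : 'I_n -> H) : H := \sum_j t (xi j) (f j).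

Let srep := representation_star_rep rep.
Let rlin b : linear (rho b). Proof. by case: (sr_bounded srep b). Qed.

Fact row_dP k f g v : d (k *: f + g) v = k * d f v + d g v.
Proof. by rewrite /d mulr_sumr -big_split /=; apply: eq_bigr => i _; rewrite hdotP. Qed.
Fact row_dC f g : d f g = (d g f)^*.
Proof. by rewrite /d rmorph_sum; apply: eq_bigr => i _; rewrite hdotC. Qed.
Fact row_dE f : Re (d f f) = \sum_i rnorm (f i) ^+ 2.
Proof. by rewrite /d cRe_sum; apply: eq_bigr => i _; rewrite rnorm_sqr. Qed.
Fact row_d0 f : 0 <= Re (d f f).
Proof. by rewrite row_dE sumr_ge0 // => i _; exact: sqr_ge0. Qed.
Fact row_lP k f g : P (k *: f + g) = k *: P f + P g.
Proof.
apply/funext => i; rewrite /P /= !fctE scaler_sumr -big_split /=.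
by apply: eq_bigr => j _; rewrite rlin.
Qed.
Fact row_sP f g : d (P f) g = d f (P g).
Proof.
rewrite /d /P.
transitivity (\sum_i \sum_j hdot (rho (G i j) (f j)) (g i)).
  by apply: eq_bigr => i _; rewrite hdot_suml.
rewrite exchange_big; apply: eq_bigr => j _; rewrite hdot_sumr; apply: eq_bigr => i _.
by rewrite (sr_star srep) minner_star.
Qed.
Fact row_P0 f : 0 <= Re (d (P f) f).
Proof.
have := gram_ge0 srep [seq (xi i, f i) | i <- enum 'I_n].
suff -> : gram rho [seq (xi i, f i) | i <- enum 'I_n] = d (P f) f by [].
rewrite /gram big_map big_enum /= /d /P.
transitivity (\sum_i \sum_j hdot (rho (G j i) (f i)) (f j)).
  by apply: eq_bigr => i _; rewrite big_map big_enum.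
rewrite exchange_big.
by apply: eq_bigr => i _; rewrite hdot_suml.
Qed.
Fact row_PM f : Re (d (P f) f) <= M2 * Re (d f f).
Proof.
have fle i : rnorm (f i) ^+ 2 <= Re (d f f).
  by rewrite row_dE (bigD1 i) //= lerDl sumr_ge0 // => j _; exact: sqr_ge0.
rewrite {1}/d cRe_sum /M2 mulr_suml ler_sum // => i _.
rewrite /P hdot_suml cRe_sum mulr_suml ler_sum // => j _.
rewrite (le_trans (Re_le_rnorm _)) // (le_trans (hdot_CS _ _)) //.
rewrite (le_trans (ler_wpM2r (rnorm_ge0 _) (sr_contractive srep _ _))) //.
rewrite -mulrA ler_wpM2l ?rnorm_ge0 //.
have := fle i; have := fle j; have := sqr_ge0 (rnorm (f i) - rnorm (f j)).
by move: (Re _) (rnorm (f i)) (rnorm (f j)) => *; nra.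
Qed.

Fact row_lY k f g : Y (k *: f + g) = k *: Y f + Y g.
Proof.
rewrite /Y row_lP !scalerDr !scalerN !scalerA opprD.
by rewrite [k * aC]mulrC [k * cC]mulrC addrACA.
Qed.
Fact row_sY f g : d (Y f) g = d f (Y g).
Proof.
rewrite /Y.
have dB u v w : d (u - v) w = d u w - d v w.
  by rewrite (sym_dD row_dP) (sym_dN row_dP).
have dBr u v w : d w (u - v) = d w u - d w v.
  by rewrite row_dC dB rmorphB /= -!row_dC.
have dZ k u v : d (k *: u) v = k * d u v.
  by rewrite /d mulr_sumr; apply: eq_bigr => i _; rewrite hdotZl.
have dZr k u v : d v (k *: u) = k^* * d v u by rewrite row_dC dZ rmorphM /= -row_dC.
by rewrite dB dBr !dZ !dZr !conjC_real row_sP.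
Qed.
Fact row_YE f : Re (d (Y f) f) = a * Re (d f f) - c * Re (d (P f) f).
Proof.
rewrite /Y (sym_dD row_dP) (sym_dN row_dP).
have dZ k u v : d (k *: u) v = k * d u v.
  by rewrite /d mulr_sumr; apply: eq_bigr => i _; rewrite hdotZl.
by rewrite !dZ !ReImE !mul0r !subr0.
Qed.
Fact row_Y0 f : 0 <= Re (d (Y f) f).
Proof.
rewrite row_YE; have := row_PM f; have := row_d0 f; have := row_cM; have := row_cM1.
have := row_c; rewrite /a; move: (Re (d f f)) (Re (d (P f) f)) => u v c0 m1 E u0 vu.
have : c * v <= c * M2 * u by rewrite -mulrA ler_pM2l // row_c.
have : (c * M1 + c * M2 + c * e) * u = u by rewrite E mul1r.
have := mulr_ge0 m1 u0.
by move: (c * v) (c * M1) (c * M2) (c * e) => x p r o *; nra.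
Qed.
Fact row_Yle f : Re (d (Y f) f) <= a * Re (d f f).
Proof. by rewrite row_YE gerBl mulr_ge0 ?row_P0 // ltW ?row_c. Qed.
Fact row_a0 : 0 <= a.
Proof. by rewrite /a; have := row_cM; have := row_cM1; have := row_cM2; lra. Qed.
Fact row_a1 : a < 1.
Proof. by rewrite /a; have := row_ce; lra. Qed.

(** By [t_right] the matrix Y passes from the row to the vector. *)
Lemma row_T_iter m f : \sum_j t (row_iter m j) (f j) = T (iter m Y f).
Proof.
have tl x := t_lin rep x.
elim: m f => // m IH f; rewrite iterSr -IH /row_iter iterS -/(row_iter m) /row_step.
have tN x h : t (- x) h = - t x h by rewrite -scaleN1r (t_scale rep) scaleN1r.
under eq_bigr do rewrite (t_add rep) tN !(t_scale rep) (t_sum rep).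
rewrite sumrB; under [RHS]eq_bigr do rewrite /Y !fctE (linB (tl _)) !(linZ (tl _)).
rewrite sumrB -!scaler_sumr; congr (_ - _ *: _).
rewrite exchange_big; apply: eq_bigr => i _ /=; rewrite /P (lin_sum (tl _)).
by apply: eq_bigr => j _; rewrite -(t_right rep).
Qed.

Lemma row_T_bounded : exists2 D : R, 0 <= D &
  forall f, rnorm (T f) <= D * Num.sqrt (Re (d f f)).
Proof.
have ex j : exists C : R, 0 <= C /\ forall h, rnorm (t (xi j) h) <= C * rnorm h.
  by have /bounded_opP[_ [C C0 bC]] := t_bounded rep (xi j); exists C.
pose C j := sval (cid (ex j)).
have CP j : 0 <= C j /\ forall h, rnorm (t (xi j) h) <= C j * rnorm h := svalP (cid (ex j)).
exists (\sum_j C j); first by rewrite sumr_ge0 // => j _; case: (CP j).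
move=> f; rewrite (le_trans (rnorm_sum _ _ _)) // mulr_suml ler_sum // => j _.
have [C0 /(_ (f j)) /le_trans -> //] := CP j; rewrite ler_wpM2l //.
rewrite -(@ler_pXn2r _ 2) ?nnegrE ?rnorm_ge0 ?sqrtr_ge0 // sqr_sqrtr ?row_d0 //.
by rewrite row_dE (bigD1 j) //= lerDl sumr_ge0 // => i _; exact: sqr_ge0.
Qed.

(** The series for (1 - Y)^-1, applied to (1 - Y) h, writes h as half of (1 - Y) h plus the sum of
    the ((1 + Y) Y^m)^2 (1 - Y) h. One factor (1 + Y) Y^m stays in [row_family]; the rest is
    here. *)
Definition row_vec N (h : 'I_n -> H) (i : 'I_n + 'I_N * 'I_n) : H :=
  match i with
  | inl i => (2^-1%:C)%C *: (h - Y h) i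
  | inr (m, i) => (2^-1%:C)%C *:
      ((iter m Y h + Y (iter m Y h)) - Y (iter m Y h + Y (iter m Y h))) i
  end.

(** The sum over m telescopes to at most |h|^2 - |Y h|^2. Added to |(1 - Y) h|^2 it gives 2 ((1 - Y)
    h, h), where 1 - Y = c (P + e), and the two halves contribute the factor 1/4. *)
Lemma row_vec_norm N h :
  \sum_i rnorm (row_vec (N := N) h i) ^+ 2 <=
  c / 2 * (Re (d (P h) h) + e * Re (d h h)).
Proof.
have nh : rnorm ((2^-1%:C)%C : R[i]) = 2^-1 by rewrite rnorm_real ger0_norm ?invr_ge0.
rewrite big_sumType /=.
under eq_bigr do rewrite rnormZ nh exprMn.
rewrite (eq_bigr (fun p : 'I_N * 'I_n => (2^-1) ^+ 2 * rnorm (((iter p.1 Y h +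
    Y (iter p.1 Y h)) - Y (iter p.1 Y h + Y (iter p.1 Y h))) p.2) ^+ 2)); last first.
  by move=> [m i] _; rewrite rnormZ nh exprMn.
rewrite -(pair_bigA _ (fun (m : 'I_N) i => (2^-1) ^+ 2 * rnorm (((iter m Y h +
    Y (iter m Y h)) - Y (iter m Y h + Y (iter m Y h))) i) ^+ 2)) /=.
under [X in _ + X]eq_bigr do rewrite -mulr_sumr -row_dE.
rewrite -!mulr_sumr -row_dE -mulrDr.
pose F f := Re (d f f) - Re (d (Y f) (Y f)).
have F0 f : 0 <= F f.
  rewrite subr_ge0; have := sym_norm_le row_dP row_dC row_d0 row_lY row_sY row_Y0 row_Yle f.
  move=> /le_trans -> //; rewrite ler_piMl ?row_d0 // expr_le1 ?row_a0 //.
  exact: ltW row_a1.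
have -> : \sum_(m < N) Re (d ((iter m Y h + Y (iter m Y h)) -
      Y (iter m Y h + Y (iter m Y h))) ((iter m Y h + Y (iter m Y h)) -
      Y (iter m Y h + Y (iter m Y h)))) = F h - F (iter N Y h).
  elim: N => [|N IH]; first by rewrite big_ord0 subrr.
  rewrite big_ord_recr IH /= (sqnorm_sub2 row_dP row_dC row_lY row_sY).
  by rewrite -/(F _) -/(F _) subrKA.
rewrite (sqnorm_sub row_dP row_dC).
have := F0 (iter N Y h); have := row_YE h; rewrite {2}/F /a.
move: (F _) (Re (d h h)) (Re (d (P h) h)) (Re _) (Re _) => *; nra.
Qed.

(** The m-th block is S m - S m.+1, where S m is T applied to (1 + Y) Y^(2m) h / 2, and the first
    block together with S 0 gives T h. *)
Lemma row_vec_T N h :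
  \sum_i t (row_family (N := N) i) (row_vec (N := N) h i) =
  T h - T ((2^-1%:C)%C *: (iter N Y (iter N Y h) + Y (iter N Y (iter N Y h)))).
Proof.
set half := (2^-1%:C)%C.
have tl x := t_lin rep x.
have lT k f g : T (k *: f + g) = k *: T f + T g.
  rewrite /T scaler_sumr -big_split /=; apply: eq_bigr => j _.
  by rewrite !fctE tl.
have TD f g : T (f + g) = T f + T g by have := lT 1 f g; rewrite !scale1r.
have T0 : T 0 = 0 by have := lT (-1) 0 0; rewrite scaler0 addr0 scaleN1r addNr.
have TB f g : T (f - g) = T f - T g.
  by have := lT (-1) g f; rewrite !scaleN1r ![- _ + _]addrC.
have YD := symD row_lY; have YN := symN row_lY.
have Y0 : Y 0 = 0 by have := row_lY (-1) 0 0; rewrite scaler0 addr0 scaleN1r addNr.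
have YZ k f : Y (k *: f) = k *: Y f.
  by have := row_lY k f 0; rewrite Y0 !addr0.
have itL m k f g : iter m Y (k *: f + g) = k *: iter m Y f + iter m Y g.
  exact: iter_linear row_lY _ _ _.
have itD m f g : iter m Y (f + g) = iter m Y f + iter m Y g.
  by have := itL m 1 f g; rewrite !scale1r.
have itB m f g : iter m Y (f - g) = iter m Y f - iter m Y g.
  by have := itL m (-1) g f; rewrite !scaleN1r ![- _ + _]addrC.
have it0 m : iter m Y 0 = 0.
  by have := itL m (-1) 0 0; rewrite scaler0 addr0 scaleN1r addNr.
have itZ m k f : iter m Y (k *: f) = k *: iter m Y f.
  by have := itL m k f 0; rewrite it0 !addr0.
have itY m f : iter m Y (Y f) = Y (iter m Y f) by rewrite -iterSr.
pose b m := iter m Y (iter m Y h).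
pose S m := T (half *: (b m + Y (b m))).
rewrite big_sumType /=.
have -> : \sum_i t (xi i) (half *: (h - Y h) i) = T (half *: (h - Y h)) by [].
pose w m : 'I_n -> H := half *: ((iter m Y h + Y (iter m Y h)) -
  Y (iter m Y h + Y (iter m Y h))).
rewrite (eq_bigr (fun p : 'I_N * 'I_n =>
   t (row_iter p.1 p.2 + row_iter p.1.+1 p.2) (w p.1 p.2))); last by move=> [].
rewrite -(pair_bigA _ (fun (m : 'I_N) i =>
   t (row_iter m i + row_iter m.+1 i) (w m i))) /=.
have inner m : \sum_i t (row_iter m i + row_iter m.+1 i) (w m i) = S m - S m.+1.
  under eq_bigr do rewrite (t_add rep).
  rewrite big_split !row_T_iter /= -TD -TB; congr (T _).
  rewrite -itY -itD -scalerBr /w YZ -scalerDr itZ; congr (_ *: _).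
  have bS : b m.+1 = Y (Y (b m)) by rewrite /b [iter m.+1 Y h]iterS iterS itY.
  have uu (u : 'I_n -> H) : u - Y u + Y (u - Y u) = u - Y (Y u).
    by rewrite YD YN addrA subrK.
  rewrite uu itB !itY itD itY bS -/(b m).
  by move: (b m) => x; congr (_ - _); rewrite -YD; congr (Y _); rewrite YD.
have -> : \sum_(m < N) \sum_i t (row_iter m i + row_iter m.+1 i) (w m i) =
    S 0 - S N.
  elim: N => [|N IH]; first by rewrite big_ord0 subrr.
  by rewrite big_ord_recr IH /= inner subrKA.
rewrite addrA; congr (_ - _); rewrite /S -TD -scalerDr /b /=.
rewrite addrACA addNr addr0 -mulr2n -scaler_nat scalerA.
have -> : half * 2%:R = 1 by rewrite /half; apply: eq_ReIm; rewrite !ReImE /=; field.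
by rewrite scale1r.
Qed.

Lemma row_contractive_fin h : rnorm (T h) ^+ 2 <= Re (d (P h) h) + e * Re (d h h).
Proof.
have [D D0 TD] := row_T_bounded.
set Q := Re (d (P h) h) + e * Re (d h h).
have Q0 : 0 <= Q by rewrite addr_ge0 ?row_P0 ?mulr_ge0 ?row_d0 // ltW.
have tl x := t_lin rep x.
have TB f g : T (f - g) = T f - T g.
  by rewrite /T -sumrB; apply: eq_bigr => j _; rewrite !fctE (linB (tl _)).
rewrite -(sqr_sqrtr Q0) ler_pXn2r ?nnegrE ?rnorm_ge0 ?sqrtr_ge0 //.
set q := Num.sqrt (Re (d h h)).
have q0 : 0 <= q by exact: sqrtr_ge0.
have H1 N : rnorm (T h) <= Num.sqrt Q + D * (a ^+ N * q).
  set g := (2^-1%:C)%C *: (iter N Y (iter N Y h) + Y (iter N Y (iter N Y h))).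
  have c2 : 0 < 2 / c by rewrite divr_gt0 // row_c.
  have := @cc_row R A X phi H rho t _ (row_family (N := N)) (2 / c) rep cc c2
    (fun K sigma s iso k => @row_iso_bound K sigma s N k iso) (row_vec (N := N) h).
  rewrite row_vec_T -/g => le1.
  have le2 : rnorm (T h - T g) ^+ 2 <= Q.
    apply: le_trans le1 _.
    apply: le_trans (ler_wpM2l (ltW c2) (row_vec_norm N h)) _.
    have k1 k : k != 0 -> 2 / k * (k / 2) = 1 :> R by move=> k0; field.
    by rewrite mulrA k1 ?mul1r // gt_eqF // row_c.
  have le3 : rnorm (T h - T g) <= Num.sqrt Q.
    by rewrite -(@ler_pXn2r _ 2) ?nnegrE ?rnorm_ge0 ?sqrtr_ge0 // sqr_sqrtr.
  rewrite -[T h](subrK (T g)) (le_trans (rnormD _ _)) // lerD // (le_trans (TD _)) //.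
  (* The remainder: (1 + Y)/2 is a contraction, and of the two factors Y^N one is bounded by a^N and
     the other by 1. *)
  rewrite ler_wpM2l // -(@ler_pXn2r _ 2) ?nnegrE ?sqrtr_ge0 ?mulr_ge0 ?exprn_ge0 ?row_a0 //.
  rewrite exprMn !sqr_sqrtr ?row_d0 // /g.
  set b := iter N Y (iter N Y h).
  have nle := sym_norm_le row_dP row_dC row_d0 row_lY row_sY row_Y0 row_Yle.
  have itle := sym_iter_le row_dP row_dC row_d0 row_lY row_sY row_Y0 row_Yle.
  have a21 : a ^+ 2 <= 1 by rewrite expr_le1 ?row_a0 // ltW // row_a1.
  have ble : Re (d b b) <= a ^+ N ^+ 2 * Re (d h h).
    rewrite /b (le_trans (itle N _)) // exprAC ler_wpM2l ?sqr_ge0 //.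
    rewrite (le_trans (itle N _)) // ler_piMl ?row_d0 // exprn_ile1 ?sqr_ge0 //.
  have -> : Re (d ((2^-1%:C)%C *: (b + Y b)) ((2^-1%:C)%C *: (b + Y b))) =
      4^-1 * Re (d (b + Y b) (b + Y b)).
    rewrite !row_dE mulr_sumr; apply: eq_bigr => i _.
    rewrite rnormZ exprMn rnorm_real ger0_norm ?invr_ge0 //; congr (_ * _).
    by field.
  apply: le_trans ble; rewrite (sqnorm_add row_dP row_dC).
  have := nle b; have := row_Yle b; have := row_d0 b; have := row_a0; have := row_a1.
  move: a21; move: (Re (d b b)) (Re (d (Y b) b)) (Re (d (Y b) (Y b))).
  move=> u v w a21 a1 a0 u0 v0 w0.
  have : a ^+ 2 * u <= 1 * u by rewrite ler_wpM2r.
  have : a * u <= 1 * u by rewrite ler_wpM2r // ltW.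
  move: (a ^+ 2 * u) (a * u) v0 w0 => x y; lra.
apply/ler_addgt0Pr => r r0.
have Dq : 0 < D * q + 1 by rewrite ltr_wpDl // mulr_ge0.
have [|N aN] := @expr_small R a (r / (D * q + 1)) row_a0 row_a1.
  by rewrite divr_gt0.
apply: le_trans (H1 N) _; rewrite lerD2l.
move: aN; rewrite ltr_pdivlMr //.
have := exprn_ge0 N row_a0; move: (a ^+ N) => x x0.
have -> : D * (x * q) = x * (D * q) by ring.
by move: (D * q) => y; nra.
Qed.

End RowContraction.

Lemma row_contractive (R : realType) (A : cstarType R) (X : hilbertModType A)
    (phi : correspondence X) (H : hilbertType R) (rho : A -> H -> H) (t : X -> H -> H)
    (s : seq (X * H)) :
  representation phi rho t -> completely_contractive phi t ->
  rnorm (\sum_(p <- s) t p.1 p.2) ^+ 2 <= Re (gram rho s).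
Proof.
move=> rep cc; apply/ler_addgt0Pr => e e0.
pose xi i := (tnth (in_tuple s) i).1; pose h i := (tnth (in_tuple s) i).2.
pose D := Re (\sum_i hdot (h i) (h i)).
have D0 : 0 <= D by rewrite /D cRe_sum sumr_ge0 // => i _; exact: Re_hdot_ge0.
have D1 : 0 < D + 1 by rewrite ltr_wpDl.
have e1 : 0 < e / (D + 1) by rewrite divr_gt0.
have := @row_contractive_fin R A X phi (size s) xi _ e1 H rho t rep cc h.
have -> : \sum_(p <- s) t p.1 p.2 = \sum_j t (xi j) (h j) by rewrite big_tnth.
have -> : gram rho s = \sum_i hdot (\sum_j rho (minner (xi i) (xi j)) (h j)) (h i).
  transitivity (\sum_i \sum_j hdot (rho (minner (xi j) (xi i)) (h i)) (h j)).
    by rewrite /gram big_tnth; apply: eq_bigr => i _; rewrite big_tnth.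
  by rewrite exchange_big; apply: eq_bigr => i _; rewrite hdot_suml.
rewrite -/D => le1; apply: (le_trans le1); rewrite lerD2l.
by rewrite mulrAC ler_pdivrMr // ler_wpM2l ?(ltW e0) //; lra.
Qed.

(** * The inner product on words *)

Section Words.
Variables (R : realType) (A : cstarType R) (X : hilbertModType A).
Variables (phi : correspondence X) (H : hilbertType R).
Variables (rho : A -> H -> H) (t : X -> H -> H).

(* The pair ([:: x_1; ...; x_n], h) stands for the vector t_1(x_1)...t_1(x_n) h
   of an isometric coextension t_1 of t. *)
Definition word := (seq X * H)%type.
Implicit Types (w v : word) (a b : A) (k : R[i]).

Definition word_act a w : word :=
  if w.1 is x :: s then (phi a x :: s, w.2) else ([::], rho a w.2).
Definition word_scale k w : word := (w.1, k *: w.2).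
Definition word_cons x w : word := (x :: w.1, w.2).
(** The compression to H of the vector that w stands for, since H is coinvariant. *)
Definition word_eval w : H := foldr t w.2 w.1.

(* [kern N w v] is the inner product of the vectors represented by w and v if N
   is at least the length of w or of v; the truncation at N makes an induction
   possible. *)
Fixpoint kern N w v : R[i] :=
  match N, w, v with
  | N'.+1, (x :: s, h), (y :: r, k) => kern N' (word_act (minner y x) (s, h)) (r, k)
  | _, _, _ => hdot (word_eval w) (word_eval v)
  end.

Hypothesis rep : representation phi rho t.
Let srep := representation_star_rep rep.
Let tl x : linear (t x). Proof. exact: t_lin rep x. Qed.
Let rl a : linear (rho a). Proof. by case: (sr_bounded srep a). Qed.

Lemma kern_cons N x y w v :
  kern N.+1 (word_cons x w) (word_cons y v) = kern N (word_act (minner y x) w) v.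
Proof. by case: w v => [s h] [r k]. Qed.

Lemma kern_nill N h v : kern N ([::], h) v = hdot h (word_eval v).
Proof. by case: N v => [|N] [[|y r] k]. Qed.

Lemma kern_nilr N w (h : H) : kern N w ([::], h) = hdot (word_eval w) h.
Proof. by case: N w => [|N] [[|x s] g]. Qed.

Lemma word_eval_act a w : word_eval (word_act a w) = rho a (word_eval w).
Proof.
by case: w => [[|x s] h] //; rewrite /word_eval /word_act /= (t_left rep).
Qed.

Lemma word_eval_scale k w : word_eval (word_scale k w) = k *: word_eval w.
Proof.
case: w => s h; rewrite /word_eval /word_scale /=.
by elim: s => //= x s ->; rewrite (linZ (tl _)).
Qed.

Lemma word_act_scale a k w : word_act a (word_scale k w) = word_scale k (word_act a w).
Proof. by case: w => [[|x s] h]; rewrite /word_act /word_scale //= (linZ (rl _)). Qed.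

Lemma word_act_mul a b w : word_act (cmul a b) w = word_act a (word_act b w).
Proof.
by case: w => [[|x s] h]; rewrite /word_act /= ?(sr_mul srep) // corr_mul.
Qed.

Lemma word_act_size a w : size (word_act a w).1 = size w.1.
Proof. by case: w => [[|x s] h]. Qed.

Lemma kern_scale N k w v : kern N (word_scale k w) v = k * kern N w v.
Proof.
elim: N w v => [|N IH] [[|x s] h] [[|y r] g];
  rewrite /= -?[(_, k *: h)]/(word_scale k (_, h)) ?word_act_scale ?IH //;
  by rewrite word_eval_scale hdotZl.
Qed.

(** Linearity in the algebra element descends one letter at a time: phi(a) changes the first letter
    x, and <y, phi(a) x>, which acts on the tail, is again linear in a. *)
Lemma kern_act_linear N k a b w v :
  kern N (word_act (k *: a + b) w) v =
  k * kern N (word_act a w) v + kern N (word_act b w) v.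
Proof.
have E a' b' u : word_eval (word_act (k *: a' + b') u) =
    k *: word_eval (word_act a' u) + word_eval (word_act b' u).
  by rewrite !word_eval_act (sr_linear srep).
elim: N a b w v => [|N IH] a b w v; first by rewrite /= E hdotP.
case: w v => [[|x s] h] [[|y r] g].
- by rewrite /word_act /= /word_eval /= (sr_linear srep) hdotP.
- by rewrite /word_act /= /word_eval /= (sr_linear srep) hdotP.
- by rewrite !kern_nilr E hdotP.
by rewrite /= corr_linear minnerDr minnerZr IH.
Qed.

Lemma kern_cons_linear N k x x' s h v :
  kern N (k *: x + x' :: s, h) v = k * kern N (x :: s, h) v + kern N (x' :: s, h) v.
Proof.
have E : word_eval (k *: x + x' :: s, h) =
    k *: word_eval (x :: s, h) + word_eval (x' :: s, h).
  by rewrite /word_eval /= (t_linear rep).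
case: N v => [|N] [[|y r] g]; rewrite /= ?E ?hdotP //.
by rewrite minnerDr minnerZr kern_act_linear.
Qed.

Lemma kern_adj N a w v : kern N (word_act a w) v = kern N w (word_act (cstar a) v).
Proof.
have E u u' : hdot (word_eval (word_act a u)) (word_eval u') =
    hdot (word_eval u) (word_eval (word_act (cstar a) u')).
  by rewrite !word_eval_act (sr_star srep).
case: N w v => [|N] [[|x s] h] [[|y r] g] //=.
by rewrite corr_star cstarK.
Qed.

Lemma kern_herm N w v : kern N w v = (kern N v w)^*.
Proof.
elim: N w v => [|N IH] [[|x s] h] [[|y r] g] /=; rewrite ?[LHS]hdotC //.
by rewrite IH kern_adj minner_star.
Qed.

Lemma kern_stable N M w v : (size w.1 <= N)%N -> (size w.1 <= M)%N ->
  kern N w v = kern M w v.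
Proof.
elim: N M w v => [|N IH] [|M] [[|x s] h] [[|y r] g] //= sN sM.
by apply: IH; rewrite word_act_size.
Qed.

Definition word_dot w v := kern (size w.1) w v.

Lemma word_dotE N w v : (size w.1 <= N)%N -> word_dot w v = kern N w v.
Proof. by move=> sN; apply: kern_stable. Qed.

Hypothesis cc : completely_contractive phi t.

(** The part of the form orthogonal to H; it vanishes for N = 0, which starts the induction. *)
Let defect N w v := kern N w v - hdot (word_eval w) (word_eval v).
Let sumdot (F : word -> word -> R[i]) (x y : seq word) :=
  \sum_(w <- x) \sum_(v <- y) F w v.
Definition word_comb k (x y : seq word) := map (word_scale k) x ++ y.

Fact sumdotP (F : word -> word -> R[i]) :
  (forall k w v, F (word_scale k w) v = k * F w v) ->
  forall k x y z, sumdot F (word_comb k x y) z = k * sumdot F x z + sumdot F y z.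
Proof.
move=> FZ k x y z; rewrite /sumdot big_cat big_map mulr_sumr; congr (_ + _).
by apply: eq_bigr => w _; rewrite mulr_sumr; apply: eq_bigr => v _.
Qed.

Fact sumdotC (F : word -> word -> R[i]) : (forall w v, F w v = (F v w)^*) ->
  forall x y, sumdot F x y = (sumdot F y x)^*.
Proof.
move=> FC x y; rewrite /sumdot exchange_big rmorph_sum; apply: eq_bigr => v _.
by rewrite rmorph_sum; apply: eq_bigr => w _.
Qed.

Fact defect_ge0 N x : 0 <= Re (sumdot (defect N) x x).
Proof.
elim: N x => [|N IH] z.
  by rewrite /sumdot big1 // => w _; rewrite big1 // => v _; rewrite /defect /= subrr.
have dZ k w v : defect N (word_scale k w) v = k * defect N w v.
  by rewrite /defect kern_scale word_eval_scale hdotZl mulrBr.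
have dC w v : defect N w v = (defect N v w)^*.
  by rewrite /defect rmorphB /= -kern_herm -hdotC.
(* The induction hypothesis makes the defect at N a pre-Hilbert form, on which A acts. *)
pose E := @PreHilbert R (seq word) (sumdot (defect N)) word_comb [::]
  (sumdotP dZ) (sumdotC dC) IH.
have rE : @pre_star_rep R A E (fun a => map (word_act a)).
  split=> /= [a x y|k a b x y|a b x y]; rewrite /sumdot.
  - rewrite big_map; apply: eq_bigr => w _; rewrite big_map; apply: eq_bigr => v _.
    by rewrite /defect kern_adj !word_eval_act (sr_star srep).
  - rewrite !big_map mulr_sumr -big_split; apply: eq_bigr => w _ /=.
    rewrite mulr_sumr -big_split; apply: eq_bigr => v _ /=.
    rewrite /defect kern_act_linear !word_eval_act (sr_linear srep) hdotP; ring.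
  - rewrite -map_comp; congr (\sum_(w <- _) _); apply: eq_map => w /=.
    exact: word_act_mul.
(* Splits off the first letter. Words without letters lie in H, so their defect is zero and they
   drop out. *)
pose un (w : word) := if w.1 is x :: s
  then Some (x, (s, w.2)) else None : option (X * word).
have sum_un (F : word -> R[i]) (y : seq word) : (forall h, F ([::], h) = 0) ->
    \sum_(w <- y) F w = \sum_(p <- pmap un y) F (word_cons p.1 p.2).
  move=> F0; elim: y => [|[[|x s] h] y IHy]; rewrite ?big_nil //= !big_cons.
    by rewrite F0 add0r.
  by rewrite IHy.
have dl h v : defect N.+1 ([::], h) v = 0 by rewrite /defect kern_nill subrr.
have dr h w : defect N.+1 w ([::], h) = 0 by rewrite /defect kern_nilr subrr.
rewrite /sumdot sum_un; last by move=> h; rewrite big1.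
set p := pmap un z.
(* The first summand is nonnegative by Gram positivity over E; the second is the gap in the row
   inequality for the vectors [word_eval]. *)
have -> : \sum_(i <- p) \sum_(v <- z) defect N.+1 (word_cons i.1 i.2) v =
  (\sum_(i <- p) \sum_(j <- p) defect N (word_act (minner j.1 i.1) i.2) j.2) +
  (gram rho [seq (i.1, word_eval i.2) | i <- p] -
   hdot (\sum_(i <- p) t i.1 (word_eval i.2)) (\sum_(i <- p) t i.1 (word_eval i.2))).
  rewrite /gram big_map hdot_suml -sumrB -big_split; apply: eq_bigr => i _ /=.
  rewrite sum_un; last by move=> h; exact: dr.
  rewrite big_map hdot_sumr -sumrB -big_split; apply: eq_bigr => j _ /=.
  by rewrite /defect kern_cons word_eval_act /=; ring.
rewrite cRe_add addr_ge0 //.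
  have := @pre_gram_ge0 R A X E _ [seq (i.1, [:: i.2] : E) | i <- p] rE.
  rewrite big_map /=; under eq_bigr do rewrite big_map.
  rewrite /sumdot /=; under eq_bigr do under eq_bigr do rewrite !big_seq1.
  by [].
rewrite cRe_add cRe_opp subr_ge0 -rnorm_sqr.
have := row_contractive [seq (i.1, word_eval i.2) | i <- p] rep cc.
by rewrite big_map.
Qed.

Fact word_dot_ge0 x : 0 <= Re (sumdot word_dot x x).
Proof.
pose N := \max_(w <- x) size w.1.
have -> : sumdot word_dot x x = sumdot (defect N) x x +
    hdot (\sum_(w <- x) word_eval w) (\sum_(w <- x) word_eval w).
  rewrite /sumdot hdot_suml -big_split; apply: eq_big_seq => w wx /=.
  rewrite hdot_sumr -big_split; apply: eq_bigr => v _ /=.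
  rewrite /defect subrK; apply: word_dotE.
  exact: (@leq_bigmax_seq _ x xpredT (fun w : word => size w.1) w wx isT).
by rewrite cRe_add addr_ge0 ?defect_ge0 ?Re_hdot_ge0.
Qed.

Fact word_dot_scale k w v : word_dot (word_scale k w) v = k * word_dot w v.
Proof. exact: kern_scale. Qed.

Lemma word_dotC w v : word_dot w v = (word_dot v w)^*.
Proof.
rewrite (word_dotE v (leq_maxl (size w.1) (size v.1))).
by rewrite (word_dotE w (leq_maxr (size w.1) (size v.1))) kern_herm.
Qed.

Definition word_space : prehilbert R :=
  @PreHilbert R (seq word) (sumdot word_dot) word_comb [::]
    (sumdotP word_dot_scale) (sumdotC word_dotC) word_dot_ge0.

Lemma word_spaceE (x y : word_space) :
  ph_dot x y = \sum_(w <- (x : seq word)) \sum_(v <- (y : seq word)) word_dot w v.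
Proof. by []. Qed.

Lemma word_dot_nill h v : word_dot ([::], h) v = hdot h (word_eval v).
Proof. exact: kern_nill. Qed.

Lemma word_dot_nilr w (h : H) : word_dot w ([::], h) = hdot (word_eval w) h.
Proof. exact: kern_nilr. Qed.

Lemma word_dot_cons x y w v :
  word_dot (word_cons x w) (word_cons y v) = word_dot (word_act (minner y x) w) v.
Proof. by rewrite /word_dot kern_cons word_act_size. Qed.

Lemma word_dot_adj a w v : word_dot (word_act a w) v = word_dot w (word_act (cstar a) v).
Proof. by rewrite /word_dot kern_adj word_act_size. Qed.

Lemma word_space_rep : @pre_star_rep R A word_space (fun a => map (word_act a)).
Proof.
split=> /= [a x y|k a b x y|a b x y]; rewrite /sumdot.
- rewrite big_map; apply: eq_bigr => w _; rewrite big_map; apply: eq_bigr => v _.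
  exact: word_dot_adj.
- rewrite !big_map mulr_sumr -big_split; apply: eq_bigr => w _ /=.
  rewrite mulr_sumr -big_split; apply: eq_bigr => v _ /=.
  by rewrite /word_dot !word_act_size kern_act_linear.
- rewrite -map_comp; congr (\sum_(w <- _) _); apply: eq_map => w /=.
  exact: word_act_mul.
Qed.

End Words.

(** * Existence *)

Lemma adj_bounded (R : realType) (H K : hilbertType R) (T : H -> K) :
  bounded_op T -> bounded_op (adj T).
Proof.
move=> bT; have /bounded_opP[_ [C C0 TC]] := bT; apply/bounded_opP.
by split; [exact: adj_linear|exists C => //; exact: adj_le].
Qed.

(** Polarization: c = 1 recovers the real part and c = -i the imaginary part. *)
Lemma isometry_hdot (R : realType) (H K : hilbertType R) (V : H -> K) :
  isometry_op V -> forall h k, hdot (V h) (V k) = hdot h k.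
Proof.
move=> [lV nV] h k.
have key c : Re (c * hdot (V h) (V k)) = Re (c * hdot h k).
  have := rnorm_sqrP c (V h) (V k); rewrite -lV {1 2 3}/rnorm !nV -!/(rnorm _).
  by rewrite rnorm_sqrP; lra.
apply: eq_ReIm; first by have := key 1; rewrite !mul1r.
by have := key (Complex 0 (-1)); rewrite !ReImE /= !mul0r !sub0r !mulN1r !opprK.
Qed.

Lemma isometry_bounded (R : realType) (H K : hilbertType R) (V : H -> K) :
  isometry_op V -> bounded_op V.
Proof.
move=> [lV nV]; apply/bounded_opP; split=> //; exists 1 => // x.
by rewrite mul1r /rnorm nV.
Qed.

Lemma dense_hdot_inj (R : realType) (E : Type) (H : hilbertType R) (J : E -> H) h k :
  dense_map J -> (forall x, hdot (J x) h = hdot (J x) k) -> h = k.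
Proof.
move=> dJ hk; apply/subr0_eq; apply: (dense_hdot0 dJ) => x.
by rewrite hdotBr hk subrr.
Qed.

Lemma total_range_zero (R : realType) (V : normedModType R[i]) (I : Type)
    (f : I -> V -> V) (g : V -> R[i]) (C : R) :
  total_range f -> (forall x y, g (x + y) = g x + g y) ->
  (forall x y, rnorm (g x - g y) <= C * rnorm (x - y)) ->
  (forall i v, g (f i v) = 0) -> forall v, g v = 0.
Proof.
move=> tf gD gC gf v.
have g0 : g 0 = 0 by apply: (addrI (g 0)); rewrite -gD !addr0.
have clv : closure [set w | exists (n : nat) (i : 'I_n -> I) (v : 'I_n -> V),
    w = \sum_(j < n) f (i j) (v j)] v by rewrite tf.
apply: (@rnorm_small _ R[i]^o) => e e0; rewrite subr0.
have C0 : 0 < `|C| + 1 by rewrite ltr_wpDl.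
have d0 : 0 < e / (`|C| + 1) by rewrite divr_gt0.
have [_ [n [i [w ->]]] vw] := proj1 (closureP _ _) clv _ d0.
have gs : g (\sum_(j < n) f (i j) (w j)) = 0.
  by rewrite (big_morph g gD g0) big1.
rewrite -[g v]subr0 -gs (le_lt_trans (gC _ _)) //.
rewrite ltr_pdivlMr // in vw; apply: le_lt_trans vw.
rewrite mulrC ler_wpM2l ?rnorm_ge0 //.
by have := ler_norm C; lra.
Qed.

Lemma total_rangeP (R : realType) (H : hilbertType R) (I : Type) (f : I -> H -> H) :
  (forall i, linear (f i)) ->
  (forall r, (forall i v, hdot (f i v) r = 0) -> r = 0) -> total_range f.
Proof.
move=> lf Hr; rewrite /total_range; set S := [set w | _].
have Sp i v : S (f i v).
  by exists 1%N, (fun=> i), (fun=> v); rewrite big_ord1.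
have cM : closed_subspace (closure S).
  apply: closed_subspace_closure.
    have i0 : 'I_0 -> I by case.
    by exists 0%N, i0, (fun=> 0); rewrite big_ord0.
  move=> k h h' [n [i [v ->]]] [m [j [w ->]]].
  (* The two sums are concatenated, and linearity of each f i absorbs k into the vectors. *)
  exists (n + m)%N, (fun l => match fintype.split l with inl a => i a | inr b => j b end),
    (fun l => match fintype.split l with inl a => k *: v a | inr b => w b end).
  rewrite big_split_ord scaler_sumr; congr (_ + _); apply: eq_bigr => l _.
    by rewrite (unsplitK (inl l)) (linZ (lf _)).
  by rewrite (unsplitK (inr l)).
apply/seteqP; split=> // h _.
have [p Mp pO] := closed_projection h cM.
suff -> : h = p by [].
by apply/subr0_eq/Hr => i v; rewrite hdotC pO ?conjC0 //; apply: subset_closure.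
Qed.

Section Coextension.
Variables (R : realType) (A : cstarType R) (X : hilbertModType A).
Variables (phi : correspondence X) (phi_nd : nondegenerate_correspondence phi).
Variables (G : topologicalGroupType) (alpha : gauge_action phi G).
Variable pi : covariant_rep alpha.

Let H := rep_space pi.
Let rho := @rep_rho _ _ _ _ _ _ pi.
Let t := @rep_t _ _ _ _ _ _ pi.
Let u := @rep_u _ _ _ _ _ _ pi.
Let rep : representation phi rho t := rep_representation pi.
Let cc : completely_contractive phi t := @rep_cc _ _ _ _ _ _ pi.
Let rep_uu : unitary_representation u := rep_unitary pi.

Local Notation wordH := (word X H).
Local Notation act := (word_act phi rho).
Local Notation dotw := (word_dot phi rho t).
Implicit Types (w v : wordH) (s : G).

Definition word_u s w : wordH := (map (actX alpha s) w.1, u s w.2).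

Lemma word_eval_u s w : word_eval t (word_u s w) = u s (word_eval t w).
Proof.
case: w => x h; rewrite /word_eval /word_u /=.
by elim: x => //= x l ->; rewrite /u rep_cov_t.
Qed.

Lemma word_u_act s a w : word_u s (act a w) = act (actC alpha s a) (word_u s w).
Proof.
by case: w => [[|x l] h]; rewrite /word_u /word_act /= ?act_left // /u rep_cov_rho.
Qed.

(** By [act_inner] the coefficient of the moved letters is the moved coefficient, and [word_u_act]
    passes it on to the tails. *)
Lemma word_dot_u s w v : dotw (word_u s w) (word_u s v) = dotw w v.
Proof.
rewrite /word_dot size_map; move: (size w.1) => N.
have iso : isometry_op (u s) by case: (u_unitary rep_uu s).
elim: N w v => [|N IH] [[|x l] h] [[|y r] g] /=;
  rewrite -?[([::], u s _)]/(word_u s ([::], _))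
  -?[(_ :: map _ _, u s _)]/(word_u s (_ :: _, _)) ?word_eval_u ?(isometry_hdot iso) //.
by rewrite -act_inner -[(map _ l, _)]/(word_u s (l, h)) -word_u_act
  -[(map _ r, _)]/(word_u s (r, g)) IH.
Qed.

Lemma word_u_scale s k w : word_u s (word_scale k w) = word_scale k (word_u s w).
Proof.
by case: w => l h; rewrite /word_u /word_scale /= (linZ (u_unitary rep_uu s).1.1).
Qed.

Lemma word_u_mul r s w : word_u (r * s)%g w = word_u r (word_u s w).
Proof.
rewrite /word_u /= (u_mul rep_uu) -map_comp; congr (_, _).
by apply: eq_map => x; exact: actX_mul.
Qed.

(** Multiplicativity makes the maps at 1 idempotent, and an injective idempotent map is the
    identity. *)
Lemma word_u1 w : word_u 1%g w = w.
Proof.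
have a1 x : actX alpha 1%g x = x.
  by apply: (bij_inj (actX_bij alpha 1%g)); rewrite -actX_mul mulg1.
have u1 h : u 1%g h = h.
  have iso : isometry_op (u 1%g) by case: (u_unitary rep_uu 1%g).
  apply: hdot_inj => k.
  by rewrite -(isometry_hdot iso) -(u_mul rep_uu) mulg1 (isometry_hdot iso).
by case: w => l h; rewrite /word_u u1 (eq_map a1) map_id.
Qed.

Let W := word_space rep cc.
Let K := (completion W : hilbertType R).
Let J (x : seq wordH) : K := @compl_embed R W x.

Fact J_dense : dense_map J. Proof. exact: compl_embed_dense. Qed.
Fact hdotJ x y : hdot (J x) (J y) = \sum_(w <- x) \sum_(v <- y) dotw w v.
Proof. by rewrite /J compl_hdot. Qed.
Fact J_comb c x y : J (word_comb c x y) = c *: J x + J y.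
Proof. exact: (@compl_embed_comb R W). Qed.
Fact J_map (f g : wordH -> wordH) x : (forall w v, dotw (f w) v = dotw (g w) v) ->
  J (map f x) = J (map g x).
Proof.
move=> fg; apply: (@compl_embed_eq R W) => y; rewrite !word_spaceE !big_map.
by apply: eq_bigr => w _; apply: eq_bigr => v _; exact: fg.
Qed.
Fact map_word_comb (f : wordH -> wordH) c x y :
  (forall k w, f (word_scale k w) = word_scale k (f w)) ->
  map f (word_comb c x y) = word_comb c (map f x) (map f y).
Proof.
by move=> fZ; rewrite /word_comb map_cat -!map_comp; congr (_ ++ _); apply: eq_map => w /=.
Qed.

Fact coext_rho_ex : exists rho1 : A -> K -> K,
  star_rep rho1 /\ forall a x, rho1 a (J x) = J (map (act a) x).
Proof. exact: compl_star_rep (word_space_rep rep cc). Qed.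
Let rho1 := sval (cid coext_rho_ex).
Let srep1 : star_rep rho1 := (svalP (cid coext_rho_ex)).1.
Let rhoJ : forall a x, rho1 a (J x) = J (map (act a) x) := (svalP (cid coext_rho_ex)).2.

(** Prefixing x turns the squared norm of y into (<x,x> y, y), and the action of <x,x> is bounded by
    |x|^2. *)
Fact coext_t_ex x : exists T : K -> K, [/\ linear T,
  forall h, rnorm (T h) <= rnorm x * rnorm h &
  forall y, T (J y) = J (map (word_cons x) y)].
Proof.
apply: (@compl_lift R W W) => [|c y z v|y]; first exact: rnorm_ge0.
  by rewrite -(@ph_dotP R W) /= map_word_comb.
rewrite -(@ler_pXn2r _ 2) ?nnegrE ?mulr_ge0 ?rnorm_ge0 ?hn_ge0 // exprMn !hn_sqr.
have -> : ph_dot (map (word_cons x) y : W) (map (word_cons x) y : W) =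
    ph_dot (map (act (minner x x)) y : W) y.
  rewrite !word_spaceE !big_map; apply: eq_bigr => w _; rewrite big_map.
  by apply: eq_bigr => v _; rewrite word_dot_cons.
rewrite (le_trans (Re_le_rnorm _)) // (le_trans (CauchySchwarz _ _)) //.
rewrite -rnorm_minner -hn_sqr expr2 mulrA ler_wpM2r ?hn_ge0 //.
exact: hn_act (word_space_rep rep cc) _ _.
Qed.
Let t1 x := sval (cid (coext_t_ex x)).
Let t1P x : [/\ linear (t1 x), forall h, rnorm (t1 x h) <= rnorm x * rnorm h &
  forall y, t1 x (J y) = J (map (word_cons x) y)] := svalP (cid (coext_t_ex x)).
Fact tJ x y : t1 x (J y) = J (map (word_cons x) y). Proof. by case: (t1P x). Qed.
Fact t1_le x h : rnorm (t1 x h) <= rnorm x * rnorm h. Proof. by case: (t1P x). Qed.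
Fact t1_bounded x : bounded_op (t1 x).
Proof.
apply/bounded_opP; split; first by case: (t1P x).
by exists (rnorm x); [exact: rnorm_ge0|exact: t1_le].
Qed.

Fact coext_u_ex s : exists T : K -> K, [/\ linear T,
  forall h, rnorm (T h) <= 1 * rnorm h &
  forall y, T (J y) = J (map (word_u s) y)].
Proof.
apply: (@compl_lift R W W) => // [c y z v|y].
  by rewrite -(@ph_dotP R W) /= map_word_comb // => k w; exact: word_u_scale.
rewrite mul1r -(@ler_pXn2r _ 2) ?nnegrE ?hn_ge0 // !hn_sqr !word_spaceE big_map.
rewrite le_eqVlt; apply/orP; left; apply/eqP; congr (Re _); apply: eq_bigr => w _.
by rewrite big_map; apply: eq_bigr => v _; exact: word_dot_u.
Qed.
Let u1 s := sval (cid (coext_u_ex s)).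
Let u1P s : [/\ linear (u1 s), forall h, rnorm (u1 s h) <= 1 * rnorm h &
  forall y, u1 s (J y) = J (map (word_u s) y)] := svalP (cid (coext_u_ex s)).
Fact uJ s y : u1 s (J y) = J (map (word_u s) y). Proof. by case: (u1P s). Qed.
Fact u1_bounded s : bounded_op (u1 s).
Proof.
apply/bounded_opP; split; first by case: (u1P s).
by exists 1 => //; case: (u1P s).
Qed.

Fact J_nil : J [::] = 0.
Proof.
by apply: (dense_hdot0 J_dense) => x; rewrite hdotJ big1 // => w _; rewrite big_nil.
Qed.
Fact J_cons w x : J (w :: x) = J [:: w] + J x.
Proof.
have := J_comb 1 [:: w] x; rewrite scale1r => <-; rewrite /word_comb /=.
by rewrite /word_scale scale1r; case: w.
Qed.
Fact J_ind (P : K -> Prop) : P 0 -> (forall w h, P h -> P (J [:: w] + h)) ->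
  forall x, P (J x).
Proof.
move=> P0 PD; elim=> [|w x IH]; first by rewrite J_nil.
by rewrite J_cons; exact: PD.
Qed.
Fact J_words0 r : (forall w, hdot (J [:: w]) r = 0) -> r = 0.
Proof.
move=> Jr; apply: (dense_hdot0 J_dense).
apply: (J_ind (P := fun g => hdot g r = 0)) => [|w h hr]; first exact: hdot0l.
by rewrite hdotDl Jr hr addr0.
Qed.

Let V (h : H) : K := J [:: ([::], h)].
Fact V_isometry : isometry_op V.
Proof.
have Vd h k : hdot (V h) (V k) = hdot h k.
  by rewrite hdotJ !big_seq1 word_dot_nill.
split=> [c x y|h].
  apply: (dense_hdot_inj J_dense) => z; rewrite hdotDr hdotZr !hdotJ mulr_sumr -big_split.
  by apply: eq_bigr => w _ /=; rewrite !big_seq1 !word_dot_nilr hdotDr hdotZr.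
rewrite !normr_rnorm; congr (_%:C)%C.
by apply/eqP; rewrite -(@eqrXn2 _ 2) ?rnorm_ge0 // !rnorm_sqr Vd.
Qed.
Fact rho1V a h : rho1 a (V h) = V (rho a h). Proof. by rewrite rhoJ. Qed.
Fact u1V s h : u1 s (V h) = V (u s h). Proof. by rewrite uJ. Qed.

Fact t1_linear k x y h : t1 (k *: x + y) h = k *: t1 x h + t1 y h.
Proof.
have /(congr1 (fun f => f h)) // : t1 (k *: x + y) = (fun h => k *: t1 x h + t1 y h).
apply: (dense_eq J_dense) => [||z]; first exact: t1_bounded.
  by apply: bounded_op_comb; exact: t1_bounded.
rewrite !tJ -J_comb; apply: (@compl_embed_eq R W) => v.
rewrite (@ph_dotP R W) !word_spaceE !big_map mulr_sumr -big_split.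
apply: eq_bigr => -[l g] _ /=; rewrite mulr_sumr -big_split; apply: eq_bigr => r _ /=.
exact: (kern_cons_linear rep (size l).+1 k x y l g r).
Qed.
Fact t1D x y h : t1 (x + y) h = t1 x h + t1 y h.
Proof. by have := t1_linear 1 x y h; rewrite !scale1r. Qed.
Fact t1B x y h : t1 (x - y) h = t1 x h - t1 y h.
Proof. by have := t1_linear (-1) y x h; rewrite !scaleN1r ![- _ + _]addrC. Qed.

Fact t1_left a x h : rho1 a (t1 x h) = t1 (phi a x) h.
Proof.
have /(congr1 (fun f => f h)) // : rho1 a \o t1 x = t1 (phi a x).
apply: (dense_eq J_dense) => [||y] /=; last by rewrite !tJ rhoJ -map_comp.
  by apply: bounded_op_comp; [exact: sr_bounded srep1 _|exact: t1_bounded].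
exact: t1_bounded.
Qed.

(** The two sides come from different lists of words, which agree only after pairing: with the empty
    word by the relation for t, with a longer word because the inner product of X is A-linear. *)
Fact t1_right x a h : t1 x (rho1 a h) = t1 (mact x a) h.
Proof.
have /(congr1 (fun f => f h)) // : t1 x \o rho1 a = t1 (mact x a).
apply: (dense_eq J_dense) => [||y] /=.
- by apply: bounded_op_comp; [exact: t1_bounded|exact: sr_bounded srep1 _].
- exact: t1_bounded.
rewrite rhoJ !tJ -map_comp; apply: J_map => w [[|z l] g] /=.
  rewrite !word_dot_nilr; congr (hdot _ _).
  have E y' w' : word_eval t (word_cons y' w') = t y' (word_eval t w') by [].
  by rewrite !E (word_eval_act rep) (t_right rep).
rewrite -[(z :: l, g)]/(word_cons z (l, g)) !word_dot_cons.
by rewrite minnerMr (word_act_mul rep).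
Qed.

Fact coext_representation : representation phi rho1 t1.
Proof.
split.
- exact: sr_bounded srep1.
- exact: sr_linear srep1.
- exact: sr_mul srep1.
- by move=> a; symmetry; apply: adj_unique; exact: sr_star srep1 a.
(* Let r be orthogonal to the range of rho1. Nondegeneracy of rho makes it orthogonal to V H. For a
   word starting with y, the function y |-> (t1(y) g, r) vanishes on phi(A) X, hence on X. *)
- apply: total_rangeP => [a|r Hr]; first by case: (sr_bounded srep1 a).
  apply: J_words0 => -[[|x l] h].
    have [C C0 bV] := bounded_op_lip (isometry_bounded V_isometry).
    apply: (@total_range_zero R H A rho (fun k => hdot (V k) r) (C * rnorm r)) => //.
    + exact: rho_nondegenerate rep.
    + by move=> y z; rewrite (linD V_isometry.1) hdotDl.
    + move=> y z; rewrite -hdotBl (le_trans (hdot_CS _ _)) // mulrAC.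
      by rewrite ler_wpM2r ?rnorm_ge0.
    + by move=> a k; rewrite -rho1V Hr.
  have tw y : J [:: (y :: l, h)] = t1 y (J [:: (l, h)]) by rewrite tJ.
  rewrite tw.
  apply: (@total_range_zero R X A phi (fun y => hdot (t1 y (J [:: (l, h)])) r)
    (rnorm (J [:: (l, h)]) * rnorm r)) => //.
  + by move=> y z; rewrite t1D hdotDl.
  + move=> y z; rewrite -hdotBl -t1B (le_trans (hdot_CS _ _)) //.
    by rewrite mulrAC ler_wpM2r ?rnorm_ge0 // mulrC t1_le.
  + by move=> a y; rewrite -t1_left Hr.
- exact: t1_bounded.
- exact: t1_linear.
- exact: t1_left.
- by move=> a x h; exact: t1_right.
Qed.

Fact coext_toeplitz : toeplitz rho1 t1.
Proof.
move=> x y h; have b1 := t1_bounded.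
have /(congr1 (fun f => f h)) // : adj (t1 x) \o t1 y = rho1 (minner x y).
apply: (dense_eq J_dense) => [||z] /=.
- by apply: bounded_op_comp; [exact: adj_bounded|].
- exact: sr_bounded srep1 _.
apply: (dense_hdot_inj J_dense) => v.
rewrite -(adjP (b1 x)) !tJ rhoJ !hdotJ !big_map; apply: eq_bigr => w _.
rewrite !big_map; apply: eq_bigr => w' _.
by rewrite word_dot_cons (word_dot_adj rep) minner_star.
Qed.

(** The norm of T_X is a supremum over isometric representations, and this is one of them. *)
Fact coext_cc : completely_contractive phi t1.
Proof.
move=> n x; apply: ereal_sup_ubound; exists K, rho1, t1; split.
  by split; [exact: coext_representation|exact: coext_toeplitz].
by congr opmx_norm; apply/matrixP => i j; rewrite !mxE.
Qed.

Fact u1_mul r s h : u1 (r * s)%g h = u1 r (u1 s h).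
Proof.
have /(congr1 (fun f => f h)) // : u1 (r * s)%g = u1 r \o u1 s.
apply: (dense_eq J_dense) => [||z] /=; first exact: u1_bounded.
  by apply: bounded_op_comp; exact: u1_bounded.
by rewrite !uJ -map_comp; congr J; apply: eq_map => w; exact: word_u_mul.
Qed.

Fact u1_one h : u1 1%g h = h.
Proof.
have /(congr1 (fun f => f h)) // : u1 1%g = id.
apply: (dense_eq J_dense) => [||z] /=; first exact: u1_bounded.
  by apply/bounded_opP; split=> //; exists 1 => // x; rewrite mul1r.
by rewrite uJ (eq_map word_u1) map_id.
Qed.

(** A contraction whose inverse is a contraction is isometric. *)
Fact u1_unitary s : unitary_op (u1 s).
Proof.
have le r h : rnorm (u1 r h) <= rnorm h.
  by case: (u1P r) => _ /(_ h); rewrite mul1r.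
have inv1 h : u1 s^-1%g (u1 s h) = h by rewrite -u1_mul mulVg u1_one.
split=> [|k].
  split=> [|h]; first by case: (u1P s).
  rewrite !normr_rnorm; congr (_%:C)%C; apply/eqP; rewrite eq_le le /=.
  by rewrite -{1}(inv1 h) le.
by exists (u1 s^-1%g k); rewrite -u1_mul mulgV u1_one.
Qed.

Fact u1_t1 s x h : u1 s (t1 x h) = t1 (actX alpha s x) (u1 s h).
Proof.
have /(congr1 (fun f => f h)) // : u1 s \o t1 x = t1 (actX alpha s x) \o u1 s.
apply: (dense_eq J_dense) => [||z] /=;
  try by apply: bounded_op_comp; [exact: u1_bounded|exact: t1_bounded].
  by apply: bounded_op_comp; [exact: t1_bounded|exact: u1_bounded].
by rewrite !(tJ, uJ) -!map_comp.
Qed.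

Fact u1_rho1 s a h : u1 s (rho1 a h) = rho1 (actC alpha s a) (u1 s h).
Proof.
have rb b : bounded_op (rho1 b) by exact: sr_bounded srep1 _.
have /(congr1 (fun f => f h)) // : u1 s \o rho1 a = rho1 (actC alpha s a) \o u1 s.
apply: (dense_eq J_dense) => [||z] /=;
  try by apply: bounded_op_comp => //; exact: u1_bounded.
by rewrite !(rhoJ, uJ) -!map_comp; congr J; apply: eq_map => w /=; exact: word_u_act.
Qed.

(** The operators are isometric, so continuity on a dense set suffices. On a word it is proved
    letter by letter from u_s t1(x) = t1(alpha_s x) u_s, both factors being continuous in s. *)
Fact u1_continuous h : continuous (fun s => u1 s h).
Proof.
have iso s : forall k, rnorm (u1 s k) = rnorm k.
  by move=> k; rewrite /rnorm (u1_unitary s).1.2.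
have lu s : linear (u1 s) by case: (u1_unitary s) => -[].
apply: (dense_closed J_dense (S := [set h | continuous (fun s => u1 s h)])).
  apply/closed_rnorm => k Hk s; apply/cvg_rnorm => e e0.
  have e30 : 0 < e / 3 by rewrite divr_gt0.
  have [g /= cg kg] := Hk _ e30.
  apply: filterS (proj1 (cvg_rnorm (nbhs_filter _) _ _) (cg s) _ e30) => r gr.
  apply: le_lt_trans (rnorm_tri (u1 s g) _ _) _.
  have h1 := rnorm_tri (u1 r g) (u1 s g) (u1 r k).
  have h2 : rnorm (u1 s k - u1 s g) < e / 3 by rewrite -(linB (lu s)) iso.
  have h3 : rnorm (u1 r g - u1 r k) < e / 3 by rewrite -(linB (lu r)) iso rnormBC.
  by move: h1 h2 h3 gr; rnorm_lra.
apply: (J_ind (P := fun h => continuous (fun s => u1 s h))) => [|w g cg s].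
  move=> s; apply/cvg_rnorm => e e0; apply: nearW => r.
  by rewrite !(lin0 (lu _)) subrr rnorm0.
have cw : continuous (fun s => u1 s (J [:: w])).
  case: w => l k; elim: l => [|x l IH] r; apply/cvg_rnorm => e e0.
    have cu : continuous (fun q => u q k)  by exact: u_continuous rep_uu _.
    have n0 := proj1 (cvg_rnorm (nbhs_filter _) _ _) (cu r) _ e0.
    apply: filterS n0 => q.
    rewrite -![J [:: ([::], k)]]/(V k) !u1V.
    by rewrite -(linB V_isometry.1) {2}/rnorm V_isometry.2.
  set g' := J [:: (l, k)] in IH.
  have tw : J [:: (x :: l, k)] = t1 x g' by rewrite tJ.
  rewrite tw.
  have c0 : 0 < rnorm g' + rnorm x + 1 by rewrite ltr_wpDl // addr_ge0 ?rnorm_ge0.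
  have d0 : 0 < e / (rnorm g' + rnorm x + 1) by rewrite divr_gt0.
  have cx := @actX_continuous _ _ _ _ _ alpha x.
  have n1 := proj1 (cvg_rnorm (nbhs_filter _) _ _) (cx r) _ d0.
  have n2 := proj1 (cvg_rnorm (nbhs_filter _) _ _) (IH r) _ d0.
  near=> q.
  have k1 : rnorm (actX alpha r x - actX alpha q x) < e / (rnorm g' + rnorm x + 1).
    by near: q.
  have k2 : rnorm (u1 r g' - u1 q g') < e / (rnorm g' + rnorm x + 1) by near: q.
  rewrite !u1_t1.
  have -> : t1 (actX alpha r x) (u1 r g') - t1 (actX alpha q x) (u1 q g') =
      t1 (actX alpha r x - actX alpha q x) (u1 r g') +
      t1 (actX alpha q x) (u1 r g' - u1 q g').
    by rewrite t1B (linB (t1_bounded _).1) addrA subrK.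
  apply: le_lt_trans (rnormD _ _) _.
  apply: le_lt_trans (lerD (t1_le _ _) (t1_le _ _)) _.
  have -> : rnorm (actX alpha q x) = rnorm x by rewrite /rnorm actX_norm.
  rewrite iso; move: k1 k2 (rnorm_ge0 g') (rnorm_ge0 x); rewrite !ltr_pdivlMr //.
  move: (rnorm_ge0 (actX alpha r x - actX alpha q x)) (rnorm_ge0 (u1 r g' - u1 q g')).
  move: (rnorm g') (rnorm x) (rnorm (actX _ _ _ - _)) (rnorm (u1 _ _ - _)) => b c a d.
  by move=> a0 d0' ae de b0 xc; case: (lerP a d) => ad; nra.
apply/cvg_rnorm => e e0; have e20 : 0 < e / 2 by rewrite divr_gt0.
have n1 := proj1 (cvg_rnorm (nbhs_filter _) _ _) (cw s) _ e20.
have n2 := proj1 (cvg_rnorm (nbhs_filter _) _ _) (cg s) _ e20.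
near=> q.
rewrite !(linD (lu _)) opprD addrACA (splitr e); apply: le_lt_trans (rnormD _ _) _.
by rewrite ltrD //; near: q.
Unshelve. all: by end_near. Qed.

Fact coext_unitary : unitary_representation u1.
Proof. by split; [exact: u1_unitary|exact: u1_mul|exact: u1_continuous]. Qed.

Definition coext_rep : covariant_rep alpha :=
  CovariantRep coext_representation coext_cc coext_unitary u1_t1 u1_rho1.

(** A word paired with the empty word sees only its compression to H. This identity is the source of
    coinvariance. *)
Fact adj_t1V x h : adj (t1 x) (V h) = V (adj (t x) h).
Proof.
apply: (dense_hdot_inj J_dense) => y.
rewrite -(adjP (t1_bounded x)) tJ !hdotJ big_map; apply: eq_bigr => w _.
by rewrite !big_seq1 !word_dot_nilr -(adjP (t_bounded rep x)).
Qed.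

Fact V_closed : closed_subspace (range V).
Proof. exact: closed_image_isometry V_isometry. Qed.

Lemma coext_minimal : @minimal_isometric_coextension _ _ _ _ _ _ pi coext_rep V.
Proof.
have cv := V_closed.
have bV := isometry_bounded V_isometry.
have coinv : op_coinvariant t1 (range V).
  by move=> x _ [h _ <-]; exists (adj (t x) h) => //; rewrite adj_t1V.
split=> //=; first exact: coext_toeplitz.
  split=> //; split=> //=.
  - exact: V_isometry.
  - split=> //.
      by move=> a _ [h _ <-]; exists (rho a h) => //; rewrite rho1V.
    move=> a _ [h _ <-]; exists (rho (cstar a) h) => //.
    by rewrite -rho1V (rho_star coext_representation).
  - split=> //.
      by move=> s _ [h _ <-]; exists (u s h) => //; rewrite u1V.
    move=> s _ [h _ <-]; exists (u s^-1%g h) => //.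
    rewrite -u1V; suff -> : adj (u1 s) = u1 s^-1%g by [].
    apply: adj_unique => k g; rewrite -(isometry_hdot (u1_unitary s^-1%g).1).
    by rewrite -u1_mul mulVg u1_one.
  - exact: rho1V.
  - exact: u1V.
  (* Semi-invariance is witnessed by the whole space and the complement of H. The latter is
     invariant because H is coinvariant, and H, being closed, is its double complement. *)
  - have cO : closed_subspace (orthocompl (range V)).
      split=> [|k _|k h g Oh Og l Vl].
      + apply/closed_rnorm => h Hh l [k _ <-].
        apply: (@rnorm_small _ R[i]^o) => e e0; rewrite subr0.
        have c0 : 0 < rnorm (V k) + 1 by rewrite ltr_wpDl ?rnorm_ge0.
        have d0 : 0 < e / (rnorm (V k) + 1) by rewrite divr_gt0.
        have [g Og hg] := Hh _ d0.
        have -> : hdot h (V k) = hdot (h - g) (V k).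
          by rewrite hdotBl (Og _ (ex_intro2 _ _ k I erefl)) subr0.
        apply: le_lt_trans (hdot_CS _ _) _; move: hg; rewrite ltr_pdivlMr //.
        by have := rnorm_ge0 (h - g); move: (rnorm (h - g)) (rnorm (V k)) => *; nra.
      + by rewrite hdot0l.
      + by rewrite hdotP Oh // Og // mulr0 addr0.
    exists setT, (orthocompl (range V)); split=> //.
      split=> // x h Oh k Vk; rewrite (adjP (t1_bounded x)) Oh //; exact: coinv.
    rewrite setTI; apply/seteqP; split=> g.
      by move=> Vg k Ok; rewrite hdotC Ok ?conjC0.
    move=> Og; have [p Vp pO] := closed_projection g cv.
    have Op : orthocompl (range V) (g - p) by [].
    suff -> : g = p by [].
    apply/subr0_eq/rnorm_eq0/eqP; rewrite -sqrf_eq0 rnorm_sqr hdotBr (pO _ Vp) subr0.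
    by rewrite hdotC (Og _ Op) conjC0.
  - move=> x h; apply: hdot_inj_r => k; rewrite -(adjP bV).
    rewrite (adjPr (t1_bounded x)) adj_t1V (isometry_hdot V_isometry).
    by rewrite (adjPr (t_bounded rep x)).
(* An invariant subspace containing H contains every word, by induction on its letters, and words
   span a dense subspace. *)
move=> M [[cM M0 lM] iM _] VM; apply/seteqP; split=> // g _.
apply: (dense_closed J_dense cM) g.
apply: J_ind => // -[l h] g Mg; rewrite -[J _]scale1r; apply: lM => //.
elim: l => [|x l IH]; first by apply: VM; exists h.
by have := iM x _ IH; rewrite /= tJ.
Qed.

End Coextension.

(** * Uniqueness *)

Lemma closure_bounded_op (R : realType) (H K : hilbertType R) (T : H -> K)
    (S : set H) (S' : set K) :
  bounded_op T -> (forall h, S h -> S' (T h)) -> forall h, closure S h -> closure S' (T h).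
Proof.
move=> bT ST h /closureP Sh; apply/closureP => e e0.
have [C C0 TC] := bounded_op_lip bT.
have C1 : 0 < C + 1 by rewrite ltr_wpDl.
have d0 : 0 < e / (C + 1) by rewrite divr_gt0.
have [k Sk hk] := Sh _ d0; exists (T k); first exact: ST.
apply: le_lt_trans (TC _ _) _; move: hk; rewrite ltr_pdivlMr //.
by move: (rnorm_ge0 (h - k)); move: (rnorm _) => a; nra.
Qed.

Section WordVectors.
Variables (R : realType) (A : cstarType R) (X : hilbertModType A).
Variables (phi : correspondence X) (G : topologicalGroupType).
Variables (alpha : gauge_action phi G) (pi pi1 : covariant_rep alpha).
Variable V : rep_space pi -> rep_space pi1.
Hypothesis mic : minimal_isometric_coextension V.

Let H := rep_space pi.
Let rho := @rep_rho _ _ _ _ _ _ pi.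
Let t := @rep_t _ _ _ _ _ _ pi.
Let rep : representation phi rho t := rep_representation pi.
Let K := rep_space pi1.
Let rho1 := @rep_rho _ _ _ _ _ _ pi1.
Let t1 := @rep_t _ _ _ _ _ _ pi1.
Let rep1 : representation phi rho1 t1 := rep_representation pi1.
Let iso1 : toeplitz rho1 t1. Proof. by case: mic. Qed.
Let dilV : dilation V. Proof. by case: mic => _ []. Qed.
Let isoV : isometry_op V. Proof. exact: dil_isometry dilV. Qed.
Let lt1 x : linear (t1 x). Proof. exact: t_lin rep1 x. Qed.

Definition word_vec (w : word X H) : K := foldr t1 (V w.2) w.1.
Definition word_sum (y : seq (word X H)) : K := \sum_(w <- y) word_vec w.

(** Coinvariance puts the left side in the range of V; the preimage is then identified by
    compressing t1 to t. *)
Lemma adj_t_coextension x h : adj (t1 x) (V h) = V (adj (t x) h).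
Proof.
have [_ [_ coV] _] := mic.
have [k _ e] := coV x (V h) (ex_intro2 _ _ h I erefl).
rewrite -/t1 in e; rewrite -e; congr V; apply: hdot_inj_r => g.
rewrite -(isometry_hdot isoV) e -(adjP (t_bounded rep1 x)).
rewrite -(adjP (t_bounded rep x)) -[t x g](dil_t dilV).
by rewrite (adjPr (isometry_bounded isoV)).
Qed.

Lemma word_vec_act a w : rho1 a (word_vec w) = word_vec (word_act phi rho a w).
Proof.
case: w => [[|x l] h]; rewrite /word_vec /word_act /=; first exact: dil_rho dilV _ _.
exact: t_left rep1 _ _ _.
Qed.

Lemma word_vec_scale k w : word_vec (word_scale k w) = k *: word_vec w.
Proof.
case: w => l h; rewrite /word_vec /word_scale /=.
by elim: l => [|x l /= ->]; rewrite /= ?(linZ isoV.1) // (linZ (lt1 _)).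
Qed.

Lemma word_vec_u s w : rep_u s (word_vec w) = word_vec (word_u s w).
Proof.
case: w => l h; rewrite /word_vec /word_u /=.
by elim: l => [|x l /= <-]; [exact: dil_u dilV _ _|exact: rep_cov_t].
Qed.

Lemma hdot_word_vec w v : hdot (word_vec w) (word_vec v) = word_dot phi rho t w v.
Proof.
(* Letters cross to the left as adjoints, which never leave the range of V. *)
have nilE h l k : hdot (V h) (word_vec (l, k)) = hdot h (word_eval t (l, k)).
  elim: l h => [|x l IH] h; first by rewrite (isometry_hdot isoV).
  rewrite /word_vec /= -/(word_vec (l, k)) (adjPr (t_bounded rep1 x)).
  by rewrite adj_t_coextension IH -(adjPr (t_bounded rep x)).
have [n sw] := ubnP (size w.1).
elim: n w v sw => // n IH [[|x l] h] [[|y r] k] /= sw.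
- by rewrite word_dot_nill nilE.
- by rewrite word_dot_nill nilE.
- by rewrite word_dot_nilr hdotC nilE -hdotC.
rewrite -[(x :: l, h)]/(word_cons x (l, h)) -[(y :: r, k)]/(word_cons y (r, k)).
rewrite word_dot_cons -IH ?word_act_size // -word_vec_act.
exact: toeplitz_hdot rep1 iso1 _ _ _ _.
Qed.

Lemma word_sum_comb c x y : word_sum (word_comb c x y) = c *: word_sum x + word_sum y.
Proof.
rewrite /word_sum big_cat big_map scaler_sumr; congr (_ + _).
by apply: eq_bigr => w _; rewrite word_vec_scale.
Qed.

Lemma hdot_word_sum x y : hdot (word_sum x) (word_sum y) =
  \sum_(w <- x) \sum_(v <- y) word_dot phi rho t w v.
Proof.
rewrite hdot_suml; apply: eq_bigr => w _; rewrite hdot_sumr.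
by apply: eq_bigr => v _; exact: hdot_word_vec.
Qed.

Lemma word_sum_map (T : K -> K) (f : word X H -> word X H) : linear T ->
  (forall w, T (word_vec w) = word_vec (f w)) ->
  forall y, T (word_sum y) = word_sum (map f y).
Proof.
move=> lT Tf y; rewrite /word_sum (lin_sum lT) big_map.
by apply: eq_bigr => w _; rewrite Tf.
Qed.

Lemma word_sum_t x y : t1 x (word_sum y) = word_sum (map (word_cons x) y).
Proof. exact: word_sum_map (lt1 x) _ _. Qed.

(** Minimality applies because the closed span of the words reduces t1. *)
Lemma word_sum_dense : dense_map word_sum.
Proof.
have [_ _ min] := mic.
have clT : closure (range word_sum) = setT.
  apply: min.
    split.
    - apply: closed_subspace_closure; first by exists [::] => //; rewrite /word_sum big_nil.
      move=> c _ _ [x _ <-] [y _ <-]; exists (word_comb c x y) => //.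
      exact: word_sum_comb.
    - move=> x; apply: closure_bounded_op (t_bounded rep1 x) _ => _ [y _ <-].
      by exists (map (word_cons x) y) => //; rewrite -word_sum_t.
    - move=> x; apply: closure_bounded_op (adj_bounded (t_bounded rep1 x)) _ => _ [y _ <-].
      (* The adjoint of t1(x) maps words to words: the Toeplitz relation replaces a first letter z
         by the action of <x,z>, and the empty word is covered by coinvariance. *)
      pose f (w : word X H) : word X H := if w.1 is z :: l
        then word_act phi rho (minner x z) (l, w.2) else ([::], adj (t x) w.2).
      exists (map f y) => //; symmetry.
      apply: (word_sum_map (adj_linear (t_bounded rep1 x))).
      move=> [[|z l] h]; rewrite /f /=; first exact: adj_t_coextension.
      by rewrite -word_vec_act; exact: iso1.
  move=> _ [h _ <-]; apply: subset_closure; exists [:: ([::], h)] => //.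
  by rewrite /word_sum big_seq1.
move=> h e e0; have : closure (range word_sum) h by rewrite clT.
by move=> /closureP/(_ e e0)[_ [y _ <-] hy]; exists y.
Qed.

End WordVectors.

Lemma minimal_coextension_unique (R : realType) (A : cstarType R)
    (X : hilbertModType A) (phi : correspondence X) (G : topologicalGroupType)
    (alpha : gauge_action phi G) (pi pi1 pi2 : covariant_rep alpha)
    (V1 : rep_space pi -> rep_space pi1) (V2 : rep_space pi -> rep_space pi2) :
  minimal_isometric_coextension V1 -> minimal_isometric_coextension V2 ->
  unitarily_equivalent V1 V2.
Proof.
move=> mic1 mic2; set J1 := word_sum V1; set J2 := word_sum V2.
have dJ1 : dense_map J1 by exact: word_sum_dense.
have dJ2 : dense_map J2 by exact: word_sum_dense.
have nJ x : rnorm (J2 x) = rnorm (J1 x).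
  by apply/eqP; rewrite -(@eqrXn2 _ 2) ?rnorm_ge0 // !rnorm_sqr !hdot_word_sum.
have [W [lW W1 WJ]] : exists W : rep_space pi1 -> rep_space pi2,
    [/\ linear W, forall h, rnorm (W h) <= 1 * rnorm h & forall x, W (J1 x) = J2 x].
  apply: (dense_extension (comb := @word_comb _ _ _ _)) => // [c x y|c x y|x].
  - exact: word_sum_comb.
  - exact: word_sum_comb.
  - by rewrite mul1r nJ.
have bW : bounded_op W by apply/bounded_opP; split=> //; exists 1.
(* The extension gives only a contraction. Equality follows from adj(W) W = id, which holds on sums
   of words since both families have the same Gram matrix. *)
have nW h : rnorm (W h) = rnorm h.
  have adjWW : adj W \o W = id.
    apply: (dense_eq dJ1) => [||x] /=.
    - by apply: bounded_op_comp => //; exact: adj_bounded.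
    - by apply/bounded_opP; split=> //; exists 1 => // x; rewrite mul1r.
    by apply: (dense_hdot_inj dJ1) => y; rewrite -(adjP bW) !WJ !hdot_word_sum.
  apply/eqP; rewrite -(@eqrXn2 _ 2) ?rnorm_ge0 // !rnorm_sqr (adjP bW).
  by rewrite -[adj W _]/((adj W \o W) h) adjWW.
have isoW : isometry_op W by split=> // h; rewrite !normr_rnorm nW.
have WV h : W (V1 h) = V2 h.
  by have := WJ [:: ([::], h)]; rewrite /J1 /J2 /word_sum !big_seq1.
(* Operators acting on the words of both coextensions by the same map f are intertwined by W; this
   covers rho, t and u. *)
have inter (T1 : rep_space pi1 -> rep_space pi1) (T2 : rep_space pi2 -> rep_space pi2)
    (f : word X (rep_space pi) -> word X (rep_space pi)) :
    bounded_op T1 -> bounded_op T2 ->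
    (forall w, T1 (word_vec V1 w) = word_vec V1 (f w)) ->
    (forall w, T2 (word_vec V2 w) = word_vec V2 (f w)) ->
    forall h, W (T1 h) = T2 (W h).
  move=> b1 b2 f1 f2 h; have /(congr1 (fun g => g h)) // : W \o T1 = T2 \o W.
  apply: (dense_eq dJ1) => [||y] /=; try exact: bounded_op_comp.
  by rewrite (word_sum_map b1.1 f1) !WJ (word_sum_map b2.1 f2).
have ub (p : covariant_rep alpha) s : bounded_op (@rep_u _ _ _ _ _ _ p s).
  by apply: isometry_bounded; case: (u_unitary (rep_unitary p) s).
exists W; split=> //.
- split=> // k; have [clW _ _] := closed_image_isometry isoW.
  have [h _ <-] : range W k; last by exists h.
  by apply: (dense_closed dJ2 clW) => x; exists (J1 x).
- move=> a; apply: inter.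
  + exact: rho_bounded (rep_representation pi1) a.
  + exact: rho_bounded (rep_representation pi2) a.
  + exact: word_vec_act mic1 a.
  + exact: word_vec_act mic2 a.
- move=> x; apply: (inter _ _ (word_cons x)) => //.
  + exact: t_bounded (rep_representation pi1) x.
  + exact: t_bounded (rep_representation pi2) x.
- move=> s; apply: inter => //.
  + exact: word_vec_u mic1 s.
  + exact: word_vec_u mic2 s.
Qed.

Theorem theorem4p6 (R : realType) (A : cstarType R) (X : hilbertModType A)
    (phi : correspondence X) (phi_nondegenerate : nondegenerate_correspondence phi)
    (G : topologicalGroupType) (G_locally_compact : locally_compact [set: G])
    (G_hausdorff : hausdorff_space G)
    (alpha : gauge_action phi G) (pi : covariant_rep alpha) :
  (exists (pi1 : covariant_rep alpha) (V : rep_space pi -> rep_space pi1),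
     minimal_isometric_coextension V) /\
  (forall (pi1 pi2 : covariant_rep alpha)
          (V1 : rep_space pi -> rep_space pi1)
          (V2 : rep_space pi -> rep_space pi2),
     minimal_isometric_coextension V1 -> minimal_isometric_coextension V2 ->
     unitarily_equivalent V1 V2).
Proof.
split; last by move=> pi1 pi2 V1 V2; exact: minimal_coextension_unique.
have min := coext_minimal phi_nondegenerate pi.
by exists (coext_rep phi_nondegenerate pi); eexists; exact: min.
Qed.
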